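(* Let $X$ be a normed linear space, $Y$ a Banach space, and $k\in\mathbb N\cup\{\infty\}$ such that the pair $(X,Y)$ has property (LA$_k$). Suppose that $U\subset X$ is one of the following types: (a) $U$ is an image of an open convex bounded set under a bi-Lipschitz automorphism of $X$; (b) $U$ is a Lipschitz domain in $X$. Let $f\in C^1(U;Y)$ and suppose that the mapping $Df\colon U\to\mathcal L(X;Y)$ has a continuous extension $G\colon\overline U\to\mathcal L(X;Y)$. Then $f$ can be extended to a mapping $g\in C^1(X;Y)$ such that $g$ is $C^k$-smooth on $X\setminus\overline U$. Moreover, if (a) holds and $f$ is Lipschitz, then one can additionally assert that $g$ is Lipschitz.
   Context: All normed linear spaces are real. $U_X$ is the open unit ball of $X$. An $L$-Lipschitz mapping is a mapping with a (not necessarily minimal) Lipschitz constant $L$. $\mathcal L(X;Y)$ is the normed space of continuous linear operators from $X$ to $Y$. $Df$ is the Fréchet derivative. For open $\Omega\subset X$, $C^k(\Omega;Y)$ is the space of $C^k$-smooth (in the Fréchet sense) mappings from $\Omega$ to $Y$. A bi-Lipschitz automorphism of $X$ is a (not necessarily linear) bi-Lipschitz bijection of $X$ onto $X$. $E\oplus_\infty\mathbb R$ is the direct sum with the maximum norm. Lipschitz domain: an open non-empty subset $G$ of a normed linear space $X$ is a Lipschitz domain in $X$ if for each $a\in\partial G$ there exist an open neighbourhood $V$ of $a$, a normed linear space $E$, and a bi-Lipschitz mapping $\Phi$ of $V$ onto $U_E\times(-1,1)\subset E\oplus_\infty\mathbb R$ such that $\Phi(G\cap V)=U_E\times(0,1)$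 and $\Phi(\partial G\cap V)=U_E\times\{0\}$. Property (LA$_k$), $k\in\mathbb N\cup\{\infty\}$: the pair $(X,Y)$ of normed linear spaces has property (LA$_k$) if there is $C\ge0$ such that for any $L$-Lipschitz mapping $f\colon U_X\to Y$ and any $\varepsilon>0$ there is a $CL$-Lipschitz mapping $g\in C^k(U_X;Y)$ such that $\sup_{U_X}\|f-g\|\le\varepsilon$. *)

(* Defs.v *)
(* Mathematical Components / MathComp-Analysis *)
From HB Require Import structures.
From mathcomp Require Import all_boot all_order all_algebra.
From mathcomp Require Import all_classical all_reals all_analysis.

Set Implicit Arguments.
Unset Strict Implicit.
Unset Printing Implicit Defensive.

Import Order.TTheory GRing.Theory Num.Theory.
Import numFieldNormedType.Exports.

Local Open Scope classical_set_scope.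
Local Open Scope ring_scope.

Section ContinuousOperators.
Context {R : realType} (X Y : normedModType R).

Definition continuous_linear : {pred X -> Y} :=
  [pred f : X -> Y | `[< linear f /\ continuous f >]].

Lemma continuous_linearP (f : X -> Y) :
  reflect (linear f /\ continuous f) (f \in continuous_linear).
Proof. exact: asboolP. Qed.

Fact continuous_linear_submod : submod_closed continuous_linear.
Proof.
split.
  apply/continuous_linearP; split=> [a x y|x]; last exact: cst_continuous.
  by rewrite -[LHS]/(0 : Y) -[RHS]/(a *: (0 : Y) + 0) scaler0 addr0.
move=> a f g /continuous_linearP[lf cf] /continuous_linearP[lg cg].
apply/continuous_linearP; split=> [b x y|x].
  rewrite -[LHS]/(a *: f (b *: x + y) + g (b *: x + y)) lf lg.
  rewrite -[RHS]/(b *: (a *: f x + g x) + (a *: f y + g y)).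
  by rewrite !scalerDr !scalerA (mulrC a b) addrACA.
by apply: cvgD; [apply: cvgZr; exact: cf|exact: cg].
Qed.

HB.instance Definition _ := GRing.isSubmodClosed.Build R (X -> Y)
  continuous_linear continuous_linear_submod.

Record clinear :=
  CLinear { clinear_fun :> X -> Y ; _ : clinear_fun \in continuous_linear }.

HB.instance Definition _ := [isSub for clinear_fun].
HB.instance Definition _ := [Choice of clinear by <:].
HB.instance Definition _ := [SubChoice_isSubLmodule of clinear by <:].

Lemma clinear_linear (T : clinear) : linear T.
Proof. by case: T => T /= /continuous_linearP[]. Qed.

Lemma clinear_continuous (T : clinear) : continuous T.
Proof. by case: T => T /= /continuous_linearP[]. Qed.

HB.instance Definition _ (T : clinear) :=
  GRing.isLinear.Build R X Y *:%R T (clinear_linear T).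

Definition opnorm (T : clinear) : R :=
  sup [set `|T x| | x in [set x : X | `|x| <= 1]].

Lemma opnorm_has_sup (T : clinear) :
  has_sup [set `|T x| | x in [set x : X | `|x| <= 1]].
Proof.
split; first by exists `|T 0|, 0 => //=; rewrite normr0.
have [M TM] := (bounded_funP T).2
  ((linear_bounded_continuous T).2 (@clinear_continuous T)) 1.
by exists M => _ [x x1 <-]; exact: TM.
Qed.

Lemma le_opnorm (T : clinear) (x : X) : `|T x| <= opnorm T * `|x|.
Proof.
have [->|x0] := eqVneq x 0; first by rewrite linear0 !normr0 mulr0.
have nx0 : 0 < `|x| by rewrite normr_gt0.
rewrite -ler_pdivrMr// mulrC -[X in X * _](@ger0_norm _ `|x|^-1) ?invr_ge0//.
rewrite -normrZ -linearZ/=; apply: (sup_upper_bound (opnorm_has_sup T)).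
by exists (`|x|^-1 *: x) => //=; rewrite normrZ normfV normr_id mulVf ?gt_eqF.
Qed.

Lemma opnorm_le (T : clinear) (M : R) : 0 <= M ->
  (forall x, `|T x| <= M * `|x|) -> opnorm T <= M.
Proof.
move=> M0 TM; apply: ge_sup; first by case: (opnorm_has_sup T).
by move=> _ [x /= x1 <-]; rewrite (le_trans (TM x))// ler_piMr.
Qed.

Lemma opnorm_ge0 (T : clinear) : 0 <= opnorm T.
Proof.
apply: (sup_upper_bound (opnorm_has_sup T)).
by exists 0 => /=; rewrite ?normr0// linear0 normr0.
Qed.

Fact opnormD (S T : clinear) : opnorm (S + T) <= opnorm S + opnorm T.
Proof.
apply: opnorm_le => [|x]; first by rewrite addr_ge0 ?opnorm_ge0.
by rewrite mulrDl (le_trans (ler_normD _ _))// lerD ?le_opnorm.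
Qed.

Fact opnormZ (a : R) (T : clinear) : opnorm (a *: T) = `|a| * opnorm T.
Proof.
have leZ (b : R) S : opnorm (b *: S) <= `|b| * opnorm S.
  apply: opnorm_le => [|x]; first by rewrite mulr_ge0 ?opnorm_ge0.
  by rewrite -mulrA -[leLHS]/(`|b *: S x|) normrZ ler_wpM2l ?le_opnorm.
apply/eqP; rewrite eq_le leZ /=; have [->|a0] := eqVneq a 0.
  by rewrite normr0 mul0r opnorm_ge0.
have := leZ a^-1 (a *: T).
by rewrite scalerA mulVf// scale1r normfV ler_pdivlMl ?normr_gt0.
Qed.

Fact opnorm0_eq0 (T : clinear) : opnorm T = 0 -> T = 0.
Proof.
move=> T0; apply/val_inj/funext => x /=; apply/eqP.
by rewrite -normr_le0 (le_trans (le_opnorm T x))// T0 mul0r.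
Qed.

HB.instance Definition _ :=
  Lmodule_isNormed.Build R clinear opnormD opnormZ opnorm0_eq0.

End ContinuousOperators.

Notation "''L' ( X ; Y )" := (clinear X Y)
  (at level 8, format "''L' ( X ;  Y )") : type_scope.

(* Maps defined on an open set Omega are represented by total functions, whose
   values outside Omega are irrelevant. *)
Fixpoint Cn {R : realType} {X : normedModType R} (n : nat) :
    forall Y : normedModType R, set X -> (X -> Y) -> Prop :=
  if n is m.+1 then fun Y Omega f =>
    exists Df : X -> 'L(X; Y),
      (forall x, Omega x -> is_diff x f (Df x)) /\ Cn m Omega Df
  else fun Y Omega f => {in Omega, continuous f}.

Variant smoothness := Cfinite of nat | Cinfinity.

Definition Ck {R : realType} {X Y : normedModType R} (k : smoothness)
    (Omega : set X) (f : X -> Y) : Prop :=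
  match k with
  | Cfinite n => Cn n Omega f
  | Cinfinity => forall n, Cn n Omega f
  end.

Definition property_LA {R : realType} (k : smoothness)
    (X Y : normedModType R) : Prop :=
  exists2 C : R, 0 <= C &
    forall (L : R) (f : X -> Y) (eps : R),
      0 <= L -> L.-lipschitz_(ball (0 : X) 1) f -> 0 < eps ->
      exists g : X -> Y,
        [/\ (C * L).-lipschitz_(ball (0 : X) 1) g,
            Ck k (ball (0 : X) 1) g &
            forall x, ball (0 : X) 1 x -> `|f x - g x| <= eps].

Definition bilipschitz {R : realType} {V W : normedModType R}
    (A : set V) (Phi : V -> W) : Prop :=
  [lipschitz Phi x | x in A] /\
  exists2 Psi : W -> V, {in A, cancel Phi Psi} &
    [lipschitz Psi y | y in Phi @` A].

Definition bilipschitz_automorphism {R : realType} {X : normedModType R}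
    (Phi : X -> X) : Prop :=
  bilipschitz setT Phi /\ Phi @` setT = setT.

Definition bilipschitz_convex_image {R : realType} {X : normedModType R}
    (U : set X) : Prop :=
  exists (Phi : X -> X) (C : set X),
    [/\ bilipschitz_automorphism Phi, open C, convex_set C, bounded_set C &
        U = Phi @` C].

Definition boundary {T : topologicalType} (A : set T) : set T :=
  closure A `\` interior A.

(* The norm of the product E * R^o is the maximum norm. *)
Definition lipschitz_domain {R : realType} {X : normedModType R}
    (G : set X) : Prop :=
  [/\ open G, G !=set0 &
    forall a, boundary G a ->
      exists (V : set X) (E : normedModType R) (Phi : X -> E * R^o),
        [/\ open V /\ V a,
            bilipschitz V Phi,
            Phi @` V = ball (0 : E) 1 `*` `](-1), 1[%classic,
            Phi @` (G `&` V) = ball (0 : E) 1 `*` `]0, 1[%classic &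
            Phi @` (boundary G `&` V) = ball (0 : E) 1 `*` [set 0]]].

(* Main.v *)
(* The idea is to extend [f] across the boundary by a Lipschitz reflection and to smooth
   the extension off [closure U].

   Near a boundary point [a], points of [U] are joined in [U] by curves of comparable
   length, so by the mean value inequality and the continuity of [G] the map [f - G a] is
   [e]-Lipschitz on [U] near [a] for every [e > 0]. In particular [f] extends to
   [closure U]. For [z] outside [closure U] let [rho z] be the reflection of [z] into [U];
   it has depth comparable to [|z - rho z|], so for a fixed small [t > 0] the point
   [sigma z = rho z + t (z - rho z)] is also in [U]. Then
     [F z = f (rho z) + (f (sigma z) - f (rho z)) / t]
   is built from values of [f] at points depending on [z] in a Lipschitz way, and the same
   formula reproduces every linear map; hence [F - G a] is [C e]-Lipschitz off [closure U]
   near [a].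

   Off [closure U], [F] is replaced by a C^k map [g] as follows: on small balls [F - T] is
   smoothed by (LA_k), [T] being a linear map nearly minimizing the local Lipschitz
   constant of [F - T], and the pieces are glued by a C^k partition of unity, which exists
   by (LA_k), Hahn-Banach and Stone's argument for the paracompactness of metric spaces.
   Then [D g] tends to [G a] at [a], so that [g] is C^1 up to the boundary. For Lipschitz
   domains the reflection is only local, and the local extensions are glued by another
   partition of unity. *)

(* Two obstacles shape the construction. The natural candidate f(rho z) + G(rho z)(z - rho z) need
   not be Lipschitz in z, because [G] is only continuous. The difference quotient with a fixed [t]
   is Lipschitz, at the price of keeping [sigma z] inside [U]. Moreover (LA_k) controls Lipschitz
   constants, not derivatives. So off the closure F is measured only by local Lipschitz constants of
   F minus a linear map: these survive smoothing up to the factor [C], and they bound the derivative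
   of a smooth result. A centre z does not know the boundary point a with which it will be compared.
   A near-optimal T z solves this: its constant is at most that of [G a] plus a tolerance, and T z
   then differs from [G a] by at most the sum of the two constants. The tolerance at z, which also
   bounds the distance from g to F, is the square of a radius smaller than the distance to the
   closure. Near a it is O(|y - a|^2), so that g and F have the same derivative at a, and it tends
   to 0, so that D g tends to [G a]. *)
From HB Require Import structures.
Require Import Defs.
From mathcomp Require Import all_boot all_order all_algebra.
From mathcomp Require Import all_classical all_reals all_analysis.
From mathcomp Require Import ssrAC ring lra.
From mathcomp Require wochoice.
Set Implicit Arguments.
Unset Strict Implicit.
Unset Printing Implicit Defensive.

Import Order.TTheory GRing.Theory Num.Theory.
Import numFieldNormedType.Exports.

Local Open Scope classical_set_scope.
Local Open Scope ring_scope.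

(** * Identities in modules, by reflection *)

Section ModuleReflection.
Context {R : comNzRingType} {V : lmodType R}.

Inductive module_expr :=
  | MVar of nat
  | MZero
  | MAdd of module_expr & module_expr
  | MOpp of module_expr
  | MScale of R & module_expr.

Fixpoint module_eval (env : seq V) (e : module_expr) : V :=
  match e with
  | MVar i => nth 0 env i
  | MZero => 0
  | MAdd e1 e2 => module_eval env e1 + module_eval env e2
  | MOpp e1 => - module_eval env e1
  | MScale a e1 => a *: module_eval env e1
  end.

Fixpoint module_coef (i : nat) (e : module_expr) : R :=
  match e with
  | MVar j => if j == i then 1 else 0
  | MZero => 0
  | MAdd e1 e2 => module_coef i e1 + module_coef i e2
  | MOpp e1 => - module_coef i e1
  | MScale a e1 => a * module_coef i e1
  end.

Lemma module_evalE env e :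
  module_eval env e = \sum_(i < size env) module_coef i e *: nth 0 env i.
Proof.
elim: e => [j||e1 IH1 e2 IH2|e1 IH1|a e1 IH1] /=.
- have [jn|nj] := ltnP j (size env).
    rewrite (bigD1 (Ordinal jn))//= eqxx scale1r big1 ?addr0// => i ij.
    by rewrite eq_sym (negPf (_ : i != j :> nat)) ?scale0r.
  rewrite nth_default// big1// => i _.
  by rewrite gtn_eqF ?scale0r// (leq_trans (ltn_ord i)).
- by rewrite big1// => i _; rewrite scale0r.
- by rewrite IH1 IH2 -big_split; apply: eq_bigr => i _; rewrite scalerDl.
- by rewrite IH1 -sumrN; apply: eq_bigr => i _; rewrite scaleNr.
- by rewrite IH1 scaler_sumr; apply: eq_bigr => i _; rewrite scalerA.
Qed.

(** A conjunction rather than a quantified statement, so that on a concrete environment it unfolds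
    into finitely many scalar identities for [ring]. *)
Fixpoint module_agree (n : nat) (e1 e2 : module_expr) : Prop :=
  if n is m.+1 then module_coef m e1 = module_coef m e2 /\ module_agree m e1 e2 else True.

Lemma module_eval_eq env e1 e2 : module_agree (size env) e1 e2 ->
  module_eval env e1 = module_eval env e2.
Proof.
move=> agree; rewrite !module_evalE; apply: eq_bigr => i _; congr (_ *: _).
move: (ltn_ord i) agree; move: (size env) (nat_of_ord i) => n j.
by elim: n => // n IHn; rewrite ltnS leq_eqVlt => /predU1P[->|/IHn IH] [? ?]; [|exact: IH].
Qed.

End ModuleReflection.

Ltac module_mem x env :=
  lazymatch env with
  | nil => constr:(false)
  | cons ?y ?s =>
    match x with
    | y => constr:(true)
    | _ => module_mem x s
    end
  end.

Ltac module_env e env :=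
  lazymatch e with
  | ?a + ?b => let env := module_env a env in module_env b env
  | - ?a => module_env a env
  | _ *: ?a => module_env a env
  | 0 => env
  | ?x =>
    lazymatch module_mem x env with
    | true => env
    | false => constr:(cons x env)
    end
  end.

Ltac module_index x env :=
  lazymatch env with
  | cons ?y ?s =>
    match x with
    | y => constr:(0%N)
    | _ => let n := module_index x s in constr:(S n)
    end
  end.

Ltac module_reify R e env :=
  lazymatch e with
  | ?a + ?b =>
    let a := module_reify R a env in
    let b := module_reify R b env in constr:(@MAdd R a b)
  | - ?a => let a := module_reify R a env in constr:(@MOpp R a)
  | ?k *: ?a => let a := module_reify R a env in constr:(@MScale R k a)
  | 0 => constr:(@MZero R)
  | ?x => let n := module_index x env in constr:(@MVar R n)
  end.

(* Reduces an equality in a module over [R] to ring identities between coefficients. *)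
Ltac module R :=
  lazymatch goal with
  | |- @eq ?V ?a ?b =>
    let env := module_env a (@nil V) in
    let env := module_env b env in
    let ea := module_reify R a env in
    let eb := module_reify R b env in
    refine (@module_eval_eq R _ env ea eb _);
    cbn [size module_agree module_coef eqn eq_op Equality.eqtype_hasDecEq_mixin hasDecEq.eq_op
         Datatypes_nat__canonical__eqtype_Equality];
    repeat split; rewrite /=; ring
  end.

(** * Epsilon-delta forms of neighbourhoods, openness and continuity *)

Section Metric.
Context {R : realType}.
Implicit Types X Y : normedModType R.

Lemma ballP X (x y : X) (r : R) : ball x r y <-> `|y - x| < r.
Proof. by rewrite -ball_normE /= distrC. Qed.

Lemma near_ballP X (x : X) (P : X -> Prop) :
  (\forall y \near x, P y) <-> exists2 d : R, 0 < d & forall y, `|y - x| < d -> P y.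
Proof.
split=> [/nbhs_ballP[d /= d0 H]|[d d0 H]].
  by exists d => // y /ballP; exact: H.
by apply/nbhs_ballP; exists d => //= y /ballP; exact: H.
Qed.

Lemma open_ballP X (O : set X) :
  open O <-> forall x, O x -> exists2 d : R, 0 < d & forall y, `|y - x| < d -> O y.
Proof.
rewrite openE; split=> H x Ox; last by apply/near_ballP; exact: H.
by apply/near_ballP; exact: H.
Qed.

Lemma open_nearby X (x : X) (r : R) : open [set y | `|y - x| < r].
Proof.
apply/open_ballP => y /= yr; exists (r - `|y - x|); first by rewrite subr_gt0.
move=> z zy; rewrite -(subrK y z) -addrA.
by rewrite (le_lt_trans (ler_normD _ _))// -ltrBrDr.
Qed.

Lemma continuous_atP X Y (f : X -> Y) (x : X) :
  {for x, continuous f} <->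
  forall e, 0 < e -> \forall y \near x, `|f y - f x| < e.
Proof.
split=> [/cvgrPdist_lt H e e0|H].
  by have := H _ e0; apply: filterS => y; rewrite distrC.
apply/cvgrPdist_lt => e e0; have := H _ e0.
by apply: filterS => y; rewrite distrC.
Qed.

Lemma norm_dist_trans X (x y z : X) (r s : R) :
  `|x - y| < r -> `|y - z| < s -> `|x - z| < r + s.
Proof.
by move=> xy yz; rewrite -(subrKA y) (le_lt_trans (ler_normD _ _))// ltrD.
Qed.

End Metric.

(** * Continuous operators and an epsilon form of differentiability *)

Section ContinuousLinear.
Context {R : realType}.
Implicit Types X Y Z W : normedModType R.

Lemma bounded_continuous_linear X Y (f : X -> Y) (M : R) :
  linear f -> (forall x, `|f x| <= M * `|x|) -> f \in @continuous_linear R X Y.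
Proof.
move=> lf fM; apply/continuous_linearP; split=> // x.
pose L := GRing.isLinear.Build R X Y *:%R f lf.
pose g : {linear X -> Y} := HB.pack f L.
have gE : g = f :> (X -> Y) by [].
rewrite -gE; apply: bounded_linear_continuous; apply/bounded_funP => r.
exists (`|M| * r) => y yr; apply: le_trans (fM y) _.
apply: le_trans (ler_wpM2l (normr_ge0 M) yr).
by rewrite ler_wpM2r// ler_norm.
Qed.

(* The zero map when [f] is not continuous and linear. *)
Definition to_clinear X Y (f : X -> Y) : 'L(X; Y) :=
  if pselect (f \in @continuous_linear R X Y) is left h then CLinear h else 0.

Lemma to_clinearE X Y (f : X -> Y) : f \in @continuous_linear R X Y ->
  to_clinear f = f :> (X -> Y).
Proof. by rewrite /to_clinear; case: pselect. Qed.

Lemma clinear_ext X Y (S T : 'L(X; Y)) : (forall x, S x = T x) -> S = T.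
Proof. by move=> ST; apply/val_inj/funext. Qed.

Lemma clinearD X Y (S T : 'L(X; Y)) x : (S + T) x = S x + T x.
Proof. by []. Qed.

Lemma clinearN X Y (T : 'L(X; Y)) x : (- T) x = - T x.
Proof. by []. Qed.

Lemma clinearB X Y (S T : 'L(X; Y)) x : (S - T) x = S x - T x.
Proof. by []. Qed.

Lemma clinearZ X Y (a : R) (T : 'L(X; Y)) x : (a *: T) x = a *: T x.
Proof. by []. Qed.

Lemma clinear0 X Y x : (0 : 'L(X; Y)) x = 0.
Proof. by []. Qed.

Lemma clinear_mapD X Y (T : 'L(X; Y)) x y : T (x + y) = T x + T y.
Proof. exact: linearD. Qed.

Lemma clinear_mapN X Y (T : 'L(X; Y)) x : T (- x) = - T x.
Proof. exact: linearN. Qed.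

Lemma clinear_mapZ X Y (T : 'L(X; Y)) a x : T (a *: x) = a *: T x.
Proof. exact: linearZ. Qed.

Definition clinearE := (@clinearD, @clinearN, @clinearB, @clinearZ, @clinear0,
  @clinear_mapD, @clinear_mapN, @clinear_mapZ).

Lemma le_norm X Y (T : 'L(X; Y)) x : `|T x| <= `|T| * `|x|.
Proof. exact: le_opnorm. Qed.

(** The remainder as an explicit inequality between norms, which can be added and compared directly,
    instead of a little-o. Continuity of the differential is carried by the type of [T]. *)
Lemma is_diffP X Y (f : X -> Y) (T : 'L(X; Y)) x :
  is_diff x f T <->
  forall e, 0 < e -> \forall y \near x, `|f y - f x - T (y - x)| <= e * `|y - x|.
Proof.
split=> [df e e0|H].
  have /diff_locallyP[_ E] : differentiable f x by exact: ex_diff.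
  move/eqaddoP: E => E; have /near_ballP[d d0 dE] := E _ e0.
  apply/near_ballP; exists d => // y yd.
  have := dE (y - x); rewrite subr0 => /(_ yd) /=.
  by rewrite !fctE subrK diff_val opprD addrA.
have E : f \o shift x = cst (f x) + T +o_ 0 id.
  apply/eqaddoP => e e0; have /near_ballP[d d0 dE] := H e e0.
  apply/near_ballP; exists d => // y; rewrite subr0 => yd.
  by have := dE (y + x); rewrite addrK => /(_ yd); rewrite !fctE opprD addrA.
have dE : 'd f x = T :> (X -> Y).
  apply: (@diff_unique R X Y f T x (@clinear_continuous R X Y T)).
  exact: E.
split=> //; apply/diff_locallyP; rewrite dE; split=> //.
exact: clinear_continuous.
Qed.

End ContinuousLinear.

(** * Smooth maps *)

Section Smoothness.
Context {R : realType}.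
Implicit Types X Y Z V W : normedModType R.

Lemma Cn0P X Y (O : set X) (f : X -> Y) :
  Cn 0 O f <-> forall x, O x -> {for x, continuous f}.
Proof. by split=> H x => [Ox|/set_mem]; apply: H => //; rewrite inE. Qed.

Lemma is_diff_near X Y (f g : X -> Y) (T : 'L(X; Y)) x :
  (\forall y \near x, f y = g y) -> is_diff x f T -> is_diff x g T.
Proof.
move=> fg /is_diffP df; apply/is_diffP => e e0; have fgx := nbhs_singleton fg.
by have := df e e0; apply: filterS2 fg => y <-; rewrite -fgx.
Qed.

Lemma is_diff_continuous X Y (f : X -> Y) (T : 'L(X; Y)) x :
  is_diff x f T -> {for x, continuous f}.
Proof. by move=> df; apply: differentiable_continuous; exact: ex_diff. Qed.

Lemma Cn_sub n X Y (O O' : set X) (f : X -> Y) :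
  O' `<=` O -> Cn n O f -> Cn n O' f.
Proof.
elim: n Y f => [|n IHn] Y f O'O /=; first by move=> /Cn0P fc; apply/Cn0P => x /O'O/fc.
by move=> [D [Df CD]]; exists D; split=> [x /O'O/Df//|]; exact: IHn.
Qed.

Lemma Cn_ext n X Y (O : set X) (f g : X -> Y) : open O ->
  (forall x, O x -> f x = g x) -> Cn n O f -> Cn n O g.
Proof.
move=> oO fg; have fgx x : O x -> \forall y \near x, f y = g y.
  by move=> Ox; apply: filterS fg _; exact: open_nbhs_nbhs.
case: n => [|n] /=.
  move=> /Cn0P fc; apply/Cn0P => x Ox; apply/continuous_atP => e e0.
  have /continuous_atP/(_ e e0) := fc x Ox; rewrite fg//.
  by apply: filterS2 (fgx x Ox) => y ->.
by move=> [D [Df CD]]; exists D; split=> // x Ox; apply: is_diff_near (fgx x Ox) (Df x Ox).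
Qed.

(** A canonical witness for the existential in [Cn]. Witnesses found on different neighbourhoods
    need not agree as total functions, so [Cn_local] patches this one instead. *)
Definition derivative X Y (f : X -> Y) (x : X) : 'L(X; Y) := to_clinear ('d f x).

Lemma derivativeE X Y (f : X -> Y) (T : 'L(X; Y)) x :
  is_diff x f T -> derivative f x = T.
Proof.
move=> df; have e : 'd f x = T :> (X -> Y) by exact: diff_val.
apply: clinear_ext => y; rewrite /derivative to_clinearE ?e//.
apply/continuous_linearP; split; first exact: clinear_linear.
exact: clinear_continuous.
Qed.

Lemma is_diff_derivative X Y (f : X -> Y) (T : 'L(X; Y)) x :
  is_diff x f T -> is_diff x f (derivative f x).
Proof. by move=> df; rewrite (derivativeE df). Qed.

Lemma CnSP n X Y (O : set X) (f : X -> Y) : open O ->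
  Cn n.+1 O f <-> (forall x, O x -> is_diff x f (derivative f x)) /\ Cn n O (derivative f).
Proof.
move=> oO; split=> [[D [Df CD]]|[? ?]]; last by exists (derivative f).
split=> [x Ox|]; first exact: is_diff_derivative (Df x Ox).
by apply: Cn_ext CD => // x Ox; rewrite (derivativeE (Df x Ox)).
Qed.

Lemma Cn_local n X Y (O : set X) (f : X -> Y) :
  (forall x, O x -> exists N, [/\ open N, N x & Cn n N f]) -> Cn n O f.
Proof.
elim: n Y f => [|n IHn] Y f loc.
  by apply/Cn0P => x /loc[N [oN Nx /Cn0P]]; exact.
exists (derivative f); split=> [x /loc[N [oN Nx /(CnSP _ _ oN)[+ _]]]|]; first exact.
by apply: IHn => x /loc[N [oN Nx /(CnSP _ _ oN)[_ ?]]]; exists N.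
Qed.

Lemma Cn_pred n X Y (O : set X) (f : X -> Y) : Cn n.+1 O f -> Cn n O f.
Proof.
elim: n Y f => [|n IHn] Y f [D [Df CD]].
  by apply/Cn0P => x /Df; exact: is_diff_continuous.
by exists D; split=> //; exact: IHn.
Qed.

Lemma Cn_le m n X Y (O : set X) (f : X -> Y) : (m <= n)%N -> Cn n O f -> Cn m O f.
Proof.
elim: n => [|n IHn]; first by rewrite leqn0 => /eqP ->.
by rewrite leq_eqVlt => /predU1P[->//|/IHn mn] /Cn_pred.
Qed.

Lemma Cn_cst n X Y (O : set X) (c : Y) : Cn n O (fun _ : X => c).
Proof.
elim: n Y c => [|n IHn] Y c; first by apply/Cn0P => x _; exact: cvg_cst.
exists (fun _ => 0); split=> // x _; apply/is_diffP => e e0; near=> y.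
by rewrite subrr clinear0 subrr normr0 mulr_ge0// ltW.
Unshelve. all: by end_near. Qed.

Lemma is_diff_add X Y (f g : X -> Y) (S T : 'L(X; Y)) x :
  is_diff x f S -> is_diff x g T -> is_diff x (fun y => f y + g y) (S + T).
Proof.
move=> /is_diffP df /is_diffP dg; apply/is_diffP => e e0.
have e2 : 0 < e / 2 by rewrite divr_gt0.
near=> y.
rewrite clinearD (_ : _ - _ = (f y - f x - S (y - x)) + (g y - g x - T (y - x))).
  rewrite (le_trans (ler_normD _ _))// [e]splitr mulrDl lerD//.
    by near: y; exact: df.
  by near: y; exact: dg.
by rewrite !opprD !addrA [LHS](ACl (1*3*5*2*4*6)).
Unshelve. all: by end_near. Qed.

Lemma Cn_add n X Y (O : set X) (f g : X -> Y) :
  Cn n O f -> Cn n O g -> Cn n O (fun x => f x + g x).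
Proof.
elim: n Y f g => [|n IHn] Y f g.
  move=> /Cn0P cf /Cn0P cg; apply/Cn0P => x Ox.
  by apply: cvgD; [exact: cf|exact: cg].
move=> [D [Df CD]] [E [Eg CE]]; exists (fun x => D x + E x).
by split=> [x Ox|]; [apply: is_diff_add; [exact: Df|exact: Eg]|exact: IHn].
Qed.

(** One product rule serves scalar multiples and the application of operators. It is stated for all
    bounded bilinear maps because the derivative of B(u, w) is a sum of two such expressions with
    values in operators, and the induction on the order passes through them. *)
Definition bounded_bilinear X Y Z (B : X -> Y -> Z) (M : R) :=
  [/\ forall y, linear (B^~ y), forall x, linear (B x), 0 <= M &
      forall x y, `|B x y| <= M * `|x| * `|y|].

Definition bilinear_left X Y Z V (B : X -> Y -> Z) (T : 'L(V; X)) (y : Y) : 'L(V; Z) :=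
  to_clinear (fun v => B (T v) y).

Definition bilinear_right X Y Z V (B : X -> Y -> Z) (x : X) (T : 'L(V; Y)) : 'L(V; Z) :=
  to_clinear (fun v => B x (T v)).

Section Bilinear.
Variables (X Y Z V : normedModType R) (B : X -> Y -> Z) (M : R).
Hypothesis BB : bounded_bilinear B M.

Lemma bilinear_leftE (T : 'L(V; X)) y v : bilinear_left B T y v = B (T v) y.
Proof.
case: BB => l1 l2 M0 bM; rewrite to_clinearE//.
apply: (@bounded_continuous_linear _ _ _ _ (M * `|T| * `|y|)).
  by move=> a u w; rewrite clinear_linear l1.
move=> w; rewrite (le_trans (bM _ _))// -!mulrA ler_wpM2l//.
by rewrite mulrCA [leLHS]mulrC ler_wpM2l// le_norm.
Qed.

Lemma bilinear_rightE x (T : 'L(V; Y)) v : bilinear_right B x T v = B x (T v).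
Proof.
case: BB => l1 l2 M0 bM; rewrite to_clinearE//.
apply: (@bounded_continuous_linear _ _ _ _ (M * `|x| * `|T|)).
  by move=> a u w; rewrite clinear_linear l2.
move=> w; rewrite (le_trans (bM _ _))// -!mulrA ler_wpM2l// ler_wpM2l//.
exact: le_norm.
Qed.

Lemma bilinear_left_bounded :
  @bounded_bilinear 'L(V; X) Y 'L(V; Z) (@bilinear_left X Y Z V B) M.
Proof.
case: (BB) => l1 l2 M0 bM; split=> //.
- by move=> y a S T; apply: clinear_ext => v; rewrite clinearD clinearZ !bilinear_leftE l1.
- by move=> S a x y; apply: clinear_ext => v; rewrite clinearD clinearZ !bilinear_leftE l2.
- move=> T y; apply: opnorm_le; first by rewrite !mulr_ge0.
  move=> v; rewrite bilinear_leftE (le_trans (bM _ _))// -!mulrA ler_wpM2l//.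
  by rewrite mulrCA [leLHS]mulrC ler_wpM2l// le_norm.
Qed.

Lemma bilinear_right_bounded :
  @bounded_bilinear X 'L(V; Y) 'L(V; Z) (@bilinear_right X Y Z V B) M.
Proof.
case: (BB) => l1 l2 M0 bM; split=> //.
- by move=> y a S T; apply: clinear_ext => v; rewrite clinearD clinearZ !bilinear_rightE l1.
- by move=> S a x y; apply: clinear_ext => v; rewrite clinearD clinearZ !bilinear_rightE l2.
- move=> x T; apply: opnorm_le; first by rewrite !mulr_ge0.
  move=> v; rewrite bilinear_rightE (le_trans (bM _ _))// -!mulrA ler_wpM2l//.
  by rewrite ler_wpM2l// le_norm.
Qed.

Lemma bilinear_increment x x' y y' :
  B x' y' - B x y = B (x' - x) y + B x (y' - y) + B (x' - x) (y' - y).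
Proof.
case: BB => l1 l2 _ _.
have Bl a b c : B (a - b) c = B a c - B b c.
  by rewrite -[a - b]addrC -scaleN1r l1 scaleN1r addrC.
have Br a b c : B c (a - b) = B c a - B c b.
  by rewrite -[a - b]addrC -scaleN1r l2 scaleN1r addrC.
by rewrite [RHS]addrC Br !Bl subrKA Br subrKA.
Qed.

Lemma continuous_bilinear (u : V -> X) (w : V -> Y) v :
  {for v, continuous u} -> {for v, continuous w} ->
  {for v, continuous (fun z => B (u z) (w z))}.
Proof.
case: (BB) => l1 l2 M0 bM /continuous_atP cu /continuous_atP cw.
apply/continuous_atP => e e0.
pose K := M * (`|u v| + `|w v| + 1).
have K0 : 0 <= K by rewrite mulr_ge0// !addr_ge0.
pose d := Num.min 1 (e / (K + 1)).
have d0 : 0 < d by rewrite lt_min ltr01 divr_gt0// ltr_wpDl.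
have dK : d * K < e.
  rewrite (@le_lt_trans _ _ (e / (K + 1) * K))//; first by rewrite ler_wpM2r// ge_min lexx orbT.
  by rewrite mulrAC ltr_pdivrMr ?ltr_wpDl// ltr_pM2l// ltrDl.
near=> z.
have uz : `|u z - u v| < d by near: z; exact: cu.
have wz : `|w z - w v| < d by near: z; exact: cw.
rewrite bilinear_increment; apply: le_lt_trans dK.
rewrite (le_trans (ler_normD _ _))//.
rewrite (le_trans (lerD (ler_normD _ _) (lexx _)))//.
rewrite (le_trans (lerD (lerD (bM _ _) (bM _ _)) (bM _ _)))//.
have -> : d * K = M * d * `|w v| + M * `|u v| * d + M * d * 1 by rewrite /K; ring.
rewrite !lerD//.
- by rewrite ler_wpM2r// ler_wpM2l// ltW.
- by rewrite ler_wpM2l ?mulr_ge0// ltW.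
- rewrite ler_pM ?mulr_ge0//; first by rewrite ler_wpM2l// ltW.
  by rewrite (le_trans (ltW wz))// ge_min lexx.
Unshelve. all: by end_near. Qed.

Lemma is_diff_bilinear (u : V -> X) (w : V -> Y) (S : 'L(V; X)) (T : 'L(V; Y)) v :
  is_diff v u S -> is_diff v w T ->
  is_diff v (fun z => B (u z) (w z)) (bilinear_left B S (w v) + bilinear_right B (u v) T).
Proof.
move=> du dw; have cw := is_diff_continuous dw.
case: (BB) => l1 l2 M0 bM.
have Bl a b c : B (a - b) c = B a c - B b c.
  by rewrite -[a - b]addrC -scaleN1r l1 scaleN1r addrC.
have Br a b c : B c (a - b) = B c a - B c b.
  by rewrite -[a - b]addrC -scaleN1r l2 scaleN1r addrC.
move/is_diffP: du => du; move/is_diffP: dw => dw; move/continuous_atP: cw => cw.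
apply/is_diffP => e e0.
(* The first two errors carry the factors [|w v|] and [|u v|]. The mixed one carries [|S| + 1],
   which bounds the difference quotients of [u] near [v]. *)
pose K := M * (`|u v| + `|w v| + `|S| + 1).
have K0 : 0 <= K by rewrite mulr_ge0// !addr_ge0.
pose d := Num.min 1 (e / (K + 1)).
have d0 : 0 < d by rewrite lt_min ltr01 divr_gt0// ltr_wpDl.
have d1 : d <= 1 by rewrite ge_min lexx.
have dK : d * K <= e.
  rewrite (@le_trans _ _ (e / (K + 1) * K))//; first by rewrite ler_wpM2r// ge_min lexx orbT.
  by rewrite mulrAC ler_pdivrMr ?ltr_wpDl// ler_pM2l// lerDl.
near=> z.
have uz : `|u z - u v - S (z - v)| <= d * `|z - v| by near: z; exact: du.
have wz : `|w z - w v - T (z - v)| <= d * `|z - v| by near: z; exact: dw.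
have wz' : `|w z - w v| < d by near: z; exact: cw.
have uz' : `|u z - u v| <= (`|S| + 1) * `|z - v|.
  rewrite -(subrK (S (z - v)) (u z - u v)) (le_trans (ler_normD _ _))//.
  rewrite addrC mulrDl lerD ?le_norm// (le_trans uz)// ler_wpM2r//.
rewrite bilinear_increment clinearD bilinear_leftE bilinear_rightE.
rewrite (_ : _ - _ = B (u z - u v - S (z - v)) (w v) + B (u v) (w z - w v - T (z - v))
   + B (u z - u v) (w z - w v)); last first.
  by rewrite [B (_ - S _) _]Bl [B _ (_ - T _)]Br opprD addrAC addrACA.
rewrite (le_trans (ler_normD _ _))//.
rewrite (le_trans (lerD (ler_normD _ _) (lexx _)))//.
rewrite (le_trans (lerD (lerD (bM _ _) (bM _ _)) (bM _ _)))//.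
rewrite (@le_trans _ _ (d * K * `|z - v|))//; last by rewrite ler_wpM2r.
have -> : d * K * `|z - v| = M * (d * `|z - v|) * `|w v| + M * `|u v| * (d * `|z - v|) +
  M * ((`|S| + 1) * `|z - v|) * d by rewrite /K; ring.
rewrite !lerD//.
- by rewrite ler_wpM2r// ler_wpM2l.
- by rewrite ler_wpM2l// mulr_ge0.
- by rewrite ler_pM ?(ltW wz')// ?mulr_ge0// ler_wpM2l.
Unshelve. all: by end_near. Qed.

End Bilinear.

Lemma Cn_bilinear n X Y Z V (B : X -> Y -> Z) (M : R) (O : set V) (u : V -> X) (w : V -> Y) :
  bounded_bilinear B M -> Cn n O u -> Cn n O w -> Cn n O (fun v => B (u v) (w v)).
Proof.
elim: n X Y Z B u w => [|n IHn] X Y Z B u w BB.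
  move=> /Cn0P cu /Cn0P cw; apply/Cn0P => v Ov.
  by apply: (continuous_bilinear BB); [exact: cu|exact: cw].
move=> Cu Cw; have [D [Du CD]] := Cu; have [E [Ew CE]] := Cw.
exists (fun v => bilinear_left B (D v) (w v) + bilinear_right B (u v) (E v)).
split=> [v Ov|].
  by apply: (is_diff_bilinear BB); [exact: Du|exact: Ew].
apply: Cn_add.
  by apply: (IHn _ _ _ _ _ _ (bilinear_left_bounded V BB)) => //; exact: Cn_pred.
by apply: (IHn _ _ _ _ _ _ (bilinear_right_bounded V BB)) => //; exact: Cn_pred.
Qed.

Lemma scale_bounded_bilinear Y : @bounded_bilinear R^o Y Y (fun a y => a *: y) 1.
Proof.
split=> // [y a b c|a b x y|a y]; first by rewrite scalerDl -scalerA.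
  by rewrite scalerDr !scalerA mulrC.
by rewrite normrZ mul1r.
Qed.

Lemma apply_bounded_bilinear X Y : @bounded_bilinear 'L(X; Y) X Y (fun T x => T x) 1.
Proof.
split=> // [T x|T x]; last by rewrite mul1r le_norm.
exact: clinear_linear.
Qed.

Lemma Cn_scale n X Y (O : set X) (a : X -> R^o) (f : X -> Y) :
  Cn n O a -> Cn n O f -> Cn n O (fun x => a x *: f x).
Proof. exact: (Cn_bilinear (scale_bounded_bilinear Y)). Qed.

Lemma Cn_clinear n X Y Z (O : set X) (T : 'L(Y; Z)) (f : X -> Y) :
  Cn n O f -> Cn n O (fun x => T (f x)).
Proof.
move=> Cf; apply: (Cn_bilinear (apply_bounded_bilinear Y Z) _ Cf).
exact: Cn_cst.
Qed.

Lemma is_diff_affine X Y (f : X -> Y) (T : 'L(X; Y)) (a : R) (b x : X) :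
  is_diff (a *: x + b) f T -> is_diff x (fun y => f (a *: y + b)) (a *: T).
Proof.
move=> /is_diffP df; apply/is_diffP => e e0.
have a1 : 0 < `|a| + 1 by rewrite ltr_wpDl.
have /near_ballP[d d0 dE] := df (e / (`|a| + 1)) (divr_gt0 e0 a1).
apply/near_ballP; exists (d / (`|a| + 1)); first by rewrite divr_gt0.
move=> y yd; have aE : a *: y + b - (a *: x + b) = a *: (y - x).
  by rewrite opprD addrACA subrr addr0 scalerBr.
have := dE (a *: y + b); rewrite aE normrZ linearZ clinearZ => /(_ _)/le_trans; apply.
  rewrite (@le_lt_trans _ _ ((`|a| + 1) * `|y - x|))//.
    by rewrite ler_wpM2r// lerDl.
  by rewrite mulrC -ltr_pdivlMr.
rewrite mulrA ler_wpM2r// mulrAC ler_pdivrMr// ler_pM2l//.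
by rewrite lerDl.
Qed.

Lemma Cn_affine n X Y (O : set X) (f : X -> Y) (a : R) (b : X) :
  Cn n O f -> Cn n [set x | O (a *: x + b)] (fun x => f (a *: x + b)).
Proof.
elim: n Y f => [|n IHn] Y f.
  move=> /Cn0P cf; apply/Cn0P => x /= /cf fc.
  apply: (@continuous_comp _ _ _ (fun x : X => a *: x + b) f) => //.
  by apply: cvgD; [exact: cvgZl_tmp|exact: cvg_cst].
move=> [D [Df CD]]; exists (fun x => a *: D (a *: x + b)); split.
  by move=> x /= /Df; exact: is_diff_affine.
by apply: (@Cn_scale _ _ _ _ (fun=> a)); [exact: Cn_cst|exact: IHn].
Qed.

Lemma is_diff_comp_real X (phi : X -> R^o) (T : 'L(X; R^o)) (h : R -> R) (l : R) x :
  is_derive (phi x : R^o) (1 : R^o) (h : R^o -> R^o) l -> is_diff x phi T ->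
  is_diff x (fun y => h (phi y) : R^o) (l *: T).
Proof.
move=> dh dphi; have hd : differentiable (h : R^o -> R^o) (phi x).
  by apply/derivable1_diffP; exact: ex_derive.
have e : 'd (h : R^o -> R^o) (phi x) \o T = l *: T :> (X -> R^o).
  apply/funext => v /=; rewrite diff1E//.
  by rewrite derive1E derive_val; exact: mulrC.
have := is_diff_comp dphi (differentiableP hd).
by rewrite e.
Qed.

(** The outer function is given with all its derivatives, as a sequence [h]. The chain rule moves
    from [h j] to [h j.+1], so the induction on the order keeps [j] general. *)
Lemma Cn_comp_real n X (O : set X) (D : set R) (phi : X -> R^o) (h : nat -> R -> R) j :
  (forall i t, D t -> is_derive (t : R^o) (1 : R^o) (h i : R^o -> R^o) (h i.+1 t)) ->
  (forall x, O x -> D (phi x)) -> Cn n O phi -> Cn n O (fun x => h j (phi x) : R^o).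
Proof.
move=> dh OD; elim: n j => [|n IHn] j Cphi.
  move: Cphi => /Cn0P cphi; apply/Cn0P => x Ox; have phic := cphi _ Ox.
  apply: (@continuous_comp _ _ _ phi (h j)) => //.
  apply: differentiable_continuous; apply/derivable1_diffP.
  by case: (dh j (phi x) (OD _ Ox)).
have [T [Tphi CT]] := Cphi; exists (fun x => h j.+1 (phi x) *: T x); split.
  by move=> x Ox; apply: is_diff_comp_real (Tphi x Ox); exact/dh/OD.
by apply: (Cn_scale (IHn _ _) CT); exact: Cn_pred.
Qed.

(** Treats finite and infinite order together, so that closure properties of [Cn] transfer to [Ck]
    without a case distinction. *)
Lemma CkP X Y (k : smoothness) (O : set X) (f : X -> Y) :
  Ck k O f <-> forall n, (if k is Cfinite m then (n <= m)%N else true) -> Cn n O f.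
Proof.
case: k => [m|] /=; last by split=> [H n _|H n]; exact: H.
by split=> [H n nm|]; [exact: Cn_le H|exact].
Qed.

Lemma Ck_sub k X Y (O O' : set X) (f : X -> Y) : O' `<=` O -> Ck k O f -> Ck k O' f.
Proof. by move=> OO' /CkP Cf; apply/CkP => n /Cf; exact: Cn_sub. Qed.

Lemma Ck_ext k X Y (O : set X) (f g : X -> Y) : open O ->
  (forall x, O x -> f x = g x) -> Ck k O f -> Ck k O g.
Proof. by move=> oO fg /CkP Cf; apply/CkP => n /Cf; exact: Cn_ext. Qed.

Lemma Ck_local k X Y (O : set X) (f : X -> Y) :
  (forall x, O x -> exists N, [/\ open N, N x & Ck k N f]) -> Ck k O f.
Proof.
move=> loc; apply/CkP => n nk; apply: Cn_local => x /loc[N [oN Nx /CkP Cf]].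
by exists N; split=> //; exact: Cf.
Qed.

Lemma Ck_cst k X Y (O : set X) (c : Y) : Ck k O (fun _ : X => c).
Proof. by apply/CkP => n _; exact: Cn_cst. Qed.

Lemma Ck_add k X Y (O : set X) (f g : X -> Y) :
  Ck k O f -> Ck k O g -> Ck k O (fun x => f x + g x).
Proof. by move=> /CkP Cf /CkP Cg; apply/CkP => n nk; apply: Cn_add; [exact: Cf|exact: Cg]. Qed.

Lemma Ck_scale k X Y (O : set X) (a : X -> R^o) (f : X -> Y) :
  Ck k O a -> Ck k O f -> Ck k O (fun x => a x *: f x).
Proof. by move=> /CkP Ca /CkP Cf; apply/CkP => n nk; apply: Cn_scale; [exact: Ca|exact: Cf]. Qed.

Lemma Ck_sum k X Y (O : set X) (f : nat -> X -> Y) n :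
  (forall i, (i < n)%N -> Ck k O (f i)) -> Ck k O (fun x => \sum_(i < n) f i x).
Proof.
elim: n => [|n IHn] Cf.
  by under eq_fun do rewrite big_ord0; exact: Ck_cst.
under eq_fun do rewrite big_ord_recr /=.
by apply: Ck_add; [apply: IHn => i /leqW; exact: Cf|exact: Cf].
Qed.

Lemma Ck_clinear k X Y Z (O : set X) (T : 'L(Y; Z)) (f : X -> Y) :
  Ck k O f -> Ck k O (fun x => T (f x)).
Proof. by move=> /CkP Cf; apply/CkP => n /Cf; exact: Cn_clinear. Qed.

Lemma Ck_affine k X Y (O : set X) (f : X -> Y) (a : R) (b : X) :
  Ck k O f -> Ck k [set x | O (a *: x + b)] (fun x => f (a *: x + b)).
Proof. by move=> /CkP Cf; apply/CkP => n /Cf; exact: Cn_affine. Qed.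

Lemma Ck_comp_real k X (O : set X) (D : set R) (phi : X -> R^o) (h : nat -> R -> R) j :
  (forall i t, D t -> is_derive (t : R^o) (1 : R^o) (h i : R^o -> R^o) (h i.+1 t)) ->
  (forall x, O x -> D (phi x)) -> Ck k O phi -> Ck k O (fun x => h j (phi x) : R^o).
Proof. by move=> dh OD /CkP Cp; apply/CkP => n /Cp; exact: Cn_comp_real dh OD. Qed.

Lemma Ck_C1 k X Y (O : set X) (f : X -> Y) : k <> Cfinite 0 ->
  Ck k O f -> Ck (Cfinite 1) O f.
Proof. by move=> k0 /CkP; apply; case: k k0 => // -[]. Qed.

End Smoothness.

(** * The mean value inequality and smooth cutoffs *)

Section MeanValue.
Context {R : realType}.
Implicit Types X Y : normedModType R.

(** The parameters s with |h s - h 0| <= (M + e) s contain their supremum, and a supremum below 1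
    could be passed. The argument works for values in any normed space, without linear
    functionals. *)
Lemma curve_mean_value Y (h : R -> Y) (M : R) :
  (forall s, 0 <= s <= 1 -> forall e, 0 < e -> exists2 d, 0 < d &
     forall s', 0 <= s' <= 1 -> `|s' - s| < d -> `|h s' - h s| <= (M + e) * `|s' - s|) ->
  `|h 1 - h 0| <= M.
Proof.
move=> hM; apply/ler_addgt0Pr => e e0.
pose S := [set s : R | 0 <= s <= 1 /\ `|h s - h 0| <= (M + e) * s].
have S0 : S 0 by split; rewrite ?lexx ?ler01// subrr normr0 mulr0.
have supS : has_sup S by split; [exists 0|exists 1 => s [/andP[]]].
have sup0 : 0 <= sup S by exact: sup_upper_bound.
have sup1 : sup S <= 1 by apply: ge_sup; [exists 0|move=> s [/andP[]]].
have [d d0 dh] := hM (sup S) (introT andP (conj sup0 sup1)) e e0.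
have Ssup : S (sup S).
  split; first by rewrite sup0.
  have [s Ss sd] := sup_adherent d0 supS.
  have sS : s <= sup S by exact: sup_upper_bound.
  have [s01 hs] := Ss.
  have := dh s s01; rewrite distrC ger0_norm ?subr_ge0// => /(_ _).
  rewrite ltrBlDr -ltrBlDl => /(_ sd) hss.
  rewrite -(subrKA (h s)) (le_trans (ler_normD _ _))// distrC.
  by rewrite (le_trans (lerD hss hs))// -mulrDr subrK.
have [S1|S1] := leP 1 (sup S).
  by have [_] := Ssup; rewrite (le_anti (introT andP (conj sup1 S1))) mulr1.
(* A parameter beyond the supremum, still within reach of the local bound there. *)
pose s' := Num.min 1 (sup S + d / 2).
have s'S : sup S < s' by rewrite lt_min S1 ltrDl divr_gt0.
have s'1 : 0 <= s' <= 1 by rewrite ge_min lexx (le_trans sup0 (ltW s'S)).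
suff : S s' by move=> /(sup_upper_bound supS); rewrite leNgt s'S.
split=> //; have := dh s' s'1; rewrite ger0_norm ?subr_ge0 ?(ltW s'S)// => /(_ _).
rewrite ltrBlDl gt_min ltrD2l [X in _ || X]ltr_pdivrMr// ltr_pMr// ltr1n orbT => /(_ isT) hs.
rewrite -(subrKA (h (sup S))) (le_trans (ler_normD _ _))//.
by have [_ hS] := Ssup; rewrite (le_trans (lerD hs hS))// -mulrDr subrK.
Qed.

(** A Lipschitz curve need not be differentiable, so neither is [f] along it. What remains is a
    Lipschitz bound based at each parameter, which is all that [curve_mean_value] asks. *)
Lemma curve_diff_mean_value X Y (f : X -> Y) (gamma : R -> X) (L M : R) :
  0 <= L -> 0 <= M ->
  (forall s s', 0 <= s <= 1 -> 0 <= s' <= 1 -> `|gamma s' - gamma s| <= L * `|s' - s|) ->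
  (forall s, 0 <= s <= 1 -> exists2 T : 'L(X; Y), is_diff (gamma s) f T & `|T| <= M) ->
  `|f (gamma 1) - f (gamma 0)| <= M * L.
Proof.
move=> L0 M0 Lg fT; apply: (@curve_mean_value _ (f \o gamma)) => s s01 e e0 /=.
have [T /is_diffP dT TM] := fT s s01.
have L1 : 0 < L + 1 by rewrite ltr_wpDl.
have /near_ballP[d d0 dE] := dT (e / (L + 1)) (divr_gt0 e0 L1).
exists (d / (L + 1)); first by rewrite divr_gt0.
move=> s' s'01 s's; have gs := Lg s s' s01 s'01.
have /dE fE : `|gamma s' - gamma s| < d.
  rewrite (le_lt_trans gs)// (@le_lt_trans _ _ ((L + 1) * `|s' - s|))//.
    by rewrite ler_wpM2r// lerDl.
  by rewrite mulrC -ltr_pdivlMr.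
rewrite -(subrK (T (gamma s' - gamma s)) (_ - _)) (le_trans (ler_normD _ _))//.
rewrite (le_trans (lerD fE (le_norm _ _)))// -mulrDl.
rewrite (@le_trans _ _ ((e / (L + 1) + M) * (L * `|s' - s|)))//.
  rewrite ler_pM// ?lerD2l// addr_ge0// divr_ge0// ?(ltW e0)// ltW//.
rewrite mulrA ler_wpM2r// mulrDl addrC lerD2l mulrAC ler_pdivrMr// ler_pM2l//.
by rewrite lerDl.
Qed.

Lemma segment_mean_value X Y (f : X -> Y) (x y : X) (M : R) : 0 <= M ->
  (forall s, 0 <= s <= 1 -> exists2 T : 'L(X; Y), is_diff (x + s *: (y - x)) f T & `|T| <= M) ->
  `|f y - f x| <= M * `|y - x|.
Proof.
move=> M0 fT; have := @curve_diff_mean_value _ _ f (fun s => x + s *: (y - x)) `|y - x| M.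
rewrite scale1r scale0r addr0 subrKC; apply => // s s' _ _.
by rewrite opprD addrACA subrr add0r -scalerBl normrZ mulrC.
Qed.

End MeanValue.

(** * Flat functions and a smooth transition from 1 to 0 *)

Section Cutoff.
Context {R : realType}.

Lemma is_derive_epsilon (f : R -> R) (t l : R) :
  (forall e, 0 < e -> \forall s \near t, `|f s - f t - l * (s - t)| <= e * `|s - t|) ->
  is_derive (t : R^o) (1 : R^o) (f : R^o -> R^o) l.
Proof.
move=> fl; pose T := to_clinear (fun v : R^o => l * v : R^o).
have TE v : T v = l * v.
  rewrite /T to_clinearE//; apply: (@bounded_continuous_linear _ _ _ _ `|l|).
    by move=> a x y; rewrite mulrDr -scalerAr.
  by move=> x; rewrite normrM.
have df : is_diff (t : R^o) (f : R^o -> R^o) T.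
  by apply/is_diffP => e e0; have := fl e e0; apply: filterS => s; rewrite TE.
apply: DeriveDef; first by apply/derivable1_diffP; exact: ex_diff.
by rewrite deriveE ?diff_val ?TE ?mulr1//; exact: ex_diff.
Qed.

(** The classical p(1/t) exp(-1/t), extended by 0. With [p] as a parameter the family is closed
    under differentiation, so one derivative computation gives smoothness of every order. *)
Definition flat (p : {poly R}) (t : R) : R :=
  if 0 < t then p.[t^-1] * expR (- t^-1) else 0.

(** The coefficients of [C] come from exp u >= u^(i+2) / (i+2)!. The two extra powers give
    [flat p s] the size of s^2 for small s > 0, whence a zero derivative at 0. *)
Lemma expR_decay (p : {poly R}) :
  exists2 C, 0 <= C & forall u, 1 <= u -> `|p.[u] * expR (- u)| <= C / u ^+ 2.
Proof.
exists (\sum_(i < size p) `|p`_i| * (i.+2)`!%:R) => [|u u1].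
  by apply: sumr_ge0 => i _; rewrite mulr_ge0.
have u0 : 0 < u by rewrite (lt_le_trans _ u1).
rewrite horner_coef normrM (ger0_norm (expR_ge0 _)).
rewrite (le_trans (ler_wpM2r (expR_ge0 _) (ler_norm_sum _ _ _)))//.
rewrite !mulr_suml; apply: ler_sum => i _.
rewrite normrM normrX (gtr0_norm u0) -!mulrA ler_wpM2l//.
rewrite expRN ler_pdivrMr ?expR_gt0// mulrAC ler_pdivlMr ?exprn_gt0//.
rewrite -exprD addnC add2n mulrC -ler_pdivrMr ?ltr0n ?fact_gt0//.
by rewrite (le_trans _ (expR_ge1Dxn i.+1 (ltW u0)))// lerDr.
Qed.

Lemma is_derive_flat (p : {poly R}) (t : R) :
  is_derive (t : R^o) (1 : R^o) (flat p : R^o -> R^o) (flat ('X^2 * (p^`() * -1 + p)) t).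
Proof.
have [t0|t0|->] := ltgtP t 0.
- rewrite [X in is_derive _ _ _ X]/flat ltNge (ltW t0) /=.
  apply: (@near_eq_is_derive R R^o R^o (cst 0)).
  near=> s; rewrite /flat ltNge ltW//=; near: s; exact: lt_nbhsl.
- rewrite [X in is_derive _ _ _ X]/flat t0.
  have E : \forall s \near t,
      (((fun s => p.[s^-1]) : R -> R) * (fun s => expR (- s^-1))) s = flat p s.
    near=> s; rewrite /flat ifT//; near: s; exact: lt_nbhsr.
  have tn0 : t != 0 by rewrite gt_eqF.
  have dV : is_derive (t : R) (1 : R) (fun s : R => s^-1 : R) (- t ^- 2).
    have := @is_deriveV R id t 1 1 tn0 (is_derive_id _ _).
    by rewrite /= scaler1.
  have dp := @is_derive1_comp R (horner p) (fun s => s^-1) t _ _ (is_derive_poly p _) dV.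
  have dN := is_deriveN dV.
  have de := @is_derive1_comp R expR (fun s => - s^-1) t _ _ (is_derive_expR _) dN.
  apply: (near_eq_is_derive E); apply: (is_derive_eq (is_deriveM dp de)).
  rewrite !hornerE /= /GRing.scale /=.
  by rewrite -[t ^- 2]exprVn; ring.
- apply: is_derive_epsilon => e e0.
  have [C C0 CE] := expR_decay p.
  have C1 : 0 < C + 1 by rewrite ltr_wpDl.
  near=> s; rewrite /flat ltxx mul0r !subr0.
  case: ifPn => s0; last by rewrite normr0 mulr_ge0// ltW.
  have s1 : s <= 1 by apply: ltW; near: s; exact: lt_nbhsl.
  rewrite (le_trans (CE _ _)) ?invf_ge1//.
  rewrite exprVn invrK expr2 mulrA (gtr0_norm s0) ler_wpM2r ?(ltW s0)//.
  rewrite (@le_trans _ _ ((C + 1) * s))//; first by rewrite ler_wpM2r ?lerDl// ltW.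
  rewrite mulrC -ler_pdivlMr// ltW//.
  near: s; apply: lt_nbhsl; exact: divr_gt0.
Unshelve. all: by end_near. Qed.

Definition flat_poly (n : nat) : {poly R} := iter n (fun p => 'X^2 * (p^`() * -1 + p)) 1.

Lemma flat_gt0 (t : R) : 0 < t -> 0 < flat 1 t.
Proof. by move=> t0; rewrite /flat t0 hornerC mul1r expR_gt0. Qed.

Lemma flat_eq0 p (t : R) : t <= 0 -> flat p t = 0.
Proof. by move=> t0; rewrite /flat ltNge t0. Qed.

Lemma flat_ge0 (t : R) : 0 <= flat 1 t.
Proof. by have [/flat_eq0->//|/flat_gt0/ltW] := leP t 0. Qed.

(** The n-th derivative of 1/t. *)
Definition inverse_derivative (n : nat) (t : R) : R := (-1) ^+ n * n`!%:R * t^-1 ^+ n.+1.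

Lemma is_derive_inverse n (t : R) : t != 0 ->
  is_derive (t : R^o) (1 : R^o) (inverse_derivative n : R^o -> R^o)
    (inverse_derivative n.+1 t).
Proof.
move=> tn0.
have dV : is_derive (t : R) (1 : R) (fun s : R => s^-1 : R) (- t ^- 2).
  have := @is_deriveV R id t 1 1 tn0 (is_derive_id _ _).
  by rewrite /= scaler1.
have dX := @is_deriveX R R _ n.+1 t 1 _ dV.
have dZ := @is_deriveZ R R R _ ((-1) ^+ n * n`!%:R) t 1 _ dX.
have E : \forall s \near t, (((-1) ^+ n * n`!%:R : R) \*: ((fun s : R => s^-1 : R) ^+ n.+1)) s
    = inverse_derivative n s.
  by near=> s; rewrite /= exprfctE.
apply: (near_eq_is_derive E); apply: (is_derive_eq dZ).
rewrite /inverse_derivative /GRing.scale /= factS natrM -[t ^- 2]exprVn !exprS /= expr0.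
by ring.
Unshelve. all: by end_near. Qed.

(** The standard transition, equal to 1 for t <= 0 and to 0 for t >= 1. The denominator is positive
    because t and 1 - t are never both nonpositive. *)
Definition smooth_step (t : R) : R := flat 1 (1 - t) * (flat 1 (1 - t) + flat 1 t)^-1.

Lemma smooth_step_den_gt0 (t : R) : 0 < flat 1 (1 - t) + flat 1 t.
Proof.
have [t0|t0] := leP t 0; last by rewrite ltr_wpDl ?flat_ge0 ?flat_gt0.
by rewrite ltr_pwDl ?flat_ge0 ?flat_gt0// subr_gt0 (le_lt_trans t0).
Qed.

Lemma smooth_step_eq1 (t : R) : t <= 0 -> smooth_step t = 1.
Proof.
move=> t0; rewrite /smooth_step (flat_eq0 _ t0) addr0 divff// gt_eqF//.
by rewrite flat_gt0// subr_gt0 (le_lt_trans t0).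
Qed.

Lemma smooth_step_eq0 (t : R) : 1 <= t -> smooth_step t = 0.
Proof. by move=> t1; rewrite /smooth_step flat_eq0 ?mul0r// subr_le0. Qed.

Lemma smooth_step_itv (t : R) : 0 <= smooth_step t <= 1.
Proof.
rewrite /smooth_step divr_ge0 ?flat_ge0 ?(ltW (smooth_step_den_gt0 _))//=.
by rewrite ler_pdivrMr ?smooth_step_den_gt0// mul1r lerDl flat_ge0.
Qed.

Lemma Ck_smooth_step k (X : normedModType R) (O : set X) (phi : X -> R^o) :
  Ck k O phi -> Ck k O (fun x => smooth_step (phi x) : R^o).
Proof.
move=> Cphi.
have Cflat (psi : X -> R^o) : Ck k O psi -> Ck k O (fun x => flat 1 (psi x) : R^o).
  move=> Cpsi; apply: (@Ck_comp_real _ k X O setT psi (fun n => flat (flat_poly n)) 0%N) => //.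
  by move=> i t _; exact: is_derive_flat.
have Cflat' : Ck k O (fun x => flat 1 (1 - phi x) : R^o).
  apply: Cflat; apply: (@Ck_add _ k X R^o O (fun=> 1)); first exact: Ck_cst.
  under eq_fun do rewrite -scaleN1r.
  by apply: (@Ck_scale _ k X R^o O (fun=> -1)) => //; exact: Ck_cst.
apply: (@Ck_scale _ k X R^o O) => //.
rewrite (_ : (fun x => _^-1) = (fun x => inverse_derivative 0
  (flat 1 (1 - phi x) + flat 1 (phi x)))); last first.
  by apply/funext => x; rewrite /inverse_derivative fact0 expr0 !mul1r expr1.
apply: (@Ck_comp_real _ k X O [set t | t != 0]
  (fun x => flat 1 (1 - phi x) + flat 1 (phi x) : R^o)).
- by move=> i t; exact: is_derive_inverse.
- by move=> x _ /=; rewrite gt_eqF// smooth_step_den_gt0.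
- by apply: Ck_add => //; exact: Cflat.
Qed.

(** The derivative is bounded on [0, 1] by compactness, and the step is constant on either side.
    Clamping with the 1-Lipschitz map [cl] brings every pair of points into that interval. *)
Lemma smooth_step_lipschitz :
  exists2 M, 0 <= M & forall s t, `|smooth_step s - smooth_step t| <= M * `|s - t|.
Proof.
have [D [dD /Cn0P cD]] : Ck (Cfinite 1) [set: R^o] (smooth_step : R^o -> R^o).
  apply: (@Ck_smooth_step (Cfinite 1) R^o setT id).
  exists (fun=> to_clinear idfun); split=> [x _|]; last exact: Cn_cst.
  rewrite to_clinearE; first exact: is_diff_id.
  by apply: (@bounded_continuous_linear _ _ _ _ 1) => // y; rewrite mul1r.
have [c _ cmax] : exists2 c, c \in `[0, 1]%R &
    forall t, t \in `[0, 1]%R -> `|D t| <= `|D c|.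
  apply: (@EVT_max R (fun t => `|D t|)) => //.
  apply: continuous_subspaceT => t.
  by apply: continuous_comp; [exact: cD|exact: norm_continuous].
exists `|D c| => // s t.
pose cl (u : R) := Num.max 0 (Num.min 1 u).
have clE u : smooth_step u = smooth_step (cl u).
  rewrite /cl; have [u1|u1] := leP 1 u.
    by rewrite max_r// !smooth_step_eq0.
  by have [u0|//] := leP u 0; rewrite !smooth_step_eq1.
have cl01 u : 0 <= cl u <= 1 by rewrite /cl le_max lexx ge_max ler01 ge_min lexx.
have cll u v : `|cl u - cl v| <= `|u - v|.
  have uv := ler_norm (u - v); have vu := ler_norm (v - u).
  rewrite distrC in vu; rewrite ler_norml /cl !maxEle !minEle.
  move: (`|u - v|) uv vu => d uv vu.
  case: (leP 1 u) => ?; case: (leP 1 v) => ?; rewrite ?ler01;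
    case: (leP 0 u) => ?; case: (leP 0 v) => ?; apply/andP; split; lra.
rewrite clE [smooth_step t]clE (le_trans _ (ler_wpM2l _ (cll s t)))//.
apply: (@segment_mean_value _ R^o R^o smooth_step) => // r /andP[r0 r1].
exists (D (cl t + r *: (cl s - cl t) : R^o)); first exact: dD.
apply: cmax; rewrite in_itv /=.
have /andP[s0 s1] := cl01 s; have /andP[t0 t1] := cl01 t.
rewrite /GRing.scale /=; nra.
Qed.

End Cutoff.

(** * Smooth approximation on balls *)

Section HahnBanach.
Context {R : realType} (Y : normedModType R).

(** A partial linear functional dominated by the norm, encoded by its graph, so that chains are
    handled by unions. Single-valuedness follows: two values at one point differ by a value at 0,
    which domination makes nonpositive in both orders. *)
Let dominated_graph (A : set (Y * R)) :=
  (forall a p q, A p -> A q -> A (a *: p.1 + q.1, a * p.2 + q.2)) /\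
  (forall p, A p -> p.2 <= `|p.1|).

(** The one-dimensional step of Hahn-Banach: the triangle inequality puts every lower constraint on
    the value at [v] below every upper one, and [c] is the supremum of the lower ones. *)
Let dominated_graph_extend (A : set (Y * R)) (v : Y) :
  dominated_graph A -> A !=set0 ->
  exists c, dominated_graph [set p | exists q a, A q /\ p = (q.1 + a *: v, q.2 + a * c)].
Proof.
move=> [linA domA] [p0 Ap0].
have A0 : A (0, 0).
  by have := linA (-1) _ _ Ap0 Ap0; rewrite scaleN1r mulN1r !addNr.
have scA a p : A p -> A (a *: p.1, a * p.2).
  by move=> Ap; have := linA a _ _ Ap A0; rewrite !addr0.
pose S := [set p.2 - `|p.1 - v| | p in A].
have Sub p : A p -> ubound S (`|p.1 + v| - p.2).
  move=> Ap _ [q Aq <-]; rewrite lerBlDr addrAC lerBrDr.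
  have := domA _ (linA 1 _ _ Aq Ap); rewrite /= scale1r mul1r => /le_trans; apply.
  rewrite (_ : q.1 + p.1 = (q.1 - v) + (p.1 + v)); last by rewrite addrACA addNr addr0.
  by rewrite addrC (le_trans (ler_normD _ _))// addrC.
have supS : has_sup S.
  split; first by exists (p0.2 - `|p0.1 - v|), p0.
  by exists (`|p0.1 + v| - p0.2); exact: Sub.
pose c := sup S.
have cle p : A p -> c <= `|p.1 + v| - p.2 by move=> /Sub ?; apply: ge_sup => //; case: supS.
have cge p : A p -> p.2 - `|p.1 - v| <= c by move=> Ap; apply: sup_upper_bound => //; exists p.
exists c; split.
  move=> a _ _ [p [b [Ap ->]]] [q [d [Aq ->]]].
  exists (a *: p.1 + q.1, a * p.2 + q.2), (a * b + d); split; first exact: linA.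
  by congr (_, _) => /=; [rewrite scalerDr scalerDl scalerA addrACA|ring].
move=> _ [q [a [Aq ->]]] /=.
have [a0|a0|->] := ltgtP a 0; last by rewrite scale0r mul0r !addr0 domA.
- have b0 : 0 < - a by rewrite oppr_gt0.
  have := cge _ (scA (- a)^-1 _ Aq); rewrite /= -(ler_pM2l b0) mulrBr mulVKf ?gt_eqF//.
  rewrite -[X in _ - X * _](gtr0_norm b0) -normrZ scalerBr scalerA mulfV ?gt_eqF// scale1r.
  by rewrite scaleNr opprK; lra.
- have := cle _ (scA a^-1 _ Aq); rewrite /= -(ler_pM2l a0) mulrBr mulVKf ?gt_eqF//.
  rewrite -[X in _ <= X * _ - _](gtr0_norm a0) -normrZ scalerDr scalerA mulfV ?gt_eqF// scale1r.
  by lra.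
Qed.

(** Zorn's lemma on dominated graphs containing the line through [y]; a maximal one is defined
    everywhere by the one-dimensional step. The functional serves to pass from [Y]-valued
    approximation to scalar approximation. *)
Lemma hahn_banach_norming (y : Y) : exists T : 'L(Y; R^o),
  T y = `|y| /\ forall v, `|T v| <= `|v|.
Proof.
pose S := [set p : Y * R | exists a, p = (a *: y, a * `|y|)].
have Sdom : dominated_graph S.
  split=> [a _ _ [b ->] [c ->]|_ [a ->] /=].
    by exists (a * b + c); rewrite /= scalerA mulrA -scalerDl -mulrDl.
  by rewrite normrZ ler_wpM2r// ler_norm.
(* The union of the empty chain is empty and must satisfy [P], so the inclusion of [S] is asked of
   nonempty graphs only. *)
pose P A := dominated_graph A /\ (A !=set0 -> S `<=` A).
have Sy : S (y, `|y|) by exists 1; rewrite scale1r mul1r.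
have [A [[domA SA] maxA]] : exists A, P A /\ forall B, A `<` B -> ~ P B.
  apply: Zorn_bigcup => F FP totF; split; last first.
    move=> [p [B FB Bp]]; apply: subset_trans (bigcup_sup FB).
    by have [_] := FP _ FB; apply; exists p.
  split=> [a p q [B FB Bp] [C FC Cq]|p [B FB Bp]]; last first.
    by have [[_]] := FP _ FB => + _; exact.
  have [BC|CB] := totF _ _ FB FC.
    by exists C => //; have [[+ _] _] := FP _ FC; apply => //; exact: BC.
  by exists B => //; have [[+ _] _] := FP _ FB; apply => //; exact: CB.
have A0 : A !=set0.
  apply: contrapT => A0; have AE : A = set0 by apply: contrapT => /eqP/set0P.
  apply: (maxA S); last by split=> // _ ?.
  by rewrite AE; split=> [//|/(_ _ Sy)].
have tot v : exists r, A (v, r).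
  have [c domB] := dominated_graph_extend v domA A0.
  set B := [set p | _] in domB.
  have AB : A `<=` B by move=> p Ap; exists p, 0; rewrite scale0r mul0r !addr0; case: p Ap.
  have BA : B `<=` A.
    apply: contrapT => nBA; apply: (maxA B); first by split.
    by split=> // _; apply: subset_trans AB; exact: SA.
  exists c; apply: BA; exists (0, 0), 1; rewrite /= scale1r mul1r !add0r; split=> //.
  by apply: (SA A0); exists 0; rewrite scale0r mul0r.
case: domA => linA domA.
have uniqA v r s : A (v, r) -> A (v, s) -> r = s.
  move=> Ar As; apply/eqP; rewrite eq_le; apply/andP; split; rewrite -subr_ge0.
    have := domA _ (linA (-1) _ _ As Ar); rewrite /= scaleN1r addNr normr0 mulN1r; lra.
  have := domA _ (linA (-1) _ _ Ar As); rewrite /= scaleN1r addNr normr0 mulN1r; lra.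
pose T v : R^o := sval (cid (tot v)).
have TA v : A (v, T v) by exact: svalP (cid (tot v)).
have Tlin : linear T by move=> a u v; apply: uniqA (TA _) (linA a _ _ (TA u) (TA v)).
have TN v : T (- v) = - T v.
  have := linA (-1) _ _ (TA v) (linA (-1) _ _ (TA v) (TA v)).
  by rewrite /= scaleN1r mulN1r !addNr !addr0; exact: uniqA.
have Tle v : `|T v| <= `|v|.
  rewrite ler_norml (domA _ (TA v)) andbT lerNl -TN.
  by rewrite -normrN (domA _ (TA (- v))).
have Tc : T \in @continuous_linear R Y R^o.
  apply: (@bounded_continuous_linear _ _ _ _ 1) => // v.
  by rewrite mul1r.
exists (to_clinear T); split=> [|v]; rewrite to_clinearE//.
by apply: uniqA (TA y) _; exact: SA Sy.
Qed.

End HahnBanach.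

(** * Rescaling of (LA_k) and passage to scalar functions *)

Section Approximation.
Context {R : realType}.
Implicit Types X Y : normedModType R.

(* Property (LA_k) with constant [C], rescaled from the unit ball to all balls. *)
Definition ball_approximable (k : smoothness) X Y (C : R) :=
  forall (z : X) (r L : R) (f : X -> Y) (e : R), 0 < r -> 0 <= L -> 0 < e ->
  (forall x y, `|x - z| < r -> `|y - z| < r -> `|f x - f y| <= L * `|x - y|) ->
  exists g : X -> Y,
    [/\ forall x y, `|x - z| < r -> `|y - z| < r -> `|g x - g y| <= C * L * `|x - y|,
        Ck k [set x | `|x - z| < r] g &
        forall x, `|x - z| < r -> `|f x - g x| <= e].

(** Dilating by [r] multiplies Lipschitz constants by [r] and the inverse dilation divides them
    again, so the constant [C] does not depend on the ball. *)
Lemma property_LA_ball k X Y : property_LA k X Y ->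
  exists2 C, 0 <= C & ball_approximable k X Y C.
Proof.
move=> [C C0 LA]; exists C => // z r L f e r0 L0 e0 fL.
have rn0 : r != 0 by rewrite gt_eqF.
pose f' x := f (r *: x + z).
have unitE (x : X) : ball (0 : X) 1 x <-> `|r *: x + z - z| < r.
  by rewrite ballP subr0 addrK normrZ gtr0_norm// gtr_pMr.
have affE (x y : X) : r *: x + z - (r *: y + z) = r *: (x - y).
  by rewrite opprD addrACA subrr addr0 scalerBr.
have [||g [gL gk fg]] := LA (L * r) f' e _ _ e0.
- by rewrite mulr_ge0// ltW.
- move=> [x y] [/= /unitE x1 /unitE y1]; have := fL _ _ x1 y1.
  by rewrite affE normrZ (gtr0_norm r0) mulrA.
pose h x := r^-1 *: x + - (r^-1 *: z).
have hE x : r *: h x + z = x.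
  by rewrite scalerDr scalerN !scalerA mulfV// !scale1r subrK.
have hball x : `|x - z| < r -> ball (0 : X) 1 (h x) by move=> xz; apply/unitE; rewrite hE.
exists (g \o h); split=> [x y xz yz||x xz] /=.
- have := gL (h x, h y) (conj (hball x xz) (hball y yz)) => /=.
  move=> /le_trans; apply.
  rewrite (_ : h x - h y = r^-1 *: (x - y)); last by rewrite opprD addrACA subrr addr0 scalerBr.
  by rewrite normrZ gtr0_norm ?invr_gt0// !mulrA mulfK.
- by apply: Ck_sub (Ck_affine r^-1 (- (r^-1 *: z)) gk) => x /hball.
- by have := fg _ (hball x xz); rewrite /f' hE.
Qed.

(** Place a scalar function on the line through [y0], smooth it in [Y], and return by the norming
    functional of [y0]. The factors [|y0|] cancel, so [C] is kept. *)
Lemma ball_approximable_scalar k X Y C (y0 : Y) : y0 != 0 -> 0 <= C ->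
  ball_approximable k X Y C -> ball_approximable k X R^o C.
Proof.
move=> y0n0 C0 LA; have [T [Ty0 T1]] := hahn_banach_norming y0.
have ny0 : 0 < `|y0| by rewrite normr_gt0.
move=> z r L f e r0 L0 e0 fL.
have [|||g [gL gk fg]] := LA z r (L * `|y0|) (fun x => f x *: y0) (e * `|y0|) r0.
- by rewrite mulr_ge0.
- by rewrite mulr_gt0.
- by move=> x y xz yz; rewrite -scalerBl normrZ mulrAC ler_wpM2r// fL.
have TB a b : T (a - b) = T a - T b by rewrite linearB.
exists (fun x => `|y0|^-1 *: T (g x) : R^o); split=> [x y xz yz||x xz].
- rewrite -scalerBr -TB normrZ gtr0_norm ?invr_gt0// ler_pdivrMl//.
  rewrite (le_trans (T1 _))// (le_trans (gL _ _ xz yz))//.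
  by rewrite (_ : C * _ * _ = `|y0| * (C * L * `|x - y|))//; ring.
- by apply: (@Ck_scale _ k X R^o _ (fun=> `|y0|^-1)); [exact: Ck_cst|exact: Ck_clinear].
- have -> : f x = `|y0|^-1 *: T (f x *: y0).
    by rewrite linearZ /= Ty0 /GRing.scale /= mulrCA mulVf ?mulr1// gt_eqF.
  rewrite -scalerBr -TB normrZ gtr0_norm ?invr_gt0// ler_pdivrMl//.
  by rewrite (le_trans (T1 _))// (le_trans (fg _ xz))// mulrC.
Qed.

End Approximation.

(** * Smooth partitions of unity *)

Section PartitionOfUnity.
Context {R : realType}.
Implicit Types X Y : normedModType R.

(* Pick in each [A x] the least element for a fixed well-order of [T]. *)
Lemma coherent_choice (T : eqType) (A : T -> set T) :
  exists l : T -> T, (forall x, A x !=set0 -> A x (l x)) /\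
    forall x y, A x (l y) -> A y (l x) -> l x = l y.
Proof.
have [W wo] := wochoice.well_ordering_principle T.
have minA x : {z | A x !=set0 -> A x z /\ forall y, A x y -> W z y}.
  apply: cid; have [[y Ay]|] := pselect (A x !=set0); last by exists x.
  have [|z [[zA zmin] _]] := wo [pred y | `[< A x y >]].
    by exists y; rewrite inE.
  exists z => _; split; first by move: zA; rewrite inE.
  by move=> t At; apply: zmin; rewrite inE.
exists (fun x => sval (minA x)); split=> [x /(svalP (minA x))[]//|x y].
move: (svalP (minA x)) (svalP (minA y)); set a := sval _; set b := sval _.
move=> Ha Hb Axb Aya.
(* Each of the two least elements lies in the other set, so each is below the other. *)
have [Axa /(_ _ Axb) ab] := Ha (ex_intro _ _ Axb).
have [Ayb /(_ _ Aya) ba] := Hb (ex_intro _ _ Aya).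
have tot := wochoice.wo_chainW (wochoice.withinW wo : wochoice.wo_chain W predT).
have anti := wochoice.wo_chain_antisymmetric (wochoice.withinW wo : wochoice.wo_chain W predT).
by apply: anti => //; apply/andP.
Qed.

(** A smoothed distance to [E] is fed into [smooth_step]. [E] is bounded because approximation is
    available on balls only; the function is continued by 0 outside a larger ball. *)
Lemma smooth_urysohn k X C (E : set X) (rho d : R) : 0 <= C ->
  ball_approximable k X R^o C -> 0 < d -> d <= 1 -> 0 <= rho ->
  (forall x, E x -> `|x| <= rho) ->
  exists (u : X -> R^o) (L : R), 0 <= L /\
    [/\ Ck k setT u, forall x y, `|u x - u y| <= L * `|x - y|,
        forall x, 0 <= u x <= 1,
        forall x y, E x -> `|y - x| < d / 32 -> u y = 1 &
        forall y, (forall x, E x -> d / 4 <= `|y - x|) -> u y = 0].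
Proof.
move=> C0 LA d0 d1 rho0 Erho.
(* Including 1 truncates the distance and gives it a value when [E] is empty. *)
pose S (y : X) := [set t : R | t = 1 \/ exists2 x, E x & t = `|y - x|].
have S1 y : S y 1 by left.
have infS y : has_inf (S y).
  by split; [exists 1|exists 0 => _ [->|[x _ ->]]//]; rewrite ?ler01.
pose D y : R^o := inf (S y).
have D_le y x : E x -> D y <= `|y - x|.
  by move=> Ex; apply: ge_inf; [case: (infS y)|right; exists x].
have D1 y : D y <= 1 by apply: ge_inf => //; case: (infS y).
have D_lip x y : D x - D y <= `|x - y|.
  rewrite lerBlDr; apply/ler_addgt0Pr => e e0.
  have [t [->|[z Ez ->]] ty] := inf_adherent e0 (infS y).
    by rewrite (le_trans (D1 x))// (le_trans (ltW ty))// lerD2r lerDr.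
  rewrite (le_trans (D_le x z Ez))// -(subrKA y) (le_trans (ler_normD _ _))//.
  by rewrite -addrA lerD2l ltW.
have D_far y a : a <= 1 -> (forall x, E x -> a <= `|y - x|) -> a <= D y.
  move=> a1 far; apply: lb_le_inf; first by exists 1.
  by move=> _ [->|[x /far ? ->]].
have rho2 : 0 < rho + 2 by rewrite ltr_wpDl.
have e0 : 0 < d / 32 by rewrite divr_gt0.
have [|g [gL gk fg]] := LA 0 (rho + 2) 1 D (d / 32) rho2 ler01 e0.
  move=> x y _ _; rewrite mul1r ler_norml D_lip andbT lerNl opprB distrC.
  exact: D_lip.
have {}fg y : `|y| < rho + 2 -> `|D y - g y| <= d / 32.
  by move=> y2; apply: fg; rewrite subr0.
(* The argument of [smooth_step] is at most 0 if [g y <= d / 16] and at least 1 if [g y >= d / 8].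
   As [g] is within [d / 32] of [D], this covers [D y <= d / 32] and [D y >= d / 4]. *)
pose u (y : X) : R^o := if `|y| < rho + 2 then smooth_step (16 / d * g y - 1) else 0.
have u01 x : 0 <= u x <= 1.
  by rewrite /u; case: ifP => _; [exact: smooth_step_itv|rewrite lexx ler01].
have u0 y : (forall x, E x -> d / 4 <= `|y - x|) -> u y = 0.
  move=> far; rewrite /u; case: ifPn => // yr.
  have := D_far y (d / 4) _ far; have := fg y yr; rewrite ler_norml => /andP[_ gy] Dy.
  have {}Dy : d / 4 <= D y by apply: Dy; lra.
  rewrite smooth_step_eq0// lerBrDr mulrAC ler_pdivlMr//; lra.
have u0' y : rho + 1 < `|y| -> u y = 0.
  move=> ry; apply: u0 => x /Erho xr.
  have := lerB_dist y x; lra.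
have [M M0 ML] := @smooth_step_lipschitz R.
pose L := M * (16 / d * C) + 1.
have M16 : 0 <= M * (16 / d * C) by rewrite !mulr_ge0// invr_ge0 ltW.
have L1 : 1 <= L by rewrite lerDr.
exists u, L; split; first by rewrite (le_trans ler01).
split=> //.
- apply: Ck_local => x _; have [xr|xr] := ltP `|x| (rho + 2).
    exists [set y | `|y - 0| < rho + 2]; split; [exact: open_nearby|by rewrite /= subr0|].
    apply: (Ck_ext (f := fun y => smooth_step (16 / d * g y - 1))).
    + exact: open_nearby.
    + by move=> y; rewrite /= subr0 /u => ->.
    + apply: Ck_smooth_step; apply: (@Ck_add _ k X R^o _ _ (fun=> -1)); last exact: Ck_cst.
      by apply: (@Ck_scale _ k X R^o _ (fun=> 16 / d)) => //; exact: Ck_cst.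
  exists [set y | `|y - x| < 1]; split; [exact: open_nearby|by rewrite /= subrr normr0|].
  apply: (Ck_ext (f := fun=> 0)); [exact: open_nearby| |exact: Ck_cst].
  move=> y /= yx; rewrite u0'//; have := lerB_dist x y; rewrite distrC in yx; lra.
- have bnd x y : `|u x - u y| <= 1.
    have := u01 x; have := u01 y; rewrite ler_norml; lra.
  (* Since [u] vanishes beyond radius [rho + 1], a pair straddling the sphere of radius [rho + 2]
     has both values 0 or is at distance at least 1. The latter case accounts for the summand 1 in
     [L]. *)
  have far x y : `|x| < rho + 2 -> rho + 2 <= `|y| -> `|u x - u y| <= L * `|x - y|.
    move=> xr yr; have -> : u y = 0 by apply: u0'; lra.
    have [xr'|xr'] := ltP (rho + 1) `|x|; first by rewrite u0'// subrr normr0 mulr_ge0// (le_trans ler01).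
    have xy : 1 <= `|x - y| by rewrite distrC; have := lerB_dist y x; lra.
    rewrite (@le_trans _ _ 1)//; last by nra.
    by have := u01 x; rewrite subr0 => /andP[? ?]; rewrite ger0_norm.
  move=> x y; have [xr|xr] := ltP `|x| (rho + 2); have [yr|yr] := ltP `|y| (rho + 2).
  + rewrite /u xr yr (le_trans (ML _ _))//.
    rewrite opprD addrACA subrr addr0 -mulrBr normrM (@gtr0_norm _ (16 / d)) ?divr_gt0//.
    have := gL x y; rewrite !subr0 mulr1 => /(_ xr yr) gxy.
    rewrite (@le_trans _ _ (M * (16 / d * C) * `|x - y|))//; last by rewrite ler_wpM2r// lerDl.
    by rewrite -!mulrA ler_wpM2l// ler_wpM2l// ler_wpM2l// invr_ge0 ltW.
  + exact: far.
  + by rewrite distrC [`|x - y|]distrC; exact: far.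
  + by rewrite /u !ltNge xr yr /= subrr normr0 mulr_ge0// (le_trans ler01).
- move=> x y Ex yx; have := Erho _ Ex => xr.
  have yr : `|y| < rho + 2 by have := lerB_dist y x; lra.
  rewrite /u yr smooth_step_eq1// lerBlDr add0r mulrAC ler_pdivrMr// mul1r.
  have := D_le y x Ex; have := fg y yr; rewrite ler_norml; lra.
Qed.

(* A sigma-discrete [C^k] partition of unity subordinate to the balls [B(z, r z)], [z] in
   [O]: [phi n] lives on the disjoint union [V n] of open pieces, and [c n] sends a point of
   [V n] to the centre of the ball containing its piece. *)
Definition partition_of_unity k X (O : set X) (r : X -> R) (phi : nat -> X -> R^o)
    (L : nat -> R) (V : nat -> set X) (c : nat -> X -> X) :=
  [/\ forall n, Ck k setT (phi n),
      forall n, 0 <= L n /\ forall x y, `|phi n x - phi n y| <= L n * `|x - y|,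
      forall n x, 0 <= phi n x,
      forall n x, V n x -> [/\ O (c n x), `|x - c n x| < r (c n x) &
        \forall y \near x, V n y /\ c n y = c n x] &
      (forall n x, V n x \/ \forall y \near x, phi n y = 0) /\
      forall x, O x -> exists N, \forall y \near x,
        (forall n, (N <= n)%N -> phi n y = 0) /\ \sum_(n < N) phi n y = 1].

(** Stone's argument: a coherent choice of a ball for each point sorts points, by the room they have
    in their ball, into sets [E n] whose parts belonging to different balls are [d n] apart.
    Products of the Urysohn functions of the [E n] then replace the removal of earlier layers. *)
Lemma partition_of_unity_exists k X C (O : set X) (r : X -> R) : 0 <= C ->
  ball_approximable k X R^o C -> (forall x, O x -> 0 < r x) ->
  exists phi L V c, partition_of_unity k O r phi L V c.
Proof.
move=> C0 LA r0.
have [l [lA lcoh]] := coherent_choice (fun x => [set z | O z /\ `|x - z| < r z]).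
pose d n : R := n.+1%:R^-1.
have d0 n : 0 < d n by rewrite invr_gt0.
have d1 n : d n <= 1 by rewrite invf_le1// ler1n.
(* If two points of [E n] are closer than [d n], each lies in the ball chosen for the other, and
   coherence makes the two choices equal. *)
pose E n := [set x : X | [/\ `|x| <= n%:R, O (l x), `|x - l x| < r (l x) &
                            forall y, `|y - x| < d n -> `|y - l x| < r (l x)]].
have Ecoh n x y : E n x -> E n y -> `|x - y| < d n -> l x = l y.
  move=> [_ Ox _ bx] [_ Oy _ b_y] xy; apply: lcoh; split=> //; first exact: b_y.
  by apply: bx; rewrite distrC.
have Euc n := @smooth_urysohn k X C (E n) n%:R (d n) C0 LA (d0 n) (d1 n) (ler0n _ n)
  (fun x Ex => let: And4 h _ _ _ := Ex in h).
pose u n := sval (cid (Euc n)).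
have [Lu Hu] : exists Lu : nat -> R, forall n, 0 <= Lu n /\
    [/\ Ck k setT (u n), forall x y, `|u n x - u n y| <= Lu n * `|x - y|,
        forall x, 0 <= u n x <= 1,
        forall x y, E n x -> `|y - x| < d n / 32 -> u n y = 1 &
        forall y, (forall x, E n x -> d n / 4 <= `|y - x|) -> u n y = 0].
  have [Lu Hu] := choice (fun n => svalP (cid (Euc n))).
  by exists Lu.
(* The sum of the first N functions [phi] telescopes to [1 - w N]. Where some [u m] equals 1, all
   later [w] vanish, which gives both local finiteness and total mass 1. *)
pose w n (x : X) : R^o := \prod_(m < n) (1 - u m x).
pose phi n (x : X) : R^o := u n x * w n x.
pose Lw n : R := \sum_(m < n) Lu m.
have u01 n x : 0 <= u n x <= 1 by case: (Hu n) => _ [].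
have w01 n x : 0 <= w n x <= 1.
  apply/andP; split; first by apply: prodr_ge0 => i _; have := u01 i x; lra.
  by apply: prodr_ile1 => i _; have := u01 i x; lra.
have wS n x : w n.+1 x = w n x * (1 - u n x) by rewrite /w big_ord_recr.
have prod_lip (a b a' b' : R) : 0 <= b <= 1 -> 0 <= a' <= 1 ->
    `|a * b - a' * b'| <= `|a - a'| + `|b - b'|.
  move=> b1 a1; rewrite (_ : _ - _ = (a - a') * b + a' * (b - b')); last by ring.
  rewrite (le_trans (ler_normD _ _))// !normrM lerD//.
    by rewrite ler_piMr// ger0_norm; lra.
  by rewrite ler_piMl// ger0_norm; lra.
have Lw0 n : 0 <= Lw n by apply: sumr_ge0 => i _; case: (Hu i).
have w_lip n x y : `|w n x - w n y| <= Lw n * `|x - y|.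
  elim: n => [|n IHn]; first by rewrite /w !big_ord0 subrr normr0 mulr_ge0.
  rewrite !wS (le_trans (prod_lip _ _ _ _ _ _))//; first by have := u01 n x; lra.
  rewrite /Lw big_ord_recr/= mulrDl lerD//.
  rewrite (_ : 1 - u n x - _ = u n y - u n x); last by ring.
  rewrite distrC.
  by case: (Hu n) => _ [].
have w_C n : Ck k setT (w n).
  elim: n => [|n IHn].
    by rewrite (_ : w 0%N = fun=> 1) ?funeqE; [exact: Ck_cst|move=> x; rewrite /w big_ord0].
  rewrite (_ : w n.+1 = fun x => w n x *: (1 + (-1) *: u n x)).
    apply: (@Ck_scale _ k X R^o) => //; apply: Ck_add; first exact: Ck_cst.
    apply: (@Ck_scale _ k X R^o _ (fun=> -1)); first exact: Ck_cst.
    by case: (Hu n) => _ [].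
  by apply/funext => x; rewrite wS scaleN1r.
have sum_phi N x : \sum_(n < N) phi n x = 1 - w N x.
  elim: N => [|N IHN]; first by rewrite /w !big_ord0 subrr.
  by rewrite big_ord_recr/= IHN wS /phi; ring.
(* With half the separation as radius, two points of [E n] near the same [y] are less than [d n]
   apart, so [c n y] does not depend on the one selected. *)
pose V n := [set y : X | exists2 x, E n x & `|y - x| < d n / 2].
pose c n (y : X) : X := l (if pselect (V n y) is left h then s2val (cid2 h) else y).
have cE n x y : E n x -> `|y - x| < d n / 2 -> c n y = l x.
  move=> Ex yx; have Vy : V n y by exists x.
  rewrite /c; case: pselect => // h; case: cid2 => z /= Ez yz.
  by apply: (@Ecoh n) => //; rewrite distrC in yz; rewrite [d n]splitr; apply: norm_dist_trans yx.
exists phi, (fun n => Lu n + Lw n), V, c; split.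
- by move=> n; apply: (@Ck_scale _ k X R^o) => //; case: (Hu n) => _ [].
- move=> n; split; first by rewrite addr_ge0//; case: (Hu n).
  move=> x y; rewrite (le_trans (prod_lip _ _ _ _ _ _))// mulrDl lerD//.
  by case: (Hu n) => _ [].
- by move=> n x; rewrite mulr_ge0//; [have := u01 n x|have := w01 n x]; case/andP.
- move=> n y [x Ex yx]; rewrite (cE n x y Ex yx); have [xn Ox xl bx] := Ex.
  split=> //; first by apply: bx; rewrite (lt_trans yx)// gtr_pMr// invf_lt1// ltr1n.
  apply/near_ballP; exists (d n / 2 - `|y - x|); first by rewrite subr_gt0.
  move=> z zy; have zx : `|z - x| < d n / 2.
    by rewrite -(subrKA y) (le_lt_trans (ler_normD _ _))// -ltrBrDr.
  by split; [exists x|exact: cE].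
- split=> [n y|x Ox].
    have [Vy|nVy] := pselect (V n y); [by left|right].
    apply/near_ballP; exists (d n / 4); first by rewrite divr_gt0.
    move=> z zy; rewrite /phi; have [_ [_ _ _ _ ->]] := Hu n; first by rewrite mul0r.
    move=> x Ex; rewrite leNgt; apply/negP => zx; apply: nVy; exists x => //.
    rewrite (_ : d n / 2 = d n / 4 + d n / 4); last by field.
    by rewrite distrC in zy; exact: norm_dist_trans zx.
  have [Olx xlx] : O (l x) /\ `|x - l x| < r (l x).
    by apply: lA; exists x; split=> //; rewrite subrr normr0 r0.
  (* [N] exceeds the norm of [x] as well as the inverse of the room left around [x] in its chosen
     ball. *)
  have [N ENx] : exists N, E N x.
    have e0 : 0 < r (l x) - `|x - l x| by rewrite subr_gt0.
    pose N := maxn (Num.truncn `|x|).+1 (Num.truncn (r (l x) - `|x - l x|)^-1).+1.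
    exists N; split=> //.
      rewrite (le_trans (ltW (truncnS_gt _)))// ler_nat leq_max leqnn//.
    move=> y yx; rewrite -(subrKA x) (le_lt_trans (ler_normD _ _))// -ltrBrDr.
    rewrite (lt_le_trans yx)// /d invf_ple ?posrE// (le_trans (ltW (truncnS_gt _)))// ler_nat.
    by rewrite (leq_trans (leq_maxr _ _) (leqnSn _)).
  exists N.+1; apply/near_ballP; exists (d N / 32); first by rewrite divr_gt0.
  move=> y yx; have uy : u N y = 1 by have [_ [_ _ _ H _]] := Hu N; exact: H yx.
  have wy n : (N < n)%N -> w n y = 0.
    by move=> Nn; rewrite /w (bigD1 (Ordinal Nn))//= uy subrr mul0r.
  split; last by rewrite sum_phi wy ?subr0.
  by move=> n Nn; rewrite /phi wy// mulr0.
Qed.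

End PartitionOfUnity.

(** * Gluing *)

Section Gluing.
Context {R : realType}.
Implicit Types X Y : normedModType R.

(** Replaces a bound on the derivative for maps that need not be differentiable; for differentiable
    ones it gives such a bound by [lip_near_diff]. *)
Definition lip_near X Y (f : X -> Y) (M : R) (z : X) :=
  exists2 d : R, 0 < d & forall x y, `|x - z| < d -> `|y - z| < d ->
    `|f x - f y| <= M * `|x - y|.

Lemma lip_near_le X Y (f : X -> Y) (M M' : R) z : M <= M' ->
  lip_near f M z -> lip_near f M' z.
Proof.
move=> MM' [d d0 fM]; exists d => // x y xz yz.
by rewrite (le_trans (fM x y xz yz))// ler_wpM2r.
Qed.

Lemma is_diff_clinear X Y (T : 'L(X; Y)) x : is_diff x T T.
Proof.
apply/is_diffP => e e0; near=> y.
by rewrite -linearB subrr normr0 mulr_ge0// ltW.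
Unshelve. all: by end_near. Qed.

(** The difference quotient at [y + t v] is tested with [t] so small that the Lipschitz bound and
    the differentiability estimate both apply. Here control of Lipschitz constants turns into
    control of derivatives. *)
Lemma lip_near_diff X Y (g : X -> Y) (S T : 'L(X; Y)) (M : R) y : 0 <= M ->
  is_diff y g T -> lip_near (fun x => g x - S x) M y -> `|T - S| <= M.
Proof.
move=> M0 /is_diffP dg [d d0 gM]; apply: opnorm_le => // v.
have [->|v0] := eqVneq v 0; first by rewrite linear0 !normr0 mulr0.
have nv : 0 < `|v| by rewrite normr_gt0.
apply/ler_addgt0Pr => e e0.
have /near_ballP[d' d'0 dE] := dg (e / `|v|) (divr_gt0 e0 nv).
pose t := Num.min d d' / (2 * `|v|).
have m0 : 0 < Num.min d d' by rewrite lt_min d0 d'0.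
have t0 : 0 < t by rewrite divr_gt0// mulr_gt0.
have tv : `|t *: v| < Num.min d d'.
  by rewrite normrZ (gtr0_norm t0) /t invfM mulrA mulfVK ?gt_eqF// gtr_pMr// invf_lt1// ltr1n.
have := tv; rewrite lt_min => /andP[tvd tvd'].
have := dE (y + t *: v); rewrite addrAC subrr add0r => /(_ tvd') dgv.
have := gM (y + t *: v) y; rewrite addrAC subrr add0r normr0 => /(_ tvd d0) gv.
rewrite -(ler_pM2l t0) -[X in X * _ <= _](gtr0_norm t0) -normrZ.
have -> : t *: (T - S) v =
    (g (y + t *: v) - S (y + t *: v) - (g y - S y)) - (g (y + t *: v) - g y - T (t *: v)).
  by rewrite !clinearE; module R.
rewrite (le_trans (ler_normB _ _))// (le_trans (lerD gv dgv))//.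
rewrite normrZ (gtr0_norm t0) mulrDr mulrCA lerD//.
by rewrite mulrCA mulfVK ?gt_eqF.
Qed.

Lemma lip_near_clinear X Y (S T : 'L(X; Y)) (M : R) y : 0 <= M ->
  lip_near (fun x => T x - S x) M y -> `|T - S| <= M.
Proof. by move=> M0; apply: lip_near_diff => //; exact: is_diff_clinear. Qed.

Lemma Ck_id k X (O : set X) : Ck k O (@id X).
Proof.
have iE : to_clinear (@idfun X) = idfun :> (X -> X).
  by apply: to_clinearE; apply: (@bounded_continuous_linear _ _ _ _ 1) => // y; rewrite mul1r.
apply/CkP => -[|n] _; first by apply/Cn0P => x _; exact: cvg_id.
exists (fun=> to_clinear idfun); split=> [x _|]; last exact: Cn_cst.
by rewrite iE; exact: is_diff_id.
Qed.

(** A locally finite sum written as a finite one, cut at some index past which all weights vanish at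
    [x]; by [glueE] any such index gives the same value. Where there is none, the default 0 makes
    the sum empty. *)
Definition glue X Y (phi : nat -> X -> R^o) (g : nat -> X -> Y) (x : X) : Y :=
  \sum_(n < xget 0%N [set N | forall n, (N <= n)%N -> phi n x = 0]) phi n x *: g n x.

Lemma glueE X Y (phi : nat -> X -> R^o) (g : nat -> X -> Y) x N :
  (forall n, (N <= n)%N -> phi n x = 0) -> glue phi g x = \sum_(n < N) phi n x *: g n x.
Proof.
move=> phiN; rewrite /glue; set P := [set M | _].
have := @xgetPex _ 0%N P (ex_intro _ N phiN); set M := xget _ _ => phiM.
have key A B : (A <= B)%N -> (forall n, (A <= n)%N -> phi n x = 0) ->
    \sum_(n < B) phi n x *: g n x = \sum_(n < A) phi n x *: g n x.
  move=> AB phiA; rewrite -(subnKC AB) big_split_ord /= [X in _ + X]big1 ?addr0// => i _.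
  by rewrite phiA ?leq_addr// scale0r.
by have [MN|/ltnW NM] := leqP M N; [rewrite (key _ _ MN)|rewrite (key _ _ NM)].
Qed.

(** A piece need be smooth on [V n] only, for off [V n] its weight vanishes in a neighbourhood. The
    order [k'] is separate from [k] so that a C^k partition can glue C^1 pieces. *)
Lemma glue_Ck k k' X Y (O W : set X) r phi L V c (g : nat -> X -> Y) :
  partition_of_unity k O r phi L V c -> (forall n, Ck k' setT (phi n)) ->
  open W -> W `<=` O -> (forall n, Ck k' (V n `&` W) (g n)) -> Ck k' W (glue phi g).
Proof.
move=> [_ _ _ HV [supp sum1]] phiC oW WO gC.
have oV n : open (V n).
  by rewrite openE => x Vx; have [_ _] := HV n x Vx; apply: filterS => y [].
have termC n : Ck k' W (fun x => phi n x *: g n x).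
  apply: Ck_local => x Wx; have [Vx|] := supp n x.
    exists (V n `&` W); split=> //; first exact: openI.
    by apply: Ck_scale => //; apply: Ck_sub (phiC n).
  move=> /near_ballP[d d0 dphi]; exists [set y | `|y - x| < d].
  split; [exact: open_nearby|by rewrite /= subrr normr0|].
  apply: (Ck_ext (f := fun=> 0)); [exact: open_nearby| |exact: Ck_cst].
  by move=> y /dphi ->; rewrite scale0r.
apply: Ck_local => x Wx; have [N] := sum1 x (WO _ Wx).
move=> /near_ballP[d d0 HN]; exists (W `&` [set y | `|y - x| < d]).
have oI : open (W `&` [set y | `|y - x| < d]) by apply: openI => //; exact: open_nearby.
split=> //; first by split=> //=; rewrite subrr normr0.
apply: (Ck_ext (f := fun y => \sum_(n < N) phi n y *: g n y)) => //.
  by move=> y [_ /HN[phi0 _]]; rewrite (glueE _ phi0).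
by apply: (@Ck_sum _ k' X Y _ (fun n y => phi n y *: g n y)) => n _; apply: Ck_sub (termC n) => y [].
Qed.

(* On a small ball around [z] one smooths [F - T z], where [T z] is chosen so that the
   Lipschitz constant of [F - T z] near [z] is within [b z] of the least possible one;
   the errors of the pieces are then beaten down against the Lipschitz constants of
   the partition of unity. *)
Lemma smooth_approximation k X Y (C C' : R) (O : set X) (F : X -> Y) (d b : X -> R) :
  0 <= C -> ball_approximable k X Y C -> 0 <= C' -> ball_approximable k X R^o C' ->
  open O -> (forall z, O z -> 0 < d z) -> (forall z, O z -> 0 < b z) ->
  (forall z, O z -> exists2 M, 0 <= M & lip_near F M z) ->
  exists g : X -> Y, [/\ Ck k O g,
    forall y e, O y -> (forall z, O z -> `|y - z| < d z -> b z <= e) -> `|g y - F y| <= e &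
    forall y (S : 'L(X; Y)) eta e, O y -> 0 <= eta -> 0 <= e ->
      (forall z, O z -> `|y - z| < d z -> lip_near (fun x => F x - S x) eta z /\ b z <= e) ->
      lip_near (fun x => g x - S x) ((C + 2) * (eta + e)) y].
Proof.
move=> C0 LA C'0 LA' oO d0 b0 Floc.
have data z : exists q : R * 'L(X; Y) * R, O z -> [/\ 0 <= q.1.1, 0 < q.2 <= d z,
    forall x y, `|x - z| < q.2 -> `|y - z| < q.2 ->
      `|F x - q.1.2 x - (F y - q.1.2 y)| <= q.1.1 * `|x - y| &
    forall (S : 'L(X; Y)) eta, 0 <= eta -> lip_near (fun x => F x - S x) eta z ->
      q.1.1 <= eta + b z].
  have [Oz|] := pselect (O z); last by exists (0, 0, 0).
  (* The infimum is the best local Lipschitz constant of [F] minus a linear map. Coming within [b z]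
     of it makes [T z] nearly as good as every [S], although [S] is not known yet. *)
  pose A := [set e : R | 0 <= e /\ exists T : 'L(X; Y), lip_near (fun x => F x - T x) e z].
  have infA : has_inf A.
    split; last by exists 0 => e [].
    have [M M0 FM] := Floc z Oz; exists M; split=> //; exists 0.
    by have [r r0 rE] := FM; exists r => // x y xz yz; rewrite !clinear0 !subr0 rE.
  have [e [e0 [T [r r0 rE]]] eA] := inf_adherent (b0 z Oz) infA.
  exists (e, T, Num.min r (d z)) => _ /=; split=> //.
  - by rewrite lt_min r0 d0// ge_min lexx orbT.
  - by move=> x y; rewrite !lt_min => /andP[? _] /andP[? _]; exact: rE.
  - move=> S eta eta0 Slip; rewrite (le_trans (ltW eA))// lerD2r.
    by apply: ge_inf; [case: infA|split=> //; exists S].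
have [q qP] := choice data.
pose eps z := (q z).1.1; pose T z := (q z).1.2; pose r z := (q z).2.
have r0 z : O z -> 0 < r z by move=> /qP[_ /andP[]].
have [phi [L [V [c pou]]]] := partition_of_unity_exists C'0 LA' r0.
have [phiC phiL phi0 HV [supp sum1]] := pou.
have L0 n : 0 <= L n by case: (phiL n).
(* The factor [L n + 1] absorbs the Lipschitz constant of [phi n], and the powers of 1/2 keep the
   accumulated errors below the tolerance. *)
pose tiny n z := b z * (2^-1 ^+ n.+1 / (L n + 1)).
have Ln1 n : 0 < L n + 1 by rewrite ltr_wpDl.
have t0 n z : O z -> 0 < tiny n z.
  by move=> Oz; rewrite mulr_gt0 ?b0// divr_gt0// exprn_gt0// invr_gt0.
have pieces (p : nat * X) : exists h : X -> Y, O p.2 ->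
    [/\ forall x y, `|x - p.2| < r p.2 -> `|y - p.2| < r p.2 ->
          `|h x - T p.2 x - (h y - T p.2 y)| <= C * eps p.2 * `|x - y|,
        Ck k [set x | `|x - p.2| < r p.2] h &
        forall x, `|x - p.2| < r p.2 -> `|F x - h x| <= tiny p.1 p.2].
  case: p => n z /=; have [Oz|] := pselect (O z); last by exists (fun=> 0).
  have [e0 _ FT _] := qP z Oz.
  have [h [hL hC hF]] := LA z (r z) (eps z) (fun x => F x - T z x) _ (r0 z Oz) e0 (t0 n z Oz) FT.
  exists (fun x => h x + T z x) => _; split=> [x y xz yz||x xz].
  - by rewrite !addrK hL.
  - by apply: Ck_add => //; apply: Ck_clinear; exact: Ck_id.
  - by rewrite (_ : _ - _ = F x - T z x - h x) ?hF//; module R.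
have [h hP] := choice pieces.
pose g n x := h (n, c n x) x.
have gP n x : V n x -> O (c n x) /\ `|x - c n x| < d (c n x).
  move=> Vx; have [Oc cr _] := HV n x Vx; split=> //.
  by have [_ /andP[_ rd] _ _] := qP _ Oc; exact: lt_le_trans cr rd.
have gF n x : V n x -> `|F x - g n x| <= tiny n (c n x).
  by move=> Vx; have [Oc cr _] := HV n x Vx; have [_ _] := hP (n, c n x) Oc; exact.
have gC n : Ck k (V n `&` O) (g n).
  apply: Ck_local => x [Vx Ox]; have [Oc cr cV] := HV n x Vx.
  have /near_ballP[s s0 sV] := cV.
  exists ([set y | `|y - x| < s] `&` [set y | `|y - c n x| < r (c n x)]).
  have oI : open ([set y | `|y - x| < s] `&` [set y | `|y - c n x| < r (c n x)]).
    by apply: openI; exact: open_nearby.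
  split=> //; first by split=> //=; rewrite subrr normr0.
  apply: (Ck_ext (f := h (n, c n x))) => //.
    by move=> y [/sV[_ cy] _]; rewrite /g cy.
  by have [_ hC _] := hP (n, c n x) Oc; apply: Ck_sub hC => y [].
have tinyb n z : O z -> tiny n z <= b z.
  move=> Oz; rewrite ger_pMr ?b0// ler_pdivrMr// mul1r.
  by rewrite (@le_trans _ _ 1)// ?lerDr// exprn_ile1// invf_le1// ler1n.
exists (glue phi g); split.
- exact: glue_Ck pou phiC oO (fun _ => id) gC.
- move=> y e Oy be; have [N /nbhs_singleton[phiN s1]] := sum1 y Oy.
  rewrite (glueE _ phiN) -[F y]scale1r -s1 scaler_suml -sumrB.
  rewrite (le_trans (ler_norm_sum _ _ _))//.
  rewrite -[e]mul1r -s1 mulr_suml; apply: ler_sum => n _.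
  have [Vy|/nbhs_singleton ->] := supp n y; last by rewrite !scale0r subrr normr0 mul0r.
  rewrite -scalerBr normrZ ger0_norm// ler_wpM2l//.
  have [Oc cd] := gP n y Vy.
  by rewrite distrC (le_trans (gF n y Vy))// (le_trans (tinyb _ _ Oc))// be.
- move=> y S eta e Oy eta0 e0 Hy; have [N HN] := sum1 y Oy.
  (* Near [y] each of the finitely many terms has a fixed centre or a vanishing weight. *)
  have HV' : \forall x \near y, forall n : 'I_N,
      (V n y /\ V n x /\ c n x = c n y) \/ (~ V n y /\ phi n x = 0).
    apply: filter_forall => n; have [Vy|nVy] := pselect (V n y).
      by have [_ _] := HV n y Vy; apply: filterS => x [? ?]; left.
    by have [//|] := supp n y; apply: filterS => x ?; right.
  have [s s0 sP] := (near_ballP _ _).1 (filterI HN HV').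
  (* A piece minus [S] has constant at most [C eps + |T - S|], where [eps <= eta + e] and
     [|T - S| <= eps + eta]. The varying weights add another [e], for a total of
     [(C + 2) * (eta + e)]. *)
  pose K := (C + 1) * (eta + e) + eta.
  have K0 : 0 <= K by rewrite addr_ge0// mulr_ge0// addr_ge0.
  have two_sum : \sum_(n < N) 2^-1 ^+ n.+1 <= (1 : R).
    suff -> : \sum_(n < N) 2^-1 ^+ n.+1 = 1 - 2^-1 ^+ N :> R by rewrite gerBl exprn_ge0.
    elim: (N) => [|M IHM]; first by rewrite big_ord0 expr0 subrr.
    by rewrite big_ord_recr/= IHM exprS; field.
  apply: (@lip_near_le _ _ _ (K + e)); first by rewrite /K; nra.
  exists s => // x x' xy x'y.
  have [[phiN s1] xV] := sP x xy; have [[phiN' s1'] xV'] := sP x' x'y.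
  have -> : glue phi g x - S x - (glue phi g x' - S x') =
    \sum_(n < N) (phi n x *: ((g n x - S x) - (g n x' - S x'))
                + (phi n x - phi n x') *: (g n x' - F x')).
    rewrite (glueE _ phiN) (glueE _ phiN') -[in LHS](scale1r (S x)) -[in LHS](scale1r (S x')).
    rewrite -{1}s1 -s1' !scaler_suml -!sumrB.
    (* The weights have the same sum at [x] and [x'], so this zero term may be inserted. Increments
       of [phi n] then multiply only the small errors [g n x' - F x']. *)
    have z : \sum_(n < N) (phi n x - phi n x') *: (S x' - F x') = 0.
      by rewrite -scaler_suml sumrB s1 s1' subrr scale0r.
    rewrite -[LHS]addr0 -[X in _ + X = _]z -big_split /=; apply: eq_bigr => n _.
    by module R.
  rewrite (le_trans (ler_norm_sum _ _ _))//.
  have -> : K + e = K * \sum_(n < N) phi n x + e by rewrite s1 mulr1.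
  rewrite (@le_trans _ _ (\sum_(n < N) (K * phi n x + e * 2^-1 ^+ n.+1) * `|x - x'|))//; last first.
    rewrite -mulr_suml ler_wpM2r// big_split /= -!mulr_sumr lerD2l.
    by rewrite ler_piMr.
  apply: ler_sum => n _.
  have [[Vy [Vx cx]]|[nVy phix]] := xV n; last first.
    have [[//]|[_ phix']] := xV' n.
    by rewrite phix phix' subrr !scale0r addr0 normr0 mulr_ge0// addr_ge0// mulr_ge0// exprn_ge0.
  have [[_ [Vx' cx']]|[//]] := xV' n.
  have [Oc _] := gP n y Vy.
  rewrite (le_trans (ler_normD _ _))// !normrZ mulrDl lerD//.
    rewrite ger0_norm// [K * _]mulrC -mulrA ler_wpM2l//.
    pose z := c n y; have [hL _ _] := hP (n : nat, z) Oc.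
    have [_ cr _] := HV n x Vx; have [_ cr' _] := HV n x' Vx'.
    rewrite cx in cr; rewrite cx' in cr'.
    have [_ cd] := gP n y Vy; have [HS bz] := Hy z Oc cd.
    have [ez _ FT emin] := qP z Oc.
    have epsz : eps z <= eta + e by rewrite (le_trans (emin S eta eta0 HS))// lerD2l.
    (* Near [z] both [F - S] and [F - T z] have small Lipschitz constants, hence so does their
       difference [T z - S]. *)
    have TS : `|T z - S| <= eps z + eta.
      apply: (@lip_near_clinear _ _ _ _ _ z); first by rewrite addr_ge0.
      have [s1_ s10 s1P] := HS; exists (Num.min s1_ (r z)); first by rewrite lt_min s10 r0.
      move=> u u'; rewrite !lt_min => /andP[us ur] /andP[u's u'r].
      rewrite (_ : _ - _ = (F u - S u - (F u' - S u')) - (F u - T z u - (F u' - T z u'))).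
        rewrite (le_trans (ler_normB _ _))// addrC mulrDl lerD//; first exact: FT.
        exact: s1P.
      by rewrite ?clinearE; module R.
    rewrite /g cx cx' -/z (_ : _ - _ = (h (n : nat, z) x - T z x - (h (n : nat, z) x' - T z x'))
      + (T z - S) (x - x')).
      rewrite (le_trans (ler_normD _ _))// (le_trans (lerD (hL _ _ cr cr') (le_norm _ _)))//.
      rewrite -mulrDl ler_wpM2r// (le_trans (lerD (lexx _) TS))// /K; nra.
    by rewrite !clinearE; module R.
  have [_ Lip] := phiL n.
  have [_ cd] := gP n y Vy; have [_ bz] := Hy _ Oc cd.
  have gF' : `|g n x' - F x'| <= tiny n (c n y) by rewrite distrC -cx'; exact: gF.
  rewrite (le_trans (ler_pM _ _ (Lip x x') gF'))//.
  pose p : R := 2^-1 ^+ n.+1; have p0 : 0 <= p by rewrite exprn_ge0.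
  rewrite /tiny -/p.
  have -> : L n * `|x - x'| * (b (c n y) * (p / (L n + 1))) =
    (L n / (L n + 1)) * (b (c n y) * p * `|x - x'|) by ring.
  have b1 : 0 <= b (c n y) by exact/ltW/b0.
  rewrite (@le_trans _ _ (b (c n y) * p * `|x - x'|))//.
    by rewrite ler_piMl ?mulr_ge0// ler_pdivrMr// mul1r lerDl.
  by rewrite ler_wpM2r// ler_wpM2r.
Qed.

End Gluing.

(** * Smoothing off a closed set, up to its boundary *)

Section LocalExtension.
Context {R : realType}.
Implicit Types X Y : normedModType R.

(** [F] already has the right derivative on [A]. Off [A] it is replaced by an approximation so close
    that neither this derivative nor the limit of nearby derivatives is disturbed. The last clause
    keeps Lipschitz constants uniform. *)
Lemma extension_off_closed k X Y (C C' : R) (W A : set X) (F : X -> Y) (G : X -> 'L(X; Y)) :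
  k <> Cfinite 0 ->
  0 <= C -> ball_approximable k X Y C -> 0 <= C' -> ball_approximable k X R^o C' ->
  open W -> closed A ->
  (forall a, W a -> A a -> forall e, 0 < e -> \forall x \near a, A x -> `|G x - G a| <= e) ->
  (forall a, W a -> A a -> is_diff a F (G a)) ->
  (forall a, W a -> A a -> forall e, 0 < e ->
     \forall z \near a, ~ A z -> lip_near (fun x => F x - G a x) e z) ->
  (forall z, W z -> ~ A z -> exists2 M, 0 <= M & lip_near F M z) ->
  exists g : X -> Y, [/\ forall x, A x -> g x = F x,
    Ck (Cfinite 1) W g, Ck k (W `\` A) g &
    forall M, 0 <= M -> (forall z, W z -> ~ A z -> lip_near F M z) ->
      forall y, W y -> ~ A y -> lip_near g ((C + 2) * (M + 1)) y].
Proof.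
move=> k0 C0 LA C'0 LA' oW cA Gc Fd Fl Floc.
pose O := W `\` A.
have oO : open O by rewrite /O setDE; apply: openI => //; exact: closed_openC.
have data z : exists r : R, O z -> 0 < r <= 2^-1 /\ forall y, `|y - z| < r + r -> O y.
  have [Oz|] := pselect (O z); last by exists 0.
  have [r r0 rO] := (open_ballP O).1 oO z Oz.
  (* Halving leaves room for a ball of twice the radius inside [O]. So if [y] is within [d z] of
     [z], it is at distance at least [d z] from [A]. *)
  exists (Num.min r 1 / 2) => _; split; last first.
    by move=> y; rewrite -splitr lt_min => /andP[/rO].
  rewrite divr_gt0 ?lt_min ?r0//= ler_pdivrMr// mulVf// ge_min lexx orbT//.
have [d dP] := choice data.
have d0 z : O z -> 0 < d z by move=> /dP[/andP[]].
(* The tolerance [d z ^+ 2] is at most [|y - a| ^+ 2] for every centre [z] that matters at [y],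
   hence negligible against [|y - a|]. *)
have b0 z : O z -> 0 < d z ^+ 2 by move=> /d0 ?; rewrite exprn_gt0.
have dA a y z : A a -> O z -> `|y - z| < d z -> d z <= `|y - a|.
  move=> Aa Oz yz; rewrite leNgt; apply/negP => ya.
  have [_ /(_ a) []//] := dP z Oz; rewrite distrC in ya.
  exact: norm_dist_trans yz.
have Floc' z : O z -> exists2 M, 0 <= M & lip_near F M z by move=> [? ?]; exact: Floc.
have [g [gk gF gl]] := smooth_approximation C0 LA C'0 LA' oO d0 b0 Floc'.
pose g' x := if pselect (O x) then g x else F x.
have g'g x : O x -> g' x = g x by rewrite /g'; case: pselect.
have g'F x : ~ O x -> g' x = F x by rewrite /g'; case: pselect.
have g'k : Ck k O g' by apply: Ck_ext gk => // x /g'g.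
have near_g x : O x -> \forall y \near x, g y = g' y.
  move=> Ox; have : nbhs x O by exact: open_nbhs_nbhs.
  by apply: filterS => y /g'g.
have [Dg [gD /Cn0P Dgc]] := Ck_C1 k0 g'k.
pose D x := if pselect (O x) then Dg x else G x.
have DDg x : O x -> D x = Dg x by rewrite /D; case: pselect.
have DG x : ~ O x -> D x = G x by rewrite /D; case: pselect.
have b_le a y z : A a -> O z -> `|y - z| < d z -> d z ^+ 2 <= `|y - a| ^+ 2.
  move=> Aa Oz yz; rewrite ler_pXn2r ?nnegrE ?(dA a y z)//.
  exact/ltW/d0.
exists g'; split=> //; first by move=> x Ax; rewrite g'F// => -[].
- exists D; split=> [x Wx|].
    have [Ax|nAx] := pselect (A x); last by rewrite DDg//; exact: gD.
    have nOx : ~ O x by case.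
    rewrite DG//; have /is_diffP dF := Fd x Wx Ax; apply/is_diffP => e e0.
    have e2 : 0 < e / 2 by rewrite divr_gt0.
    near=> y; rewrite (g'F x)//.
    have Fy : `|F y - F x - G x (y - x)| <= e / 2 * `|y - x| by near: y; exact: dF.
    have [Oy|nOy] := pselect (O y); last first.
      by rewrite g'F// (le_trans Fy)// ler_wpM2r// ger_pMr// invf_le1// ler1n.
    rewrite g'g// (_ : _ - _ = (F y - F x - G x (y - x)) + (g y - F y)); last by module R.
    rewrite (le_trans (ler_normD _ _))// [e]splitr mulrDl lerD//.
    have yx : `|y - x| < e / 2.
      by near: y; apply/near_ballP; exists (e / 2).
    rewrite (le_trans (gF y (`|y - x| ^+ 2) Oy _))//.
      by move=> z Oz yz; exact: b_le.
    by rewrite expr2 ler_wpM2r// ltW.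
  apply/Cn0P => x Wx; apply/continuous_atP => e e0.
  have [Ax|nAx] := pselect (A x); last first.
    have Ox : O x by [].
    have /continuous_atP/(_ e e0) := Dgc x Ox.
    have : nbhs x O by exact: open_nbhs_nbhs.
    by apply: filterS2 => y Oy; rewrite !DDg.
  rewrite (DG x); last by case.
  (* The Lipschitz part and the tolerance each get [e / (4 (C + 2))], so the factor [C + 2] brings
     their sum to [e / 2]. *)
  have e4 : 0 < e / (4 * (C + 2)).
    by rewrite divr_gt0// mulr_gt0// ltr_wpDl.
  have e2 : 0 < e / 2 by rewrite divr_gt0.
  have [s s0 sF] := (near_ballP _ _).1 (Fl x Wx Ax _ e4).
  near=> y.
  have Wy : W y by near: y; exact: open_nbhs_nbhs.
  have [Ay|nAy] := pselect (A y).
    rewrite DG; last by case.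
    rewrite (@le_lt_trans _ _ (e / 2))//; last by rewrite gtr_pMr// invf_lt1// ltr1n.
    by move: Ay; near: y; exact: Gc.
  have Oy : O y by [].
  rewrite DDg//.
  have yx : `|y - x| < Num.min (s / 2) (Num.min 1 (e / (4 * (C + 2)))).
    near: y; apply/near_ballP; exists (Num.min (s / 2) (Num.min 1 (e / (4 * (C + 2))))) => //.
    by rewrite !lt_min divr_gt0// ltr01.
  move: yx; rewrite !lt_min => /and3P[yxs yx1 yxe].
  have yx2 : `|y - x| ^+ 2 <= e / (4 * (C + 2)).
    rewrite expr2 (le_trans _ (ltW yxe))// ler_piMr// ltW//.
  have := gl y (G x) _ _ Oy (ltW e4) (sqr_ge0 `|y - x|) _.
  move=> /(_ _)/(lip_near_diff _) H.
  have dgy : is_diff y g (Dg y).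
    by apply: is_diff_near (gD y Oy); apply: filterS (near_g y Oy) => z ->.
  rewrite (le_lt_trans (H (Dg y) _ dgy _))//.
  + by rewrite mulr_ge0 ?addr_ge0 ?(ltW e4) ?sqr_ge0.
  (* A centre relevant to [y] satisfies [|y - z| < d z <= |y - x|], so it stays within [s] of
     [x]. *)
  + move=> z Oz yz; split; last exact: b_le.
    have [_ nAz] := Oz; apply: (sF z) => //.
    have dz := dA x y z Ax Oz yz; rewrite distrC in yz; rewrite [s]splitr.
    apply: (@norm_dist_trans _ _ _ y) => //.
    by rewrite (lt_le_trans yz)// (le_trans dz)// ltW.
  + rewrite (@le_lt_trans _ _ ((C + 2) * (e / (4 * (C + 2)) + e / (4 * (C + 2)))))//.
      by rewrite ler_wpM2l ?addr_ge0// lerD2l.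
    have C2 : C + 2 != 0 by rewrite gt_eqF// ltr_wpDl.
    have -> : (C + 2) * (e / (4 * (C + 2)) + e / (4 * (C + 2))) = e / 2 by field.
    by rewrite gtr_pMr// invf_lt1// ltr1n.
- move=> M M0 FM y Wy nAy; have Oy : O y by [].
  have [|s s0 sg] := gl y 0 M 1 Oy M0 ler01.
    move=> z Oz yz; split.
      have [Wz nAz] := Oz; have [r r0 rF] := FM z Wz nAz; exists r => // u v uz vz.
      by rewrite !clinear0 !subr0 rF.
    have [/andP[_ d2] _] := dP z Oz.
    by rewrite exprn_ile1 ?(ltW (d0 _ Oz))// (le_trans d2)// invf_le1// ler1n.
  have [r r0 rg] := (near_ballP _ _).1 (near_g y Oy).
  exists (Num.min r s); first by rewrite lt_min r0.
  move=> u v; rewrite !lt_min => /andP[ur us] /andP[vr vs].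
  by have := sg u v us vs; rewrite !clinear0 !subr0 !rg.
Unshelve. all: by end_near. Qed.

End LocalExtension.

(** * Extension by reflection *)

Section Reflection.
Context {R : realType}.
Implicit Types X Y : normedModType R.

(** Length is encoded by a parametrisation on [0, 1] with Lipschitz constant [K |y - x|], which is
    what bi-Lipschitz images of segments provide. *)
Definition quasiconvex_near X (U : set X) (a : X) := exists K d : R,
  [/\ 0 <= K, 0 < d & forall x y, U x -> U y -> `|x - a| < d -> `|y - a| < d ->
    exists gamma : R -> X, [/\ gamma 0 = x, gamma 1 = y,
      forall s, 0 <= s <= 1 -> U (gamma s) &
      forall s s', 0 <= s <= 1 -> 0 <= s' <= 1 ->
        `|gamma s' - gamma s| <= K * `|y - x| * `|s' - s|]].

Lemma quasiconvex_near_open X (U : set X) a : open U -> U a -> quasiconvex_near U a.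
Proof.
move=> /open_ballP oU /oU[d d0 dU]; exists 1, d; split=> // x y Ux Uy xa ya.
exists (fun s => x + s *: (y - x)); split.
- by rewrite scale0r addr0.
- by rewrite scale1r subrKC.
- move=> s /andP[s0 s1]; apply: dU.
  rewrite (_ : _ - _ = (1 - s) *: (x - a) + s *: (y - a)); last by module R.
  rewrite (le_lt_trans (ler_normD _ _))// !normrZ !ger0_norm ?subr_ge0//.
  have : (1 - s) * `|x - a| <= (1 - s) * Num.max `|x - a| `|y - a|.
    by rewrite ler_wpM2l ?subr_ge0// le_max lexx.
  have : s * `|y - a| <= s * Num.max `|x - a| `|y - a|.
    by rewrite ler_wpM2l// le_max lexx orbT.
  have : Num.max `|x - a| `|y - a| < d by rewrite gt_max xa.
  lra.
- move=> s s' _ _; rewrite mul1r.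
  by rewrite (_ : _ - _ = (s' - s) *: (y - x)) ?normrZ 1?mulrC//; module R.
Qed.

(** Both points vary and [f a] does not occur, so the notion makes sense at boundary points outside
    [A], before [f] has been extended to them. *)
Definition strictly_differentiable_on X Y (A : set X) (f : X -> Y) (T : 'L(X; Y)) (a : X) :=
  forall e, 0 < e -> exists2 d : R, 0 < d & forall x y, A x -> A y ->
    `|x - a| < d -> `|y - a| < d -> `|f x - f y - T (x - y)| <= e * `|x - y|.

Lemma quasiconvex_strict X Y (U A : set X) (f : X -> Y) (G : X -> 'L(X; Y)) a :
  U `<=` A -> (forall x, U x -> is_diff x f (G x)) ->
  (forall e, 0 < e -> \forall x \near a, A x -> `|G x - G a| <= e) ->
  quasiconvex_near U a -> strictly_differentiable_on U f (G a) a.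
Proof.
move=> UA fG Gc [K [d [K0 d0 Ud]]] e e0.
have K1 : 0 < K + 1 by rewrite ltr_wpDl.
have e'0 : 0 < e / (K + 1) by rewrite divr_gt0.
have [s s0 sG] := (near_ballP _ _).1 (Gc _ e'0).
(* A curve from [x] stays within [K |y - x|] of [x], hence within [2 K + 1] times the larger
   distance of [x] and [y] from [a]. *)
have K2 : 0 < 2 * K + 1 by rewrite ltr_wpDl// mulr_ge0.
have m0 : 0 < Num.min d (s / (2 * K + 1)) by rewrite lt_min d0 divr_gt0.
exists (Num.min d (s / (2 * K + 1))) => // y x Uy Ux.
rewrite !lt_min => /andP[yd ys] /andP[xd xs].
have [gamma [g0 g1 gU gL]] := Ud x y Ux Uy xd yd.
pose h z := f z - G a z.
have hD z : U z -> is_diff z h (G z - G a).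
  move=> Uz; have := is_diff_add (fG z Uz) (is_diff_clinear (- G a) z).
  exact.
have := @curve_diff_mean_value _ X Y h gamma (K * `|y - x|) (e / (K + 1)).
rewrite g0 g1 => H; rewrite (_ : _ - _ = h y - h x); last first.
  by rewrite /h !clinearE; module R.
rewrite (le_trans (H _ _ _ _))//; [by rewrite mulr_ge0|exact: ltW| | ]; last first.
  rewrite mulrA ler_wpM2r// mulrAC ler_pdivrMr// ler_pM2l//.
  by rewrite lerDl.
move=> t t01; exists (G (gamma t) - G a); first exact/hD/gU.
apply: sG; last exact/UA/gU.
rewrite -(subrKA x) (le_lt_trans (ler_normD _ _))//.
have gt : `|gamma t - x| <= K * `|y - x|.
  have := gL 0 t; rewrite lexx ler01 g0 subr0 => /(_ isT t01)/le_trans; apply.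
  by rewrite ler_piMr ?mulr_ge0//; case/andP: t01 => t0 t1; rewrite ger0_norm.
have xy : `|y - x| <= `|y - a| + `|x - a|.
  by rewrite -(subrKA a) (le_trans (ler_normD _ _))// [`|a - x|]distrC.
rewrite (le_lt_trans (lerD gt (lexx _)))//.
move: ys xs; rewrite !ltr_pdivlMr// => ys xs.
by move: (`|y - x|) (`|y - a|) (`|x - a|) xy (normr_ge0 (y - a)) ys xs => p q r *; nra.
Qed.

(** Strict differentiability makes [f] Lipschitz on [U] near every point of the closure, so limits
    exist by completeness of [Y]. The two-point estimate then passes to the limit with the same [e]
    and [d]. *)
Lemma strict_closure_extension X (Y : completeNormedModType R) (U : set X) (f : X -> Y)
    (G : X -> 'L(X; Y)) :
  (forall a, closure U a -> strictly_differentiable_on U f (G a) a) ->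
  exists h : X -> Y, (forall x, U x -> h x = f x) /\
    forall a, closure U a -> strictly_differentiable_on (closure U) h (G a) a.
Proof.
move=> fG.
have lim_ex a : exists l : Y, (U a -> l = f a) /\ (closure U a -> forall e, 0 < e ->
    exists2 x, U x & `|x - a| < e /\ `|f x - l| < e).
  have [Ua|nUa] := pselect (U a).
    by exists (f a); split=> // _ e e0; exists a; rewrite ?subrr ?normr0.
  have [cUa|] := pselect (closure U a); last by exists 0.
  have PF : ProperFilter (within U (nbhs a)) by exact: within_nbhs_proper.
  have [d d0 dU] := fG a cUa 1 ltr01.
  pose K := `|G a| + 1; have K0 : 0 < K by rewrite ltr_wpDl.
  have fL x y : U x -> U y -> `|x - a| < d -> `|y - a| < d -> `|f x - f y| <= K * `|x - y|.
    move=> Ux Uy xa ya; rewrite -(subrK (G a (x - y)) (f x - f y)).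
    rewrite (le_trans (ler_normD _ _))// addrC mulrDl lerD ?le_norm//.
    exact: dU.
  have : cvg (f @ within U (nbhs a)).
    apply: cauchy_cvg; apply: cauchy_exP => e /= e0.
    pose r := Num.min d (e / (2 * K)).
    have r0 : 0 < r by rewrite lt_min d0 divr_gt0// mulr_gt0.
    have [x [Ux /ballP xa]] := cUa _ (nbhsx_ballx a r r0).
    exists (f x); apply/near_ballP; exists r => // y ya Uy; apply/ballP.
    move: xa ya; rewrite !lt_min => /andP[xd xe] /andP[yd ye].
    rewrite (le_lt_trans (fL _ _ Uy Ux yd xd))//.
    have yx : `|y - x| < e / (2 * K) + e / (2 * K).
      by apply: norm_dist_trans ye _; rewrite distrC.
    rewrite (_ : e / (2 * K) + _ = e / K) in yx; last by field; rewrite gt_eqF.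
    by rewrite mulrC -ltr_pdivlMr.
  move=> /cvg_ex[l fl]; exists l; split=> // _ e e0.
  move/cvgrPdist_lt: fl => /(_ e e0)/near_ballP[r r0 rE].
  have m0 : 0 < Num.min r e by rewrite lt_min r0.
  have [x [Ux /ballP]] := cUa _ (nbhsx_ballx a (Num.min r e) m0).
  rewrite lt_min => /andP[xr xe]; exists x => //; split=> //.
  by rewrite distrC; exact: rE.
have [h hP] := choice lim_ex.
exists h; split=> [x|a cUa e e0]; first by case: (hP x).
have [d d0 dU] := fG a cUa e e0; exists d => // x y cx cy xd yd.
apply/ler_addgt0Pr => e' e'0.
(* Moving both points by less than [m] costs at most [2 m] in each of the distance, weighted by [e],
   the argument of [G a], and the values. *)
pose K := 2 * e + 2 + 2 * `|G a|.
have K0 : 0 < K by rewrite ltr_pwDl// addr_gt0// mulr_gt0.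
pose m := Num.min (e' / K) (Num.min (d - `|x - a|) (d - `|y - a|)).
have m0 : 0 < m by rewrite !lt_min divr_gt0// !subr_gt0 xd.
have [_ /(_ cx _ m0)[x' Ux' [x'x fx']]] := hP x.
have [_ /(_ cy _ m0)[y' Uy' [y'y fy']]] := hP y.
have x'd : `|x' - a| < d.
  rewrite -(subrKA x) (le_lt_trans (ler_normD _ _))// -ltrBrDr (lt_le_trans x'x)//.
  by rewrite /m !ge_min lexx !orbT.
have y'd : `|y' - a| < d.
  rewrite -(subrKA y) (le_lt_trans (ler_normD _ _))// -ltrBrDr (lt_le_trans y'y)//.
  by rewrite /m !ge_min lexx !orbT.
have mK : m * K <= e' by rewrite -ler_pdivlMr// /m ge_min lexx.
have H := dU x' y' Ux' Uy' x'd y'd.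
have xy : `|x' - y'| <= `|x - y| + 2 * m.
  rewrite (_ : x' - y' = (x - y) + ((x' - x) - (y' - y))); last by module R.
  rewrite (le_trans (ler_normD _ _))// lerD2l (le_trans (ler_normB _ _))//.
  by rewrite mulr_natl mulr2n lerD// ltW.
have gxy : `|G a ((x' - x) - (y' - y))| <= `|G a| * (2 * m).
  rewrite (le_trans (le_norm _ _))// ler_wpM2l// (le_trans (ler_normB _ _))//.
  by rewrite mulr_natl mulr2n lerD// ltW.
rewrite (_ : _ - _ = (f x' - f y' - G a (x' - y')) + (G a ((x' - x) - (y' - y))
  - ((f x' - h x) - (f y' - h y)))); last by rewrite !clinearE; module R.
rewrite (le_trans (ler_normD _ _))//.
rewrite (le_trans (lerD H (ler_normB _ _)))//.
rewrite (le_trans (lerD (lexx _) (lerD gxy (ler_normB _ _))))//.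
have := ler_wpM2l (ltW e0) xy; rewrite /K in mK.
move: fx' fy'; move: (`|f x' - h x|) (`|f y' - h y|) => p q pm qm.
by lra.
Qed.

(* Both [rho z] and [sigma z] lie in [U], so that the difference quotient
   [(f (sigma z) - f (rho z)) / t] can replace the derivative of [f] in the
   direction [z - rho z]. *)
Definition reflection X (U W : set X) (K t : R) (rho sigma : X -> X) :=
  [/\ 0 <= K /\ 0 < t,
      forall z, W z -> ~ closure U z -> U (rho z) /\ U (sigma z),
      forall z z', W z -> ~ closure U z -> W z' -> ~ closure U z' ->
        `|rho z - rho z'| <= K * `|z - z'| /\ `|sigma z - sigma z'| <= K * `|z - z'| &
      forall b, W b -> closure U b -> ~ U b -> \forall z \near b, ~ closure U z ->
        sigma z = rho z + t *: (z - rho z) /\ `|rho z - b| <= K * `|z - b|].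

Section ReflectionExtension.
Variables (X Y : normedModType R) (U W : set X) (h : X -> Y) (G : X -> 'L(X; Y)).
Variables (K t : R) (rho sigma : X -> X).
Hypotheses (oU : open U) (oW : open W).
Hypothesis hG : forall a, closure U a -> strictly_differentiable_on (closure U) h (G a) a.
Hypothesis refl : reflection U W K t rho sigma.

Definition reflected (z : X) : Y :=
  if pselect (closure U z) then h z else h (rho z) + t^-1 *: (h (sigma z) - h (rho z)).

Lemma reflected_closure z : closure U z -> reflected z = h z.
Proof. by rewrite /reflected; case: pselect. Qed.

Lemma reflected_out z : ~ closure U z ->
  reflected z = h (rho z) + t^-1 *: (h (sigma z) - h (rho z)).
Proof. by rewrite /reflected; case: pselect. Qed.

Let K0 : 0 <= K. Proof. by case: refl => -[]. Qed.
Let t0 : 0 < t. Proof. by case: refl => -[]. Qed.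

Let near_out z : W z -> ~ closure U z -> \forall y \near z, W y /\ ~ closure U y.
Proof.
move=> Wz nAz; apply: filterI; first exact: open_nbhs_nbhs.
by apply: open_nbhs_nbhs; split=> //; apply: closed_openC; exact: closed_closure.
Qed.

(* [sigma z - rho z = t (z - rho z)] makes the remainder vanish when [h] is linear. *)
Lemma reflected_remainder b z : ~ closure U z -> sigma z = rho z + t *: (z - rho z) ->
  reflected z - G b z = (h (rho z) - G b (rho z)) +
    t^-1 *: ((h (sigma z) - G b (sigma z)) - (h (rho z) - G b (rho z))).
Proof.
move=> nAz sz; rewrite reflected_out//.
have -> : G b z = G b (rho z) + t^-1 *: (G b (sigma z) - G b (rho z)).
  rewrite sz !clinearE [_ + t *: _ - _]addrC addKr scalerA mulVf ?gt_eqF// scale1r.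
  by module R.
by module R.
Qed.

(** Both auxiliary points tend to [b] together with [z], which brings them into the range of strict
    differentiability at [b]. *)
Lemma reflected_near b : W b -> closure U b -> ~ U b -> forall d, 0 < d ->
  \forall z \near b, ~ closure U z ->
    [/\ sigma z = rho z + t *: (z - rho z), `|rho z - b| <= K * `|z - b|,
        `|rho z - b| < d, `|sigma z - b| < d & `|sigma z - rho z| <= t * (K + 1) * `|z - b|].
Proof.
move=> Wb Ab nUb d d0; have [_ _ _ /(_ b Wb Ab nUb) nb] := refl.
pose M := K + t * (K + 1) + 1.
have M0 : 0 < M by rewrite ltr_wpDl// addr_ge0// mulr_ge0 ?(ltW t0)// addr_ge0.
near=> z => nAz.
have [sz rz] : sigma z = rho z + t *: (z - rho z) /\ `|rho z - b| <= K * `|z - b|.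
  by move: nAz; near: z; exact: nb.
have zb : `|z - b| < d / M by near: z; apply/near_ballP; exists (d / M); rewrite ?divr_gt0.
have srz : `|sigma z - rho z| <= t * (K + 1) * `|z - b|.
  rewrite sz addrC addKr normrZ (gtr0_norm t0) -mulrA ler_wpM2l ?(ltW t0)//.
  rewrite mulrDl mul1r [leRHS]addrC -(subrKA b) (le_trans (ler_normD _ _))// lerD2l.
  by rewrite distrC.
have Mz : M * `|z - b| < d by rewrite mulrC -ltr_pdivlMr.
have zb0 : 0 <= `|z - b| by [].
split=> //.
- rewrite (le_lt_trans rz)// (le_lt_trans _ Mz)// ler_wpM2r// /M.
  by rewrite -addrA lerDl addr_ge0// mulr_ge0 ?(ltW t0)// addr_ge0.
- rewrite -(subrKA (rho z)) (le_lt_trans (ler_normD _ _))//.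
  rewrite (le_lt_trans (lerD srz rz))// (le_lt_trans _ Mz)// /M.
  by rewrite !mulrDl; lra.
Unshelve. all: by end_near. Qed.

(** The distance from [sigma z] to [rho z] carries a factor [t], which cancels [t^-1]. The two
    remainders contribute [K] and [K + 1], within the chosen [2 * K + 2]. *)
Lemma reflected_diff b : W b -> closure U b -> is_diff b reflected (G b).
Proof.
move=> Wb Ab; apply/is_diffP => e e0.
have M0 : 0 < 2 * K + 2 by rewrite ltr_wpDl// mulr_ge0.
have e'0 : 0 < e / (2 * K + 2) by rewrite divr_gt0.
have [d d0 hd] := hG Ab e'0.
have bd : `|b - b| < d by rewrite subrr normr0.
have nearA z : closure U z -> `|z - b| < d ->
    `|reflected z - reflected b - G b (z - b)| <= e * `|z - b|.
  move=> Az zb; rewrite !reflected_closure// (le_trans (hd z b Az Ab zb bd))//.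
  rewrite ler_wpM2r// ler_pdivrMr// ler_peMr ?(ltW e0)//.
  by have := K0; lra.
have [Ub|nUb] := pselect (U b).
  near=> z; apply: nearA; last by near: z; apply/near_ballP; exists d.
  by apply: subset_closure; near: z; exact: open_nbhs_nbhs.
near=> z.
have zb : `|z - b| < d by near: z; apply/near_ballP; exists d.
have [Az|nAz] := pselect (closure U z); first exact: nearA.
have [sz rz rzd szd srz] : [/\ sigma z = rho z + t *: (z - rho z), `|rho z - b| <= K * `|z - b|,
    `|rho z - b| < d, `|sigma z - b| < d & `|sigma z - rho z| <= t * (K + 1) * `|z - b|].
  by move: nAz; near: z; exact: reflected_near.
have Wz : W z by near: z; exact: open_nbhs_nbhs.
have [_ /(_ z Wz nAz)[Ur Us] _ _] := refl.
rewrite (_ : _ - _ = (reflected z - G b z) - (reflected b - G b b)); last first.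
  by rewrite !clinearE; module R.
rewrite reflected_remainder// reflected_closure//.
have h1 := hd _ _ (subset_closure Ur) Ab rzd bd.
have h2 := hd _ _ (subset_closure Us) (subset_closure Ur) szd rzd.
rewrite (_ : _ - _ = (h (rho z) - h b - G b (rho z - b)) +
   t^-1 *: (h (sigma z) - h (rho z) - G b (sigma z - rho z))); last first.
  by rewrite !clinearE; module R.
rewrite (le_trans (ler_normD _ _))// normrZ gtr0_norm ?invr_gt0//.
rewrite (@le_trans _ _ (e / (2 * K + 2) * (K * `|z - b|) +
    t^-1 * (e / (2 * K + 2) * (t * (K + 1) * `|z - b|))))//.
  apply: lerD; first by rewrite (le_trans h1)// ler_wpM2l// ltW.
  rewrite ler_wpM2l ?invr_ge0 ?(ltW t0)// (le_trans h2)// ler_wpM2l// ltW//.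
rewrite (_ : _ + _ = e * `|z - b| * ((2 * K + 1) / (2 * K + 2))); last first.
  by field; rewrite !gt_eqF.
rewrite ler_piMr ?mulr_ge0// ?(ltW e0)// ler_pdivrMr// mul1r lerD2l.
by rewrite ler1n.
Unshelve. all: by end_near. Qed.

(** Increments of [h - G b] at the [rho] points and at the [sigma] points are each at most a small
    multiple of [K |x - y|]. They enter once with weight 1 and twice with weight [t^-1], hence the
    constant [K + t^-1 * (2 * K)]. *)
Lemma reflected_lip b : W b -> closure U b -> forall e, 0 < e ->
  \forall z \near b, ~ closure U z -> lip_near (fun x => reflected x - G b x) e z.
Proof.
move=> Wb Ab e e0; have [Ub|nUb] := pselect (U b).
  near=> z; case; apply: subset_closure; near: z; exact: open_nbhs_nbhs.
have M0 : 0 < K + t^-1 * (2 * K) + 1.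
  by rewrite ltr_wpDl// addr_ge0// !mulr_ge0// invr_ge0 ltW.
have e'0 : 0 < e / (K + t^-1 * (2 * K) + 1) by rewrite divr_gt0.
have [d d0 hd] := hG Ab e'0.
have [r r0 rP] := (near_ballP _ _).1 (reflected_near Wb Ab nUb d0).
have [r' r'0 rW] := (near_ballP _ _).1 (open_nbhs_nbhs (conj oW Wb)).
near=> z => nAz.
have zr : `|z - b| < Num.min r r'.
  by near: z; apply/near_ballP; exists (Num.min r r'); rewrite ?lt_min ?r0.
have Wz : W z by apply: rW; move: zr; rewrite lt_min => /andP[].
have [s s0 sP] := (near_ballP _ _).1 (near_out Wz nAz).
exists (Num.min s (r - `|z - b|)).
  by rewrite lt_min s0 subr_gt0; move: zr; rewrite lt_min => /andP[].
have loc x : `|x - z| < Num.min s (r - `|z - b|) -> [/\ W x, ~ closure U x,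
    sigma x = rho x + t *: (x - rho x), `|rho x - b| < d & `|sigma x - b| < d].
  rewrite lt_min => /andP[xs xr]; have [Wx nAx] := sP x xs.
  have xb : `|x - b| < r by rewrite -(subrKA z) (le_lt_trans (ler_normD _ _))// -ltrBrDr.
  by have [] := rP x xb nAx.
move=> x y /loc[Wx nAx sx rxd sxd] /loc[Wy nAy sy ryd syd].
rewrite !reflected_remainder//.
have [_ UU /(_ x y Wx nAx Wy nAy)[rl sl] _] := refl.
have [Urx Usx] := UU x Wx nAx; have [Ury Usy] := UU y Wy nAy.
have h1 := hd _ _ (subset_closure Urx) (subset_closure Ury) rxd ryd.
have h2 := hd _ _ (subset_closure Usx) (subset_closure Usy) sxd syd.
have {}h1 : `|h (rho x) - h (rho y) - G b (rho x - rho y)| <=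
    e / (K + t^-1 * (2 * K) + 1) * (K * `|x - y|).
  by rewrite (le_trans h1)// ler_wpM2l// ltW.
have {}h2 : `|h (sigma x) - h (sigma y) - G b (sigma x - sigma y)| <=
    e / (K + t^-1 * (2 * K) + 1) * (K * `|x - y|).
  by rewrite (le_trans h2)// ler_wpM2l// ltW.
rewrite (_ : _ - _ = (h (rho x) - h (rho y) - G b (rho x - rho y)) +
   t^-1 *: ((h (sigma x) - h (sigma y) - G b (sigma x - sigma y)) -
   (h (rho x) - h (rho y) - G b (rho x - rho y)))); last first.
  by rewrite !clinearE; module R.
rewrite (le_trans (ler_normD _ _))// normrZ gtr0_norm ?invr_gt0//.
rewrite (le_trans (lerD h1 (ler_wpM2l _ (le_trans (ler_normB _ _) (lerD h2 h1)))))//.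
  by rewrite invr_ge0 ltW.
rewrite (_ : _ + _ = e * `|x - y| * ((K + t^-1 * (2 * K)) / (K + t^-1 * (2 * K) + 1))).
  by rewrite ler_piMr ?mulr_ge0// ?(ltW e0)// ler_pdivrMr// mul1r lerDl.
by ring.
Unshelve. all: by end_near. Qed.

(** The hypothesis involves reflected points only, so [M] may come from strict differentiability
    inside [U] or from a global Lipschitz constant of [f]. *)
Lemma reflected_lip_near M z : 0 <= M -> W z -> ~ closure U z ->
  (exists2 d, 0 < d & forall x y, `|x - z| < d -> `|y - z| < d ->
     `|h (rho x) - h (rho y)| <= M * `|rho x - rho y| /\
     `|h (sigma x) - h (sigma y)| <= M * `|sigma x - sigma y|) ->
  lip_near reflected (M * (K + t^-1 * (2 * K))) z.
Proof.
move=> M0 Wz nAz [d d0 dh].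
have [s s0 sP] := (near_ballP _ _).1 (near_out Wz nAz).
exists (Num.min d s); first by rewrite lt_min d0.
move=> x y; rewrite !lt_min => /andP[xd /sP[Wx nAx]] /andP[yd /sP[Wy nAy]].
have [_ _ /(_ x y Wx nAx Wy nAy)[rl sl] _] := refl.
have [h1 h2] := dh x y xd yd; rewrite !reflected_out//.
have {}h1 : `|h (rho x) - h (rho y)| <= M * (K * `|x - y|).
  by rewrite (le_trans h1)// ler_wpM2l.
have {}h2 : `|h (sigma x) - h (sigma y)| <= M * (K * `|x - y|).
  by rewrite (le_trans h2)// ler_wpM2l.
rewrite (_ : _ - _ = (h (rho x) - h (rho y)) +
   t^-1 *: ((h (sigma x) - h (sigma y)) - (h (rho x) - h (rho y)))); last by module R.
rewrite (le_trans (ler_normD _ _))// normrZ gtr0_norm ?invr_gt0//.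
rewrite (le_trans (lerD h1 (ler_wpM2l _ (le_trans (ler_normB _ _) (lerD h2 h1)))))//.
  by rewrite invr_ge0 ltW.
by rewrite (_ : _ + _ = M * (K + t^-1 * (2 * K)) * `|x - y|)//; ring.
Qed.

Lemma reflected_loc z : W z -> ~ closure U z ->
  exists2 M, 0 <= M & lip_near reflected M z.
Proof.
move=> Wz nAz; have [_ /(_ z Wz nAz)[Ur Us] lip _] := refl.
have [d1 d10 h1] := hG (subset_closure Ur) ltr01.
have [d2 d20 h2] := hG (subset_closure Us) ltr01.
have [s s0 sP] := (near_ballP _ _).1 (near_out Wz nAz).
have K1 : 0 < K + 1 by rewrite ltr_wpDl.
pose M := Num.max `|G (rho z)| `|G (sigma z)| + 1.
have M0 : 0 <= M by rewrite addr_ge0// le_max normr_ge0.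
exists (M * (K + t^-1 * (2 * K))).
  by rewrite mulr_ge0// addr_ge0// !mulr_ge0// invr_ge0 ltW.
apply: reflected_lip_near => //.
have m0 : 0 < Num.min d1 d2 by rewrite lt_min d10.
exists (Num.min s (Num.min d1 d2 / (K + 1))); first by rewrite lt_min s0 divr_gt0.
have bound (p q : X) (d : R) : `|h p - h q - G (rho z) (p - q)| <= 1 * `|p - q| \/
    `|h p - h q - G (sigma z) (p - q)| <= 1 * `|p - q| ->
    `|h p - h q| <= M * `|p - q|.
  have aux (T : 'L(X; Y)) : `|T| + 1 <= M -> `|h p - h q - T (p - q)| <= 1 * `|p - q| ->
      `|h p - h q| <= M * `|p - q|.
    move=> TM H; rewrite -(subrK (T (p - q)) (h p - h q)) (le_trans (ler_normD _ _))//.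
    rewrite (le_trans (lerD H (le_norm _ _)))// -mulrDl ler_wpM2r//.
    by rewrite addrC.
  by case; apply: aux; rewrite lerD2r le_max lexx ?orbT.
have loc x : `|x - z| < Num.min s (Num.min d1 d2 / (K + 1)) ->
    [/\ U (rho x), U (sigma x), `|rho x - rho z| < d1 & `|sigma x - sigma z| < d2].
  rewrite lt_min => /andP[/sP[Wx nAx] xd].
  have [_ /(_ x Wx nAx)[? ?] _ _] := refl.
  have [rl sl] := lip x z Wx nAx Wz nAz.
  have : K * `|x - z| < Num.min d1 d2.
    rewrite (@le_lt_trans _ _ ((K + 1) * `|x - z|))//.
      by rewrite ler_wpM2r// lerDl.
    by rewrite mulrC -ltr_pdivlMr.
  rewrite lt_min => /andP[k1 k2]; split=> //.
    exact: le_lt_trans rl k1.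
  exact: le_lt_trans sl k2.
move=> x y /loc[Urx Usx rx sx] /loc[Ury Usy ry sy]; split; apply: bound => //.
  by left; apply: h1 => //; exact: subset_closure.
by right; apply: h2 => //; exact: subset_closure.
Qed.

End ReflectionExtension.

End Reflection.

(** * From local to global *)

Section Patching.
Context {R : realType}.
Implicit Types X Y : normedModType R.

(** All pieces equal [f] on [U] and the weights sum to 1, so gluing preserves the values there. *)
Lemma patch_extensions k X Y C (U A : set X) (f : X -> Y) : 0 <= C ->
  ball_approximable k X R^o C -> closed A -> k <> Cfinite 0 ->
  (forall x, exists (W : set X) (g : X -> Y), [/\ open W /\ W x, Ck (Cfinite 1) W g,
     Ck k (W `\` A) g & forall y, W y -> U y -> g y = f y]) ->
  exists g : X -> Y, [/\ forall x, U x -> g x = f x, Ck (Cfinite 1) setT g & Ck k (~` A) g].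
Proof.
move=> C0 LA cA k0 loc.
have data x : exists q : R * (X -> Y), [/\ 0 < q.1,
    Ck (Cfinite 1) [set y | `|y - x| < q.1] q.2,
    Ck k ([set y | `|y - x| < q.1] `\` A) q.2 &
    forall y, `|y - x| < q.1 -> U y -> q.2 y = f y].
  have [W [g [[oW Wx] g1 gk gf]]] := loc x.
  have [r r0 rW] := (open_ballP W).1 oW x Wx; exists (r, g); split=> //=.
  - exact: Ck_sub g1.
  - by apply: Ck_sub gk => y [/rW].
  - by move=> y /rW; exact: gf.
have [q qP] := choice data.
have r0 x : [set: X] x -> 0 < (q x).1 by case: (qP x).
have [phi [L [V [c pou]]]] := partition_of_unity_exists C0 LA r0.
have [phiC phiL phi0 HV [supp sum1]] := pou.
pose g n x := (q (c n x)).2 x.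
have pieces k' (O : set X) : open O ->
    (forall x, Ck k' ([set y | `|y - x| < (q x).1] `&` O) (q x).2) ->
    forall n, Ck k' (V n `&` O) (g n).
  move=> oO qC n; apply: Ck_local => x [Vx Ox].
  have [_ cr cV] := HV n x Vx; have [s s0 sV] := (near_ballP _ _).1 cV.
  pose B := [set y | `|y - x| < s] `&` ([set y | `|y - c n x| < (q (c n x)).1] `&` O).
  have oB : open B.
    by apply: openI; [exact: open_nearby|apply: openI => //; exact: open_nearby].
  exists B; split=> //; first by split=> //=; rewrite subrr normr0.
  apply: (Ck_ext (f := (q (c n x)).2)) => //.
    by move=> y [/sV[_ cy] _]; rewrite /g cy.
  by apply: Ck_sub (qC (c n x)) => y [].
have oA : open (~` A) by exact: closed_openC.
exists (glue phi g); split.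
- move=> x Ux; have [N /nbhs_singleton[phiN s1]] := sum1 x I.
  rewrite (glueE _ phiN) -[f x]scale1r -s1 scaler_suml; apply: eq_bigr => n _.
  have [Vx|/nbhs_singleton ->] := supp n x; last by rewrite !scale0r.
  have [_ cr _] := HV n x Vx; congr (_ *: _).
  by have [_ _ _] := qP (c n x); exact.
- apply: (glue_Ck pou) => //; first by move=> n; exact: Ck_C1 (phiC n).
    exact: openT.
  apply: pieces; first exact: openT.
  by move=> x; rewrite setIT; case: (qP x).
- apply: (glue_Ck pou) => //; apply: pieces => // x.
  by rewrite -setDE; case: (qP x).
Qed.

Lemma lipschitz_onP X Y (A : set X) (f : X -> Y) :
  [lipschitz f x | x in A] <->
  exists2 M, 0 <= M & forall x y, A x -> A y -> `|f x - f y| <= M * `|x - y|.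
Proof.
split=> [[M [_ H]]|[M M0 H]].
  exists (`|M| + 1); first by rewrite addr_ge0.
  move=> x y Ax Ay; have MM : M < `|M| + 1 by rewrite (le_lt_trans (ler_norm M))// ltrDl.
  exact: (H _ MM (x, y) (conj Ax Ay)).
exists M; split; first exact: num_real.
by move=> N MN [x y] [/= Ax Ay]; rewrite (le_trans (H x y Ax Ay))// ler_wpM2r// ltW.
Qed.

Section FromReflection.
Variables (k : smoothness) (X : normedModType R) (Y : completeNormedModType R) (C C' : R).
Variables (U : set X) (f : X -> Y) (G : X -> 'L(X; Y)).
Hypotheses (k0 : k <> Cfinite 0) (C0 : 0 <= C) (C'0 : 0 <= C').
Hypotheses (LA : ball_approximable k X Y C) (LA' : ball_approximable k X R^o C').
Hypotheses (oU : open U) (fG : forall x, U x -> is_diff x f (G x)).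
Hypothesis Gc : forall a, closure U a -> forall e, 0 < e ->
  \forall x \near a, closure U x -> `|G x - G a| <= e.
Hypothesis qc : forall a, closure U a -> ~ U a -> quasiconvex_near U a.

Lemma reflection_extension (W : set X) K t rho sigma : open W ->
  reflection U W K t rho sigma ->
  exists g : X -> Y, [/\ forall x, U x -> g x = f x,
    Ck (Cfinite 1) W g, Ck k (W `\` closure U) g &
    forall M, 0 <= M -> (forall x y, U x -> U y -> `|f x - f y| <= M * `|x - y|) ->
      exists2 N, 0 <= N & forall y, W y -> ~ closure U y -> lip_near g N y].
Proof.
move=> oW refl.
have fs a : closure U a -> strictly_differentiable_on U f (G a) a.
  move=> Aa; apply: (quasiconvex_strict (@subset_closure _ U) fG (Gc Aa)).
  by have [Ua|nUa] := pselect (U a); [exact: quasiconvex_near_open|exact: qc].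
have [h [hf hs]] := strict_closure_extension fs.
have [K0 t0] : 0 <= K /\ 0 < t by case: refl.
have [g [gF g1 gk gl]] := extension_off_closed k0 C0 LA C'0 LA' oW (@closed_closure _ U)
  (fun a _ => Gc (a := a)) (reflected_diff oU oW hs refl) (reflected_lip oU oW hs refl)
  (reflected_loc oW hs refl).
exists g; split=> // [x Ux|M M0 fM].
  by rewrite gF ?reflected_closure ?hf//; exact: subset_closure.
exists ((C + 2) * (M * (K + t^-1 * (2 * K)) + 1)).
  by rewrite mulr_ge0 ?addr_ge0// mulr_ge0// addr_ge0// !mulr_ge0// invr_ge0 ltW.
have [_ UU _ _] := refl.
move=> y Wy nAy; apply: gl => //.
  by rewrite mulr_ge0// addr_ge0// !mulr_ge0// invr_ge0 ltW.
move=> z Wz nAz; apply: (reflected_lip_near oW refl) => //.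
have [d d0 dP] : exists2 d, 0 < d & forall y, `|y - z| < d -> W y /\ ~ closure U y.
  apply/near_ballP; apply: filterI; first exact: open_nbhs_nbhs.
  by apply: open_nbhs_nbhs; split=> //; apply: closed_openC; exact: closed_closure.
exists d => // u v /dP[Wu nAu] /dP[Wv nAv].
have [? ?] := UU u Wu nAu; have [? ?] := UU v Wv nAv.
by rewrite !hf//; split; exact: fM.
Qed.

(** For the Lipschitz clause the derivative is bounded on [U] by the constant of [f], off the
    closure by the uniform local constant, and on the boundary by continuity. The mean value
    inequality on segments of the whole space concludes. *)
Lemma global_reflection_extension K t rho sigma :
  reflection U setT K t rho sigma ->
  exists g : X -> Y, [/\ forall x, U x -> g x = f x,
    Ck (Cfinite 1) setT g, Ck k (~` closure U) g &
    [lipschitz f x | x in U] -> lipschitz g].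
Proof.
move=> refl; have [g [gf g1 gk gl]] := reflection_extension openT refl.
exists g; split=> //; first by rewrite -setTD.
move=> /lipschitz_onP[M M0 fM]; have [N N0 gN] := gl M M0 fM.
have [D [gD /Cn0P Dc]] := g1.
pose B := Num.max M N.
have B0 : 0 <= B by rewrite le_max M0.
have lipD y P : 0 <= P -> lip_near g P y -> `|D y| <= P.
  move=> P0 gP; rewrite -[D y]subr0; apply: (lip_near_diff P0 (gD y I)).
  have [d d0 dP] := gP; exists d => // u v ud vd.
  by rewrite !clinear0 !subr0 dP.
have DU y : U y -> `|D y| <= B.
  move=> Uy; rewrite (@le_trans _ _ M)//; last by rewrite le_max lexx.
  apply: lipD => //; have [d d0 dU] := (open_ballP U).1 oU y Uy.
  by exists d => // u v /dU Uu /dU Uv; rewrite !gf// fM.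
have DB y : `|D y| <= B.
  have [Ay|nAy] := pselect (closure U y); last first.
    by rewrite (@le_trans _ _ N)//; [exact/lipD/gN|rewrite le_max lexx orbT].
  apply/ler_addgt0Pr => e e0.
  have /continuous_atP/(_ e e0) Dy := Dc y I.
  have [x [Ux Dx]] := Ay _ Dy.
  rewrite -(subrK (D x) (D y)) (le_trans (ler_normD _ _))// addrC lerD ?DU//.
  by rewrite distrC ltW.
apply/lipschitz_onP; exists B => // x y _ _.
by apply: segment_mean_value => // s _; eexists; [exact: gD|exact: DB].
Qed.

(** Only boundary points need a reflection. Inside [U] the map [f] serves, its smoothness off the
    closure being vacuous; off the closure the zero map serves, its agreement with [f] being
    vacuous. *)
Lemma local_reflection_extension :
  (forall a, closure U a -> ~ U a -> exists (W : set X) K t rho sigma,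
     [/\ open W, W a & reflection U W K t rho sigma]) ->
  exists g : X -> Y, [/\ forall x, U x -> g x = f x,
    Ck (Cfinite 1) setT g & Ck k (~` closure U) g].
Proof.
move=> refl; have cA : closed (closure U) by exact: closed_closure.
apply: (patch_extensions C'0 LA' cA k0) => x.
have [Ux|nUx] := pselect (U x).
  exists U, f; split=> //.
    by exists G; split=> //; apply/Cn0P => a Ua; apply/continuous_atP => e e0;
      have e2 : 0 < e / 2 by [rewrite divr_gt0];
      near=> y; have : `|G y - G a| <= e / 2 by
        [have : closure U y by [apply: subset_closure; near: y; exact: open_nbhs_nbhs];
         near: y; apply: Gc => //; exact: subset_closure];
      move=> /le_lt_trans; apply; rewrite gtr_pMr// invf_lt1// ltr1n.
  rewrite (_ : U `\` _ = set0); first by apply: Ck_local.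
  by apply/seteqP; split=> y // [/subset_closure].
have [Ax|nAx] := pselect (closure U x).
  have [W [K [t [rho [sigma [oW Wx rW]]]]]] := refl x Ax nUx.
  have [g [gf g1 gk _]] := reflection_extension oW rW.
  by exists W, g; split=> // y _; exact: gf.
exists (~` closure U), (fun=> 0); split.
- by split=> //; exact: closed_openC.
- exact: Ck_cst.
- exact: Ck_cst.
- by move=> y nAy /subset_closure.
Unshelve. all: by end_near. Qed.

End FromReflection.

End Patching.

(** * Images of convex sets *)

Section Gauge.
Context {R : realType} (X : normedModType R) (D : set X) (r B : R).
Hypotheses (r0 : 0 < r) (Dr : forall v, `|v| < r -> D v) (DB : forall v, D v -> `|v| <= B).
Hypothesis Dconv : forall u v s, D u -> D v -> 0 <= s <= 1 -> D (s *: u + (1 - s) *: v).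
Hypothesis oD : open D.

(** The Minkowski functional of [D]. As [D] need not be symmetric, homogeneity holds for positive
    factors only. *)
Definition gauge (v : X) : R := inf [set s : R | 0 < s /\ D (s^-1 *: v)].

Let gauge_mem v s : `|v| / r < s -> 0 < s /\ D (s^-1 *: v).
Proof.
move=> vs; have s0 : 0 < s by rewrite (le_lt_trans _ vs)// divr_ge0// ltW.
split=> //; apply: Dr; rewrite normrZ gtr0_norm ?invr_gt0//.
by rewrite mulrC ltr_pdivrMr// mulrC -ltr_pdivrMr.
Qed.

Let gauge_has_inf v : has_inf [set s : R | 0 < s /\ D (s^-1 *: v)].
Proof.
split; last by exists 0 => s [/ltW].
by exists (`|v| / r + 1); apply: gauge_mem; rewrite ltrDl.
Qed.

Lemma gauge_ge0 v : 0 <= gauge v.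
Proof. by apply: lb_le_inf; [case: (gauge_has_inf v)|move=> s [/ltW]]. Qed.

Lemma gauge_le v s : 0 < s -> D (s^-1 *: v) -> gauge v <= s.
Proof. by move=> s0 Ds; apply: ge_inf; [case: (gauge_has_inf v)|]. Qed.

Lemma gauge_lt v s : gauge v < s -> D (s^-1 *: v).
Proof.
move=> vs; have e0 : 0 < s - gauge v by rewrite subr_gt0.
have [s' [s'0 Ds'] s's] := inf_adherent e0 (gauge_has_inf v).
rewrite -/(gauge v) subrKC in s's.
have s0 : 0 < s by exact: lt_trans s's.
have -> : s^-1 *: v = (s' / s) *: (s'^-1 *: v) + (1 - s' / s) *: 0.
  by rewrite scaler0 addr0 scalerA mulrAC divff ?mul1r// gt_eqF.
apply: Dconv => //; first by apply: Dr; rewrite normr0.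
by rewrite divr_ge0 ?(ltW s'0) ?(ltW s0)//= ler_pdivrMr// mul1r ltW.
Qed.

Lemma gauge_le_norm v : gauge v <= `|v| / r.
Proof.
apply/ler_addgt0Pr => e e0; have [s0 Ds] : 0 < `|v| / r + e /\ D ((`|v| / r + e)^-1 *: v).
  by apply: gauge_mem; rewrite ltrDl.
exact: gauge_le.
Qed.

Lemma norm_le_gauge v : `|v| <= B * gauge v.
Proof.
have D0 : D 0 by apply: Dr; rewrite normr0.
have B0 : 0 <= B by have := DB D0; rewrite normr0.
have B1 : 0 < B + 1 by rewrite ltr_wpDl.
apply/ler_addgt0Pr => e e0.
have e'0 : 0 < e / (B + 1) by rewrite divr_gt0.
have s0 : 0 < gauge v + e / (B + 1) by rewrite ltr_wpDl// gauge_ge0.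
have := DB (@gauge_lt v (gauge v + e / (B + 1)) _); rewrite ltrDl => /(_ e'0).
rewrite normrZ gtr0_norm ?invr_gt0// ler_pdivrMl// => /le_trans; apply.
rewrite mulrC mulrDr lerD2l mulrCA ler_piMr ?(ltW e0)//.
by rewrite ler_pdivrMr// mul1r lerDl.
Qed.

Lemma gaugeD u v : gauge (u + v) <= gauge u + gauge v.
Proof.
apply/ler_addgt0Pr => e e0; have e2 : 0 < e / 2 by rewrite divr_gt0.
have Du : D ((gauge u + e / 2)^-1 *: u) by apply: gauge_lt; rewrite ltrDl.
have Dv : D ((gauge v + e / 2)^-1 *: v) by apply: gauge_lt; rewrite ltrDl.
have a0 : 0 < gauge u + e / 2 by rewrite ltr_wpDl// gauge_ge0.
have b0 : 0 < gauge v + e / 2 by rewrite ltr_wpDl// gauge_ge0.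
rewrite (_ : gauge u + gauge v + e = (gauge u + e / 2) + (gauge v + e / 2)); last by field.
move: (gauge u + e / 2) (gauge v + e / 2) a0 b0 Du Dv => a b a0 b0 Du Dv.
have ab0 : 0 < a + b by exact: addr_gt0.
apply: gauge_le => //.
have -> : (a + b)^-1 *: (u + v) =
    (a / (a + b)) *: (a^-1 *: u) + (1 - a / (a + b)) *: (b^-1 *: v).
  rewrite !scalerA scalerDr; congr (_ *: _ + _ *: _); field; rewrite ?gt_eqF//.
apply: Dconv => //.
by rewrite divr_ge0 ?(ltW a0) ?(ltW ab0)//= ler_pdivrMr// mul1r lerDl ltW.
Qed.

Lemma gauge_lip u v : `|gauge u - gauge v| <= `|u - v| / r.
Proof.
have H a b : gauge a - gauge b <= `|a - b| / r.
  rewrite lerBlDr (le_trans _ (lerD (gauge_le_norm (a - b)) (lexx _)))//.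
  by have := gaugeD (a - b) b; rewrite subrK.
by rewrite ler_norml H andbT lerNl opprB distrC H.
Qed.

Lemma gaugeZ a v : 0 < a -> gauge (a *: v) = a * gauge v.
Proof.
have H c w : 0 < c -> gauge (c *: w) <= c * gauge w.
  move=> c0; apply/ler_addgt0Pr => e e0.
  have ec : 0 < e / c by rewrite divr_gt0.
  have Dw : D ((gauge w + e / c)^-1 *: w) by apply: gauge_lt; rewrite ltrDl.
  have s0 : 0 < gauge w + e / c by rewrite ltr_wpDl// gauge_ge0.
  rewrite (_ : c * gauge w + e = c * (gauge w + e / c)); last by field; rewrite gt_eqF.
  apply: gauge_le; first by rewrite mulr_gt0.
  by rewrite scalerA invfM mulrAC mulVf ?mul1r// gt_eqF.
move=> a0; apply/eqP; rewrite eq_le H//=.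
have := H a^-1 (a *: v); rewrite scalerA mulVf ?gt_eqF// scale1r invr_gt0 => /(_ a0).
by rewrite ler_pdivlMl.
Qed.

Lemma gauge_lt1 v : gauge v < 1 <-> D v.
Proof.
split=> [/gauge_lt|Dv]; first by rewrite invr1 scale1r.
have [d d0 dD] := (open_ballP D).1 oD v Dv.
pose e := d / (`|v| + 1).
have v1 : 0 < `|v| + 1 by rewrite ltr_wpDl.
have e0 : 0 < e by rewrite divr_gt0.
have e1 : 0 < 1 + e by rewrite addr_gt0.
have : gauge v <= (1 + e)^-1.
  apply: gauge_le; rewrite ?invr_gt0// invrK; apply: dD.
  rewrite scalerDl scale1r addrAC subrr add0r normrZ gtr0_norm//.
  by rewrite /e mulrAC ltr_pdivrMr// ltr_pM2l// ltrDl.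
by move=> /le_lt_trans; apply; rewrite invf_lt1// ltrDl.
Qed.

Lemma gauge_closure v : gauge v <= 1 -> closure D v.
Proof.
move=> v1 N /near_ballP[d d0 dN]; pose e := Num.min 1 (d / (`|v| + 1)).
have v1' : 0 < `|v| + 1 by rewrite ltr_wpDl.
have e0 : 0 < e by rewrite lt_min ltr01 divr_gt0.
have ee1 : e <= 1 by rewrite ge_min lexx.
(* For [e = 1] the factor [1 - e] degenerates, but then [d] exceeds [|v|] and the origin itself is
   close enough. *)
have [e1|e1] := eqVneq e 1.
  exists 0; split; first by apply: Dr; rewrite normr0.
  apply: dN; rewrite sub0r normrN.
  have : e <= d / (`|v| + 1) by rewrite ge_min lexx orbT.
  rewrite e1 ler_pdivlMr// mul1r; apply: lt_le_trans; by rewrite ltrDl.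
have a0 : 0 < 1 - e by rewrite subr_gt0 lt_neqAle e1.
exists ((1 - e) *: v); split.
  apply/gauge_lt1; rewrite gaugeZ// (le_lt_trans (ler_piMr (ltW a0) v1))//.
  by rewrite gtrBl.
apply: dN; rewrite scalerBl scale1r addrAC subrr add0r normrN normrZ gtr0_norm//.
rewrite (@le_lt_trans _ _ (d / (`|v| + 1) * `|v|))//.
  by rewrite ler_wpM2r// ge_min lexx orbT.
by rewrite mulrAC ltr_pdivrMr// ltr_pM2l// ltrDl.
Qed.

End Gauge.

Section ConvexImage.
Context {R : realType} (X : normedModType R) (C : set X) (Phi Psi : X -> X).
Variables (c : X) (r B P Q : R).
Hypotheses (P0 : 0 <= P) (Q0 : 0 <= Q) (r0 : 0 < r) (B0 : 0 <= B).
Hypothesis PhiL : forall x y, `|Phi x - Phi y| <= P * `|x - y|.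
Hypothesis PsiL : forall x y, `|Psi x - Psi y| <= Q * `|x - y|.
Hypotheses (PhiK : cancel Phi Psi) (PsiK : cancel Psi Phi).
Hypothesis oC : open C.
Hypothesis Cconv : forall u v s, C u -> C v -> 0 <= s <= 1 -> C (s *: u + (1 - s) *: v).
Hypothesis Cr : forall v, `|v - c| < r -> C v.
Hypothesis CB : forall v, C v -> `|v - c| <= B.

Let U := Phi @` C.
Let D := [set v | C (c + v)].

Let UE z : U z <-> C (Psi z).
Proof.
split=> [[x Cx <-]|Cz]; first by rewrite PhiK.
by exists (Psi z) => //; rewrite PsiK.
Qed.

Lemma convex_image_open : open U.
Proof.
apply/open_ballP => z /UE Cz; have [d d0 dC] := (open_ballP C).1 oC _ Cz.
have Q1 : 0 < Q + 1 by rewrite ltr_wpDl.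
exists (d / (Q + 1)); first by rewrite divr_gt0.
move=> y yz; apply/UE/dC; rewrite (le_lt_trans (PsiL _ _))//.
rewrite (@le_lt_trans _ _ ((Q + 1) * `|y - z|))//.
  by rewrite ler_wpM2r// lerDl.
by rewrite mulrC -ltr_pdivlMr.
Qed.

Lemma convex_image_quasiconvex a : quasiconvex_near U a.
Proof.
exists (P * Q), 1; split; rewrite ?mulr_ge0// => x y /UE Cx /UE Cy _ _.
exists (fun s => Phi (s *: Psi y + (1 - s) *: Psi x)); split.
- by rewrite scale0r add0r subr0 scale1r PsiK.
- by rewrite subrr scale0r addr0 scale1r PsiK.
- by move=> s s01; exists (s *: Psi y + (1 - s) *: Psi x) => //; exact: Cconv.
- move=> s s' _ _; rewrite (le_trans (PhiL _ _))// -!mulrA ler_wpM2l//.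
  rewrite (_ : _ - _ = (s' - s) *: (Psi y - Psi x)); last by module R.
  by rewrite normrZ mulrA mulrC ler_wpM2r// PsiL.
Qed.

Let Dr v : `|v| < r -> D v.
Proof. by move=> vr; apply: Cr; rewrite addrC addKr. Qed.

Let DB v : D v -> `|v| <= B.
Proof. by move=> /CB; rewrite addrC addKr. Qed.

Let Dconv u v s : D u -> D v -> 0 <= s <= 1 -> D (s *: u + (1 - s) *: v).
Proof.
move=> Du Dv s01; rewrite /D /= (_ : c + _ = s *: (c + u) + (1 - s) *: (c + v)).
  exact: Cconv.
by module R.
Qed.

Let oD : open D.
Proof.
apply/open_ballP => v Dv; have [d d0 dC] := (open_ballP C).1 oC _ Dv.
by exists d => // w wv; apply: dC; rewrite opprD addrACA subrr add0r.
Qed.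

Let v z := Psi z - c.
Let q z := gauge D (v z).

Let q_lip z w : `|q z - q w| <= Q / r * `|z - w|.
Proof.
rewrite (le_trans (gauge_lip r0 Dr Dconv _ _))// mulrAC ler_wpM2r ?invr_ge0 ?(ltW r0)//.
by rewrite (_ : v z - v w = Psi z - Psi w) ?PsiL// /v; module R.
Qed.

Let q_lt1 z : q z < 1 <-> U z.
Proof.
by rewrite (gauge_lt1 r0 Dr Dconv oD) UE /D /= /v addrC subrK.
Qed.

Let q_out z : ~ closure U z -> 1 < q z.
Proof.
move=> nUz; rewrite ltNge; apply/negP => qz; apply: nUz => N /near_ballP[d d0 dN].
have P1 : 0 < P + 1 by rewrite ltr_wpDl.
have dP : 0 < d / (P + 1) by rewrite divr_gt0.
have [u [Du /ballP uv]] := gauge_closure r0 Dr Dconv oD qz (nbhsx_ballx (v z) _ dP).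
exists (Phi (c + u)); split; first by exists (c + u).
apply: dN; rewrite -[z in _ - z]PsiK (le_lt_trans (PhiL _ _))//.
rewrite (_ : c + u - Psi z = u - v z); last by rewrite /v; module R.
rewrite (@le_lt_trans _ _ ((P + 1) * `|u - v z|))//.
  by rewrite ler_wpM2r// lerDl.
by rewrite mulrC -ltr_pdivlMr.
Qed.

Let q_closure z : closure U z -> q z <= 1.
Proof.
move=> Uz; apply/ler_addgt0Pr => e e0.
have Q1 : 0 < Q / r + 1 by rewrite ltr_wpDl// divr_ge0// ltW.
have e1 : 0 < e / (Q / r + 1) by rewrite divr_gt0.
have [y [/q_lt1 y1 /ballP yz]] := Uz _ (nbhsx_ballx z _ e1).
have := q_lip y z; rewrite ler_norml => /andP[+ _].
have : Q / r * `|y - z| <= e.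
  rewrite (@le_trans _ _ ((Q / r + 1) * `|y - z|))//.
    by rewrite ler_wpM2r// lerDl.
  by rewrite mulrC -ler_pdivlMr// ltW.
by lra.
Qed.

(* In the chart, a point with gauge [q > 1] is sent radially to the point of gauge [1 / q];
   truncating [q] at [2] keeps all maps globally Lipschitz. *)
Let n z := (q z)^-1 *: v z.
Let m z := Num.min (q z) 2.
Let trunc z := Phi (c + m z *: n z).
Let rho z := Phi (c + (m z)^-1 *: n z).
Let t := r / (4 * (P * Q * B) + r).
Let sigma z := rho z + t *: (trunc z - rho z).

(** Lipschitz constants on [q >= 1]: [K0] for the normalised vector [n], and [K1] for [a *: n] with
    [|a| <= 2] and increments of [a] bounded as those of [q]. *)
Let K0 := Q + B * (Q / r).
Let K1 := 2 * K0 + B * (Q / r).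

Let Qr0 : 0 <= Q / r. Proof. by rewrite divr_ge0// ltW. Qed.
Let K00 : 0 <= K0. Proof. by rewrite addr_ge0// mulr_ge0. Qed.
Let K10 : 0 <= K1. Proof. by rewrite addr_ge0// mulr_ge0. Qed.

Let n_le z : 1 <= q z -> `|n z| <= B.
Proof.
move=> qz; have q0 : 0 < q z by rewrite (lt_le_trans _ qz).
rewrite /n normrZ gtr0_norm ?invr_gt0// ler_pdivrMl// mulrC.
exact: (norm_le_gauge r0 Dr DB Dconv).
Qed.

Let n_lip z w : 1 <= q z -> 1 <= q w -> `|n z - n w| <= K0 * `|z - w|.
Proof.
move=> qz qw; have z0 : 0 < q z by rewrite (lt_le_trans _ qz).
have w0 : 0 < q w by rewrite (lt_le_trans _ qw).
have -> : n z - n w = (q z)^-1 *: (v z - v w) + ((q z)^-1 * (q w - q z)) *: n w.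
  rewrite /n scalerA; have -> : (q z)^-1 * (q w - q z) * (q w)^-1 = (q z)^-1 - (q w)^-1.
    by field; rewrite !gt_eqF.
  by module R.
rewrite (le_trans (ler_normD _ _))// [`|_ *: (v z - v w)|]normrZ [`|_ *: n w|]normrZ normrM.
rewrite gtr0_norm ?invr_gt0//.
have q1 : (q z)^-1 <= 1 by rewrite invf_le1.
have i0 : 0 <= (q z)^-1 by rewrite invr_ge0 ltW.
rewrite /K0 mulrDl lerD//.
  rewrite (_ : v z - v w = Psi z - Psi w); last by rewrite /v; module R.
  by rewrite (le_trans (ler_piMl _ q1)).
rewrite [leRHS](_ : _ = Q / r * `|z - w| * B); last by ring.
rewrite ler_pM ?mulr_ge0 ?n_le//.
by rewrite (le_trans (ler_piMl _ q1))// distrC q_lip.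
Qed.

Let m_itv z : 1 <= q z -> 1 <= m z <= 2.
Proof. by move=> qz; rewrite /m le_min qz ler1n ge_min lexx orbT. Qed.

Let m_lip z w : `|m z - m w| <= Q / r * `|z - w|.
Proof.
rewrite (le_trans _ (q_lip z w))// /m.
have h := ler_norm (q z - q w); have h' := ler_norm (q w - q z); rewrite distrC in h'.
rewrite ler_norml; move: (`|q z - q w|) h h' => d h h'.
by rewrite !minEle; case: (leP (q z) 2) => ?; case: (leP (q w) 2) => ?; apply/andP; split; lra.
Qed.

Let scaled_lip (a : X -> R) z w : 1 <= q z -> 1 <= q w -> `|a z| <= 2 ->
  `|a z - a w| <= Q / r * `|z - w| ->
  `|Phi (c + a z *: n z) - Phi (c + a w *: n w)| <= P * K1 * `|z - w|.
Proof.
move=> qz qw az azw; rewrite (le_trans (PhiL _ _))// -mulrA ler_wpM2l//.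
rewrite (_ : _ - _ = a z *: (n z - n w) + (a z - a w) *: n w); last by module R.
rewrite (le_trans (ler_normD _ _))// [`|_ *: (n z - n w)|]normrZ [`|_ *: n w|]normrZ.
rewrite [leRHS](_ : _ = 2 * (K0 * `|z - w|) + Q / r * `|z - w| * B); last by rewrite /K1; ring.
by rewrite lerD// ler_pM ?n_lip ?n_le.
Qed.

Let trunc_lip z w : 1 <= q z -> 1 <= q w -> `|trunc z - trunc w| <= P * K1 * `|z - w|.
Proof.
move=> qz qw; apply: (scaled_lip (a := m)) => //.
by have /andP[m1 m2] := m_itv qz; rewrite ger0_norm// (le_trans ler01).
Qed.

Let rho_lip z w : 1 <= q z -> 1 <= q w -> `|rho z - rho w| <= P * K1 * `|z - w|.
Proof.
move=> qz qw; have /andP[z1 _] := m_itv qz; have /andP[w1 _] := m_itv qw.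
have z0 : 0 < m z by rewrite (lt_le_trans _ z1).
have w0 : 0 < m w by rewrite (lt_le_trans _ w1).
apply: (scaled_lip (a := fun x => (m x)^-1)) => //.
  by rewrite ger0_norm ?invr_ge0 ?(ltW z0)// (@le_trans _ _ 1)// ?invf_le1// ler1n.
rewrite (_ : _ - _ = ((m z)^-1 * (m w)^-1) * (m w - m z)); last by field; rewrite !gt_eqF.
rewrite normrM ger0_norm; last by rewrite mulr_ge0 ?invr_ge0 ?(ltW z0) ?(ltW w0).
rewrite (le_trans (ler_piMl _ _))//; last by rewrite distrC m_lip.
by rewrite mulr_ile1 ?invr_ge0 ?(ltW z0) ?(ltW w0) ?invf_le1.
Qed.

Let t0 : 0 < t.
Proof. by rewrite divr_gt0// ltr_wpDl// !mulr_ge0. Qed.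

Let t1 : t <= 1.
Proof. by rewrite ler_pdivrMr ?ltr_wpDl ?mulr_ge0// mul1r lerDr !mulr_ge0. Qed.

Let gauge_rho z : 1 <= q z -> gauge D ((m z)^-1 *: n z) = (m z)^-1.
Proof.
move=> qz; have /andP[z1 _] := m_itv qz; have z0 : 0 < m z by rewrite (lt_le_trans _ z1).
have q0 : 0 < q z by rewrite (lt_le_trans _ qz).
by rewrite /n scalerA (gaugeZ r0 Dr Dconv) ?divr_gt0 ?invr_gt0// -/(q z) -mulrA mulVf ?mulr1// gt_eqF.
Qed.

Let U_rho z : 1 < q z -> U (rho z).
Proof.
move=> qz; exists (c + (m z)^-1 *: n z) => //.
apply/(gauge_lt1 r0 Dr Dconv oD); rewrite gauge_rho ?(ltW qz)//.
have m1 : 1 < m z by rewrite lt_min qz ltr1n.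
by rewrite invf_lt1// (lt_trans _ m1).
Qed.

(** A step of fraction [t] from [rho z] raises the gauge by at most (m - 1/m)/4, by the choice of
    [t]. As m <= 2, m - 1/m = (1 - 1/m)(m + 1) is at most 3(1 - 1/m), so from 1/m the gauge stays
    below 1. *)
Let U_sigma z : 1 < q z -> U (sigma z).
Proof.
move=> qz; apply/q_lt1.
have m1 : 1 < m z by rewrite lt_min qz ltr1n.
have m0 : 0 < m z by rewrite (lt_trans _ m1).
have /andP[_ m2] := m_itv (ltW qz).
have qrho : q (rho z) = (m z)^-1 by rewrite /q /v /rho PhiK addrAC subrr add0r gauge_rho// ltW.
have srho : `|sigma z - rho z| <= t * (P * ((m z - (m z)^-1) * B)).
  rewrite /sigma addrC addKr normrZ (gtr0_norm t0) ler_wpM2l ?(ltW t0)//.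
  rewrite (le_trans (PhiL _ _))// ler_wpM2l//.
  rewrite (_ : _ - _ = (m z - (m z)^-1) *: n z); last by module R.
  rewrite normrZ ger0_norm; last first.
    by rewrite subr_ge0 (@le_trans _ _ 1)// ?ltW// invf_lt1.
  rewrite ler_wpM2l ?n_le ?(ltW qz)//.
  by rewrite subr_ge0 (@le_trans _ _ 1)// ?ltW// invf_lt1.
have := q_lip (sigma z) (rho z); rewrite qrho ler_norml => /andP[_].
pose kappa := P * Q * B / (4 * (P * Q * B) + r).
have PQB : 0 <= P * Q * B by rewrite !mulr_ge0.
have den : 0 < 4 * (P * Q * B) + r by rewrite ltr_wpDl// mulr_ge0.
have kappa4 : kappa <= 4^-1.
  by rewrite /kappa ler_pdivrMr// mulrDr mulKf// lerDl mulr_ge0// ltW.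
have : Q / r * `|sigma z - rho z| <= kappa * (m z - (m z)^-1).
  rewrite (le_trans (ler_wpM2l _ srho))//.
  by rewrite /t /kappa le_eqVlt; apply/orP; left; apply/eqP; field; rewrite !gt_eqF.
have i0 : 0 < (m z)^-1 by rewrite invr_gt0.
have i1 : (m z)^-1 < 1 by rewrite invf_lt1.
have mi : m z - (m z)^-1 = (1 - (m z)^-1) * (m z + 1) by field; rewrite gt_eqF.
have : kappa * (m z - (m z)^-1) <= 4^-1 * (m z - (m z)^-1).
  by rewrite ler_wpM2r// mi mulr_ge0//; lra.
have : (1 - (m z)^-1) * (m z + 1) <= (1 - (m z)^-1) * 3 by rewrite ler_wpM2l//; lra.
rewrite -mi; lra.
Qed.

Lemma convex_image_reflection :
  exists K t rho sigma, reflection U setT K t rho sigma.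
Proof.
exists (3 * (P * K1)), t, rho, sigma; split.
- by rewrite !mulr_ge0.
- by move=> z _ /q_out qz; split; [exact: U_rho|exact: U_sigma].
- move=> z w _ /q_out/ltW qz _ /q_out/ltW qw.
  have H := rho_lip qz qw; have H' := trunc_lip qz qw.
  have PK : 0 <= P * K1 * `|z - w| by rewrite !mulr_ge0.
  split; first by rewrite (le_trans H)// ler_wpM2r// ler_peMl ?mulr_ge0// ler1n.
  rewrite (_ : _ - _ = (1 - t) *: (rho z - rho w) + t *: (trunc z - trunc w)); last first.
    by rewrite /sigma; module R.
  rewrite (le_trans (ler_normD _ _))// [`|(1 - t) *: _|]normrZ [`|t *: _|]normrZ.
  rewrite (gtr0_norm t0) (@ger0_norm _ (1 - t)) ?subr_ge0 ?t1//.
  have := ler_wpM2l (ltW t0) H'; have : (1 - t) * `|rho z - rho w| <= (1 - t) * (P * K1 * `|z - w|).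
    by rewrite ler_wpM2l// subr_ge0 t1.
  lra.
- move=> b _ Ub nUb.
  have qb : q b = 1.
    by apply/eqP; rewrite eq_le q_closure//= leNgt; apply/negP => /q_lt1.
  have rhob : rho b = b.
    by rewrite /rho /m qb min_l ?ler1n// invr1 scale1r /n qb invr1 scale1r /v subrKC PsiK.
  have Q1 : 0 < Q / r + 1 by rewrite ltr_wpDl.
  near=> z => /q_out qz; split.
    (* Close to [b], where [q] is 1, the truncation at 2 is inactive and [trunc z] is [z]; the
       identity for [sigma] is asked only there. *)
    rewrite /sigma; congr (_ + _ *: (_ - _)).
    have q2 : q z <= 2.
      have := q_lip z b; rewrite qb ler_norml => /andP[_].
      have : (Q / r + 1) * `|z - b| < 1.
        rewrite mulrC -ltr_pdivlMr//; near: z; apply/near_ballP.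
        by exists (1 / (Q / r + 1)) => //; rewrite divr_gt0.
      have := normr_ge0 (z - b); lra.
    by rewrite /trunc /m min_l// /n scalerA divff ?scale1r ?gt_eqF ?(lt_trans _ qz)// /v subrKC PsiK.
  rewrite -{1}rhob (le_trans (rho_lip (ltW qz) _))// ?qb//.
  by rewrite ler_wpM2r// ler_peMl ?mulr_ge0// ler1n.
Unshelve. all: by end_near. Qed.

End ConvexImage.

(** * Lipschitz charts *)

Section LipschitzChart.
Context {R : realType} (X E : normedModType R) (U V : set X).
Variables (Phi : X -> E * R^o) (Psi : E * R^o -> X) (a : X) (P Q : R).
Hypotheses (P0 : 0 <= P) (Q0 : 0 <= Q).
Hypothesis PhiL : forall x y, V x -> V y -> `|Phi x - Phi y| <= P * `|x - y|.
Hypothesis PsiL : forall p q, (Phi @` V) p -> (Phi @` V) q ->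
  `|Psi p - Psi q| <= Q * `|p - q|.
Hypothesis PhiK : forall x, V x -> Psi (Phi x) = x.
Hypotheses (oU : open U) (oV : open V) (Va : V a).
Hypotheses (Ua : closure U a) (nUa : ~ U a).
Hypothesis PhiV : Phi @` V = ball (0 : E) 1 `*` `](-1), 1[%classic.
Hypothesis PhiU : Phi @` (U `&` V) = ball (0 : E) 1 `*` `]0, 1[%classic.
Hypothesis PhiB : Phi @` (boundary U `&` V) = ball (0 : E) 1 `*` [set 0].

Let boundaryE x : boundary U x <-> closure U x /\ ~ U x.
Proof. by rewrite /boundary ((interior_id U).1 oU). Qed.

Let chart_inj x y : V x -> V y -> Phi x = Phi y -> x = y.
Proof. by move=> Vx Vy xy; rewrite -(PhiK Vx) -(PhiK Vy) xy. Qed.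

Let chart_image x : V x -> ball (0 : E) 1 (Phi x).1 /\ -1 < (Phi x).2 < 1.
Proof.
move=> Vx; have : (Phi @` V) (Phi x) by exists x.
by rewrite PhiV => -[? /=]; rewrite in_itv.
Qed.

Let chart_U x : V x -> U x <-> 0 < (Phi x).2.
Proof.
move=> Vx; split=> [Ux|x0].
  have : (Phi @` (U `&` V)) (Phi x) by exists x.
  by rewrite PhiU => -[_ /=]; rewrite in_itv => /andP[].
have [b1 /andP[_ x1]] := chart_image Vx.
have : (ball (0 : E) 1 `*` `]0, 1[%classic) (Phi x) by split=> //=; rewrite in_itv /= x0.
by rewrite -PhiU => -[y [Uy Vy]] /(chart_inj Vy Vx) <-.
Qed.

Let chart_boundary x : V x -> (closure U x /\ ~ U x) <-> (Phi x).2 = 0.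
Proof.
move=> Vx; split=> [/boundaryE Bx|x0].
  have : (Phi @` (boundary U `&` V)) (Phi x) by exists x.
  by rewrite PhiB => -[].
have [b1 _] := chart_image Vx.
have : (ball (0 : E) 1 `*` [set 0]) (Phi x) by split.
by rewrite -PhiB => -[y [By Vy]] /(chart_inj Vy Vx) <-; apply/boundaryE.
Qed.

Let chart_out x : V x -> ~ closure U x -> (Phi x).2 < 0.
Proof.
move=> Vx nAx; rewrite ltNge le_eqVlt; apply/negP => /orP[/eqP x0|/(chart_U Vx) Ux].
  by have [] : closure U x /\ ~ U x by apply/chart_boundary.
by apply: nAx; exact: subset_closure.
Qed.

Let a0 : (Phi a).2 = 0. Proof. exact/chart_boundary. Qed.

Let norm_snd (p : E * R^o) : `|p.2| <= `|p|.
Proof. by rewrite prod_normE le_max lexx orbT. Qed.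

Let norm_fst (p : E * R^o) : `|p.1| <= `|p|.
Proof. by rewrite prod_normE le_max lexx. Qed.

Let eta_ex : exists2 eta, 0 < eta & forall p : E * R^o, `|p - Phi a| < eta -> (Phi @` V) p.
Proof.
have [/ballP a1 _] := chart_image Va; rewrite subr0 in a1.
(* The last coordinate of [Phi a] is 0, so only the base coordinate limits the radius. *)
exists (1 - `|(Phi a).1|); first by rewrite subr_gt0.
move=> p pa; rewrite PhiV; split.
  apply/ballP; rewrite subr0 -(subrK (Phi a).1 p.1) (le_lt_trans (ler_normD _ _))//.
  by rewrite -ltrBrDr (le_lt_trans (norm_fst (p - Phi a))).
rewrite /= in_itv /= -ltr_norml; have := norm_snd (p - Phi a).
rewrite /= a0 subr0 => /le_lt_trans; apply; rewrite (lt_le_trans pa)// gerBl//.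
Qed.

Let chart_inverse p : (Phi @` V) p -> V (Psi p) /\ Phi (Psi p) = p.
Proof. by move=> [x Vx <-]; rewrite PhiK. Qed.

(** Segments between chart points near [Phi a] stay in a ball inside the image and keep a positive
    last coordinate. Their preimages are the required curves in [U]. *)
Lemma chart_quasiconvex : quasiconvex_near U a.
Proof.
have [eta eta0 etaP] := eta_ex.
have [r r0 rV] := (open_ballP V).1 oV a Va.
have P1 : 0 < P + 1 by rewrite ltr_wpDl.
exists (Q * P), (Num.min r (eta / (P + 1))); split; rewrite ?mulr_ge0//.
  by rewrite lt_min r0 divr_gt0.
move=> x y Ux Uy; rewrite !lt_min => /andP[xr xe] /andP[yr ye].
have Vx := rV _ xr; have Vy := rV _ yr.
have near w : V w -> `|w - a| < eta / (P + 1) -> `|Phi w - Phi a| < eta.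
  move=> Vw we; rewrite (le_lt_trans (PhiL Vw Va))//.
  rewrite (@le_lt_trans _ _ ((P + 1) * `|w - a|))//; first by rewrite ler_wpM2r// lerDl.
  by rewrite mulrC -ltr_pdivlMr.
have nx := near x Vx xe; have ny := near y Vy ye.
pose seg s := Phi x + s *: (Phi y - Phi x).
have segQ s : 0 <= s <= 1 -> (Phi @` V) (seg s).
  move=> /andP[s0 s1]; apply: etaP.
  rewrite (_ : _ - _ = (1 - s) *: (Phi x - Phi a) + s *: (Phi y - Phi a)); last first.
    by rewrite /seg; module R.
  rewrite (le_lt_trans (ler_normD _ _))// !normrZ !ger0_norm ?subr_ge0//.
  have : (1 - s) * `|Phi x - Phi a| <= (1 - s) * Num.max `|Phi x - Phi a| `|Phi y - Phi a|.
    by rewrite ler_wpM2l ?subr_ge0// le_max lexx.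
  have : s * `|Phi y - Phi a| <= s * Num.max `|Phi x - Phi a| `|Phi y - Phi a|.
    by rewrite ler_wpM2l// le_max lexx orbT.
  have : Num.max `|Phi x - Phi a| `|Phi y - Phi a| < eta by rewrite gt_max nx.
  lra.
exists (Psi \o seg); split=> /=.
- by rewrite /seg scale0r addr0 PhiK.
- by rewrite /seg scale1r subrKC PhiK.
- move=> s s01; have [Vs sE] := chart_inverse (segQ s s01); apply/(chart_U Vs); rewrite sE.
  have x0 := (chart_U Vx).1 Ux; have y0 := (chart_U Vy).1 Uy.
  rewrite /seg /= /GRing.scale /=; case/andP: s01 => s0 s1.
  have [s12|s12] := leP s 2^-1.
    have : 2^-1 * (Phi x).2 <= (1 - s) * (Phi x).2 by rewrite ler_wpM2r ?(ltW x0)//; lra.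
    have : 0 <= s * (Phi y).2 by rewrite mulr_ge0// ltW.
    lra.
  have : 2^-1 * (Phi y).2 <= s * (Phi y).2 by rewrite ler_wpM2r ?(ltW y0)//; lra.
  have : 0 <= (1 - s) * (Phi x).2 by rewrite mulr_ge0 ?subr_ge0// ltW.
  lra.
- move=> s s' s01 s'01; rewrite (le_trans (PsiL (segQ _ s'01) (segQ _ s01)))//.
  rewrite -!mulrA ler_wpM2l// (_ : seg s' - seg s = (s' - s) *: (Phi y - Phi x)); last first.
    by rewrite /seg; module R.
  by rewrite normrZ mulrA mulrC ler_wpM2r// PhiL.
Qed.

Let flip (p : E * R^o) : E * R^o := (p.1, - p.2).

Let flip_norm p : `|flip p| = `|p|.
Proof. by rewrite !prod_normE /= normrN. Qed.

Let flipB p q : flip p - flip q = flip (p - q).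
Proof. by rewrite /flip; congr (_, _) => /=; rewrite opprD. Qed.

Let flip_chart p : (Phi @` V) p -> (Phi @` V) (flip p).
Proof.
rewrite PhiV => -[p1 /=]; rewrite in_itv /= => /andP[p2 p3]; split=> //=.
by rewrite in_itv /= ltrN2 p3 ltrNl.
Qed.

Let rho z := Psi (flip (Phi z)).
(** If [rho z] has height h in the chart, then |z - rho z| <= 2 Q h. A step of fraction [t] changes
    the height by at most 2 P Q t h <= h / 2, so [sigma z] keeps positive height. *)
Let t : R := (4 * (P * Q + 1))^-1.
Let sigma z := rho z + t *: (z - rho z).

Let PQ0 : 0 <= P * Q. Proof. exact: mulr_ge0. Qed.
Let t0 : 0 < t. Proof. by rewrite invr_gt0 mulr_gt0// ltr_wpDl. Qed.
Let t1 : t <= 1.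
Proof. by rewrite invf_le1 ?mulr_gt0 ?ltr_wpDl//; have := PQ0; lra. Qed.

Let chart_rho z : V z -> V (rho z) /\ Phi (rho z) = flip (Phi z).
Proof. by move=> Vz; apply: chart_inverse; apply: flip_chart; exists z. Qed.

Let rho_lip z w : V z -> V w -> `|rho z - rho w| <= Q * P * `|z - w|.
Proof.
move=> Vz Vw; have chz : (Phi @` V) (flip (Phi z)) by apply: flip_chart; exists z.
have chw : (Phi @` V) (flip (Phi w)) by apply: flip_chart; exists w.
by rewrite (le_trans (PsiL chz chw))// flipB flip_norm -mulrA ler_wpM2l// PhiL.
Qed.

Let rho_boundary b : V b -> closure U b -> ~ U b -> rho b = b.
Proof.
move=> Vb Ab nUb; rewrite /rho (_ : flip (Phi b) = Phi b) ?PhiK//.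
have b0 : (Phi b).2 = 0 by exact/chart_boundary.
by rewrite /flip b0 oppr0 -b0; case: (Phi b).
Qed.

Lemma chart_reflection : exists (W : set X) K t rho sigma,
  [/\ open W, W a & reflection U W K t rho sigma].
Proof.
have [r r0 rV] := (open_ballP V).1 oV a Va.
have K0 : 0 <= Q * P by rewrite mulr_ge0.
(* The distance of [sigma z] from [a] is at most [(2 Q P + 1) |z - a|]; this radius keeps it in [V],
   where the chart estimates hold. *)
pose rr := r / (2 * (Q * P) + 2).
have d0 : 0 < 2 * (Q * P) + 2 by rewrite ltr_wpDl// mulr_ge0.
have WV z : `|z - a| < rr -> V z.
  move=> zr; apply: rV; rewrite (lt_le_trans zr)// ler_pdivrMr// ler_peMr ?(ltW r0)//.
  by have := K0; lra.
exists [set z | `|z - a| < rr], (2 * (Q * P) + 1), t, rho, sigma; split.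
- exact: open_nearby.
- by rewrite /= subrr normr0 divr_gt0.
split.
- by split=> //; rewrite addr_ge0// mulr_ge0.
- move=> z Wz nAz; have Vz := WV z Wz; have z0 := chart_out Vz nAz.
  have [Vr rE] := chart_rho Vz.
  have Ur : U (rho z) by apply/(chart_U Vr); rewrite rE /= oppr_gt0.
  split=> //.
  have ra : `|rho z - a| <= Q * P * `|z - a|.
    by rewrite -{1}(rho_boundary Va Ua nUa) rho_lip.
  have zrz : `|z - rho z| <= Q * (2 * - (Phi z).2).
    have chz : (Phi @` V) (Phi z) by exists z.
    rewrite -{1}(PhiK Vz) (le_trans (PsiL chz (flip_chart chz)))// ler_wpM2l//.
    rewrite prod_normE /= subrr normr0 ge_max opprK; apply/andP; split; first lra.
    by rewrite ler0_norm; lra.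
  have Vs : V (sigma z).
    apply: rV; rewrite /sigma addrAC (le_lt_trans (ler_normD _ _))//.
    rewrite normrZ (gtr0_norm t0).
    have : t * `|z - rho z| <= `|z - rho z| by rewrite ler_piMl ?t1.
    have : `|z - rho z| <= `|z - a| + `|rho z - a|.
      by rewrite -(subrKA a) (le_trans (ler_normD _ _))// [`|a - _|]distrC.
    have : (2 * (Q * P) + 2) * `|z - a| < r by rewrite mulrC -ltr_pdivlMr.
    have := normr_ge0 (z - a); lra.
  apply/(chart_U Vs).
  have := le_trans (norm_snd _) (PhiL Vs Vr); rewrite /= rE /= opprK.
  rewrite /sigma addrAC subrr add0r normrZ (gtr0_norm t0) => H.
  have {}H : `|(Phi (sigma z)).2 + (Phi z).2| <= 2^-1 * - (Phi z).2.
    rewrite (le_trans H)//.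
    rewrite (@le_trans _ _ (P * (t * (Q * (2 * - (Phi z).2)))))//.
      by rewrite ler_wpM2l// ler_wpM2l// ltW.
    rewrite (_ : P * _ = 2^-1 * - (Phi z).2 * ((P * Q) / (P * Q + 1))); last first.
      by rewrite /t; field; rewrite !gt_eqF// ltr_wpDl.
    rewrite ler_piMr//; last by rewrite ler_pdivrMr ?ltr_wpDl// mul1r lerDl.
    by rewrite mulr_ge0//; lra.
  move: H; rewrite ler_norml => /andP[+ _]; lra.
- move=> z w Wz nAz Ww nAw; have H := rho_lip (WV z Wz) (WV w Ww).
  have zw := normr_ge0 (z - w).
  split; first by rewrite (le_trans H)// ler_wpM2r//; lra.
  rewrite (_ : _ - _ = (1 - t) *: (rho z - rho w) + t *: (z - w)); last first.
    by rewrite /sigma; module R.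
  rewrite (le_trans (ler_normD _ _))// [`|(1 - t) *: _|]normrZ [`|t *: _|]normrZ.
  rewrite (gtr0_norm t0) (@ger0_norm _ (1 - t)) ?subr_ge0 ?t1//.
  have : t * `|z - w| <= `|z - w| by rewrite ler_piMl ?t1.
  have : (1 - t) * `|rho z - rho w| <= `|rho z - rho w| by rewrite ler_piMl// gerBl ltW.
  have : 0 <= Q * P * `|z - w| by rewrite mulr_ge0.
  by rewrite mulrDl mul1r -mulrA; lra.
- move=> b Wb Ab nUb; have Vb := WV b Wb.
  have oW : open [set z : X | `|z - a| < rr] by exact: open_nearby.
  near=> z => nAz; split=> //.
  have Vz : V z by apply: WV; near: z; exact: open_nbhs_nbhs.
  rewrite -{1}(rho_boundary Vb Ab nUb) (le_trans (rho_lip Vz Vb))// ler_wpM2r//.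
  by have := K0; lra.
Unshelve. all: by end_near. Qed.

End LipschitzChart.

(** * Extension *)

Section Domains.
Context {R : realType} (X : normedModType R).

Lemma bilipschitz_bounds (V W : normedModType R) (A : set V) (Phi : V -> W) :
  bilipschitz A Phi -> exists (Psi : W -> V) (P Q : R),
  [/\ 0 <= P /\ 0 <= Q, forall x y, A x -> A y -> `|Phi x - Phi y| <= P * `|x - y|,
      forall p q, (Phi @` A) p -> (Phi @` A) q -> `|Psi p - Psi q| <= Q * `|p - q| &
      forall x, A x -> Psi (Phi x) = x].
Proof.
move=> [/lipschitz_onP[P P0 PhiL] [Psi PhiK /lipschitz_onP[Q Q0 PsiL]]].
by exists Psi, P, Q; split=> // x Ax; apply: PhiK; rewrite inE.
Qed.

Lemma bilipschitz_convex_image_reflection (U : set X) : bilipschitz_convex_image U ->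
  U !=set0 ->
  [/\ open U, forall a, quasiconvex_near U a &
      exists K t rho sigma, reflection U setT K t rho sigma].
Proof.
move=> [Phi [C [[bil surj] oC cvxC bC ->]]] [_ [c Cc _]].
have [Psi [P [Q [[P0 Q0] PhiL PsiL PhiK]]]] := bilipschitz_bounds bil.
have {}PhiL x y : `|Phi x - Phi y| <= P * `|x - y| by exact: PhiL.
have {}PsiL x y : `|Psi x - Psi y| <= Q * `|x - y| by apply: PsiL; rewrite surj.
have {}PhiK : cancel Phi Psi by move=> x; exact: PhiK.
have PsiK : cancel Psi Phi.
  move=> y; have [x _ <-] : (Phi @` setT) y by rewrite surj.
  by rewrite PhiK.
have Cconv u v s : C u -> C v -> 0 <= s <= 1 -> C (s *: u + (1 - s) *: v).
  move=> Cu Cv /andP[s0 s1].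
  by have := cvxC u v (Itv01 s0 s1) (mem_set Cu) (mem_set Cv) => /set_mem.
have [r r0 Cr] := (open_ballP C).1 oC c Cc.
have [M [_ CM]] := bC.
have CB v : C v -> `|v - c| <= `|M| + 1 + `|c|.
  move=> Cv; rewrite (le_trans (ler_normB _ _))// lerD2r.
  by apply: CM => //; rewrite (le_lt_trans (ler_norm M))// ltrDl.
have B0 : 0 <= `|M| + 1 + `|c| by rewrite !addr_ge0.
split.
- exact: convex_image_open Q0 PsiL PhiK PsiK oC.
- exact: convex_image_quasiconvex P0 Q0 PhiL PsiL PhiK PsiK Cconv.
- exact: convex_image_reflection P0 Q0 r0 B0 PhiL PsiL PhiK PsiK oC Cconv Cr CB.
Qed.

Lemma lipschitz_domain_reflection (U : set X) : lipschitz_domain U ->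
  forall a, closure U a -> ~ U a -> quasiconvex_near U a /\
    exists (W : set X) K t rho sigma, [/\ open W, W a & reflection U W K t rho sigma].
Proof.
move=> [oU _ chart] a Ua nUa.
have [|V [E [Phi [[oV Va] bil PhiV PhiU PhiB]]]] := chart a.
  by split=> //; rewrite ((interior_id U).1 oU).
have [Psi [P [Q [[P0 Q0] PhiL PsiL PhiK]]]] := bilipschitz_bounds bil.
split.
  exact: chart_quasiconvex P0 Q0 PhiL PsiL PhiK oU oV Va Ua nUa PhiV PhiU PhiB.
exact: chart_reflection P0 Q0 PhiL PsiL PhiK oU oV Va Ua nUa PhiV PhiU PhiB.
Qed.

End Domains.

Theorem corollary51 (R : realType) (X : normedModType R)
    (Y : completeNormedModType R) (k : smoothness) (k_pos : k <> Cfinite 0%N)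
    (XY_LA : property_LA k X Y) (U : set X)
    (U_type : bilipschitz_convex_image U \/ lipschitz_domain U)
    (f : X -> Y) (f_C1 : Ck (Cfinite 1%N) U f)
    (G : X -> 'L(X; Y)) (G_cont : {within closure U, continuous G})
    (G_Df : forall x, U x -> 'd f x = G x :> (X -> Y)) :
  (exists g : X -> Y,
     [/\ forall x, U x -> g x = f x,
         Ck (Cfinite 1%N) setT g &
         Ck k (~` closure U) g]) /\
  (bilipschitz_convex_image U -> [lipschitz f x | x in U] ->
   exists g : X -> Y,
     [/\ forall x, U x -> g x = f x,
         Ck (Cfinite 1%N) setT g,
         Ck k (~` closure U) g &
         lipschitz g]).
Proof.
have zero_lip : lipschitz (fun _ : X => 0 : Y).
  by apply/lipschitz_onP; exists 0 => // x y _ _; rewrite subrr normr0 mul0r.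
(* The image of an empty convex set is allowed in case (a); it offers no centre for a gauge, and the
   zero map extends. *)
have [U0|nU0] := pselect (U !=set0); last first.
  have UE : U = set0 by apply: contrapT => /eqP/set0P.
  have [] : exists g : X -> Y, [/\ forall x, U x -> g x = f x, Ck (Cfinite 1) setT g,
      Ck k (~` closure U) g & lipschitz g].
    exists (fun=> 0); split; [by move=> x; rewrite UE|exact: Ck_cst..|exact: zero_lip].
  by move=> g [? ? ? ?]; split=> [|_ _]; exists g.
(* If [Y] is zero, (LA_k) yields no scalar approximation and hence no partition of unity, but the
   zero map is the extension. *)
have [[y0 y0n0]|Y0] := pselect (exists y : Y, y != 0); last first.
  have Yz (y : Y) : y = 0 by apply: contrapT => /eqP yn0; apply: Y0; exists y.
  have [] : exists g : X -> Y, [/\ forall x, U x -> g x = f x, Ck (Cfinite 1) setT g,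
      Ck k (~` closure U) g & lipschitz g].
    exists (fun=> 0); split; [by move=> x _; rewrite [RHS]Yz|exact: Ck_cst..|exact: zero_lip].
  by move=> g [? ? ? ?]; split=> [|_ _]; exists g.
have [C C0 LA] := property_LA_ball XY_LA.
have LA' := ball_approximable_scalar y0n0 C0 LA.
have fG x : U x -> is_diff x f (G x).
  move=> Ux; have [D [fD _]] := f_C1; have dD := fD x Ux.
  suff -> : G x = D x by [].
  apply: clinear_ext => y; have := G_Df x Ux.
  by rewrite (@diff_val _ _ _ _ _ _ _ dD) => /(congr1 (@^~ y)).
have Gc a : closure U a -> forall e, 0 < e ->
    \forall x \near a, closure U x -> `|G x - G a| <= e.
  move=> Aa e e0; have /cvgrPdist_le/(_ e e0) := (subspace_continuousP _ _).1 G_cont a Aa.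
  by move=> near_a; apply: filterS near_a => x; rewrite distrC.
have convex_case : bilipschitz_convex_image U -> exists g : X -> Y,
    [/\ forall x, U x -> g x = f x, Ck (Cfinite 1) setT g, Ck k (~` closure U) g &
        [lipschitz f x | x in U] -> lipschitz g].
  move=> /bilipschitz_convex_image_reflection/(_ U0)[oU qc [K [t [rho [sigma refl]]]]].
  exact: (global_reflection_extension k_pos C0 C0 LA LA' oU fG Gc (fun a _ _ => qc a) refl).
split.
  case: U_type => [/convex_case[g [? ? ? _]]|dom]; first by exists g.
  have geo := lipschitz_domain_reflection dom; have [oU _ _] := dom.
  apply: (local_reflection_extension k_pos C0 C0 LA LA' oU fG Gc).
    by move=> a Aa nUa; case: (geo a Aa nUa).
  by move=> a Aa nUa; case: (geo a Aa nUa).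
by move=> /convex_case[g [? ? ? gl]] fl; exists g; split=> //; exact: gl.
Qed.
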